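(* Let $a_1,\alpha>0$, $\bar k_1\in C^1([-a_1,a_1])$, $\bar k_2\in C^0([-a_1,a_1])$ and $a\in(0,a_1)$. One can choose $\delta>0$ such that, if $\|\bar k_i\|_{[-a_1,a_1]}<\delta$ $(i=1,2)$, the following holds for the unique PC surface $M^2:\ z=f(x,y)$, $f\in C^2(\Pi(a))$, $f(0,0)=0$, $df(0,0)=0$, whose $k_1$-principal direction is parallel to the plane $x-\alpha y=0$ and whose principal curvatures satisfy $k_i(x,0)=\bar k_i(x)$ for $|x|\le a$ $(i=1,2)$. This surface can be represented in the form $$x=\frac{h+\alpha\,U(u,h)}{\sqrt{\alpha^2+1}},\qquad y=\frac{U(u,h)-\alpha h}{\sqrt{\alpha^2+1}},\qquad z=V(u,h),$$ $$U(u,h)=u-\frac{v_0'(u)\,\rho(h)}{(1+v_0'(u)^2)^{1/2}},\qquad V(u,h)=v_0(u)+\frac{\rho(h)}{(1+v_0'(u)^2)^{1/2}},$$ where $v_0(u)=\int_0^u w(\eta)\,d\eta$ and $w(u)$ is the second component of the solution $(X,w)$ to the system $$X(u)=\frac{\sqrt{\alpha^2+1}}{\alpha}\Big(u-\frac{\tilde\rho(X(u))\,w(u)}{(1+w(u)^2)^{1/2}}\Big),\qquad w(u)=\int_0^u\frac{\bar k_1(X(\eta))\,(1+w(\eta)^2)^{3/2}}{\tilde\rho(X(\eta))\,\bar k_1(X(\eta))+\Phi(X(\eta))}\,d\eta .$$ Moreover, $(X,w)$ is the limit of the iterated function sequence $\psi,S(\psi),S(S(\psi)),\dots$ for the operator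 $S$ in $C^0(\mathbb R)\times C^0(\mathbb R)$ $$S:(X,w)\mapsto\Big[\frac{\sqrt{\alpha^2+1}}{\alpha}\Big(u-\frac{\tilde\rho(X)\,w}{(1+w^2)^{1/2}}\Big),\ \int_0^u\frac{\bar k_1(X)(1+w^2)^{3/2}}{\tilde\rho(X)\bar k_1(X)+\Phi(X)}\,d\eta\Big]$$ with the starting point $\psi=\big(\tfrac{\sqrt{\alpha^2+1}}{\alpha}\,u,\ 0\big)$.
   Context: For $a,\alpha>0$, $\Pi(a)=\{(x,y):\ |\alpha x+y|\le a\alpha,\ |x-\alpha y|\le a\}$ is a rectangle in the $xy$-plane of $\mathbb R^3$. $\|u\|_D=\sup_D|u|$. A surface $M^2\subset\mathbb R^3$ is called parallel curved (PC) if there is a sphere or plane $\beta\subset\mathbb R^3$ such that at each point of $M^2$ there is a principal direction tangent to the parallel surface $\beta_d$ (at distance $d$ from $\beta$) through that point. Graphs are oriented by the upward unit normal; $k_1$ is the eigenvalue of the shape operator for the $k_1$-principal direction, $k_2$ is the other eigenvalue, and $k_i(x,y)$ is the value of $k_i$ at $(x,y,f(x,y))$. It is known that for suitable $\delta>0$ and $\|\bar k_i\|_{[-a_1,a_1]}<\delta$ a unique PC surface as described in the claim exists. Notation: $\rho=\rho(h)$ is the solution of the Cauchy problem $\rho''(h)/(1+\rho'(h)^2)^{3/2}=\bar k_2(h\sqrt{\alpha^2+1})$, $\rho(0)=\rho'(0)=0$, on $|h|\le a_1/\sqrt{\alpha^2+1}$ (it exists there for $\bar k_2$ small enough); $\tilde\rho(x)=\rho\big(\tfrac{x}{\sqrt{\alpha^2+1}}\big)$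 and $\Phi(x)=\big(1+\rho'\big(\tfrac{x}{\sqrt{\alpha^2+1}}\big)^2\big)^{-1/2}$. In the integrand of $S$, $X=X(\eta)$ and $w=w(\eta)$.
   Formalization: Uniqueness on Π(a) from data on |x|≤a fails in general; shown instead where h-lines join y=0 inside Π(a), and on Π(a) for surfaces over Π(a_1) with all the data. S is undefined on C^0(R), so it is taken on an interval (-b,b) where the iterates stay in [-a_1,a_1] and which covers Π(a). *)

(* Defs.v *)
From Stdlib Require Import Reals.
From Coquelicot Require Import Coquelicot.
Open Scope R_scope.

(** Closed domains: derivatives are taken relative to the domain, i.e. along
    the filter [within D (locally p)]; on a segment the derivatives at the
    endpoints are therefore one-sided.  A function on [D] is represented by a
    total function whose values outside [D] are irrelevant. *)

Definition segment (c x : R) : Prop := Rabs x <= c.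

Definition deriv_within (D : R -> Prop) (f : R -> R) (x l : R) : Prop :=
  filterdiff f (within D (locally x)) (fun t : R => scal t l).

Definition C1_on (D : R -> Prop) (f : R -> R) : Prop :=
  exists df : R -> R,
    (forall x, D x -> deriv_within D f x (df x)) /\ continuous_on D df.

Definition sup_norm (D : R -> Prop) (u : R -> R) : Rbar :=
  Lub_Rbar (fun y => exists x, D x /\ y = Rabs (u x)).

Definition gradient_within (D : R * R -> Prop) (f : R * R -> R)
    (p : R * R) (fx fy : R) : Prop :=
  @filterdiff R_AbsRing
    (prod_NormedModule R_AbsRing R_NormedModule R_NormedModule) R_NormedModule
    f (within D (locally p)) (fun v : R * R => fst v * fx + snd v * fy).

Record derivatives := Derivatives
  { d_x : R * R -> R; d_y : R * R -> R;
    d_xx : R * R -> R; d_xy : R * R -> R; d_yy : R * R -> R }.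

(** A single mixed derivative suffices, by the symmetry of second derivatives. *)
Definition is_C2 (D : R * R -> Prop) (f : R * R -> R) (J : derivatives) : Prop :=
  (forall p, D p ->
     gradient_within D f p (d_x J p) (d_y J p) /\
     gradient_within D (d_x J) p (d_xx J p) (d_xy J p) /\
     gradient_within D (d_y J) p (d_xy J p) (d_yy J p)) /\
  continuous_on D (d_xx J) /\ continuous_on D (d_xy J) /\
  continuous_on D (d_yy J).

(** Tangent vectors of the graph z = f(x,y) at (p, f p) are given by their
    first two coordinates; [lift J p v] is the corresponding vector of R^3. *)
Definition vec3 := (R * R * R)%type.

Definition dot (v w : vec3) : R :=
  let '(v1, v2, v3) := v in let '(w1, w2, w3) := w in
  v1 * w1 + v2 * w2 + v3 * w3.

Definition sub3 (v w : vec3) : vec3 :=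
  let '(v1, v2, v3) := v in let '(w1, w2, w3) := w in
  (v1 - w1, v2 - w2, v3 - w3).

Definition zero3 : vec3 := (0, 0, 0).

Definition lift (J : derivatives) (p v : R * R) : vec3 :=
  (fst v, snd v, d_x J p * fst v + d_y J p * snd v).

(** I^{-1} II, with the coefficients E, F, G and L, M, N of the two fundamental
    forms of the graph; II is taken with respect to the upward unit normal
    (-f_x, -f_y, 1) / W, W = sqrt (1 + f_x^2 + f_y^2). *)
Definition shape_operator (J : derivatives) (p v : R * R) : R * R :=
  let W := sqrt (1 + d_x J p ^ 2 + d_y J p ^ 2) in
  let E := 1 + d_x J p ^ 2 in
  let F := d_x J p * d_y J p in
  let G := 1 + d_y J p ^ 2 in
  let L := d_xx J p / W in
  let M := d_xy J p / W in
  let N := d_yy J p / W in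
  let II1 := L * fst v + M * snd v in
  let II2 := M * fst v + N * snd v in
  ((G * II1 - F * II2) / (E * G - F ^ 2),
   (E * II2 - F * II1) / (E * G - F ^ 2)).

Definition principal_direction (J : derivatives) (p v : R * R) (k : R) : Prop :=
  v <> (0, 0) /\ shape_operator J p v = (k * fst v, k * snd v).

(** [Plane n c] is {P | n.P = c}; [Sphere c r] has centre c and radius r. *)
Inductive sphere_or_plane :=
| Plane (n : vec3) (c : R)
| Sphere (c : vec3) (r : R).

Definition nondegenerate (beta : sphere_or_plane) : Prop :=
  match beta with
  | Plane n _ => n <> zero3
  | Sphere _ r => 0 < r
  end.

(** [v] is tangent at [P] to the surface parallel to [beta] through [P]: the
    parallel plane with the same normal, resp. the concentric sphere (which
    exists as a surface unless [P] is the centre). *)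
Definition tangent_to_parallel (beta : sphere_or_plane) (P v : vec3) : Prop :=
  match beta with
  | Plane n _ => dot n v = 0
  | Sphere c _ => P <> c /\ dot (sub3 P c) v = 0
  end.

Definition parallel_curved (D : R * R -> Prop) (f : R * R -> R)
    (J : derivatives) : Prop :=
  exists beta, nondegenerate beta /\
    forall p, D p -> exists v k,
      principal_direction J p v k /\
      tangent_to_parallel beta (fst p, snd p, f p) (lift J p v).

Definition Pi_rect (alpha a : R) (p : R * R) : Prop :=
  Rabs (alpha * fst p + snd p) <= a * alpha /\
  Rabs (fst p - alpha * snd p) <= a.

(** [K1], [K2] are the principal curvatures; the second one belongs to a
    principal direction independent of the first, so that K2 = K1 at umbilics. *)
Definition prescribed_PC_graph (alpha a : R) (k1 k2 : R -> R)
    (f : R * R -> R) : Prop :=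
  exists (J : derivatives) (K1 K2 : R * R -> R),
    is_C2 (Pi_rect alpha a) f J /\
    f (0, 0) = 0 /\ d_x J (0, 0) = 0 /\ d_y J (0, 0) = 0 /\
    parallel_curved (Pi_rect alpha a) f J /\
    (forall p, Pi_rect alpha a p -> exists v1 v2 : R * R,
       principal_direction J p v1 (K1 p) /\
       dot (1, - alpha, 0) (lift J p v1) = 0 /\
       principal_direction J p v2 (K2 p) /\
       fst v1 * snd v2 - snd v1 * fst v2 <> 0) /\
    (forall x, Rabs x <= a -> K1 (x, 0) = k1 x /\ K2 (x, 0) = k2 x).

(** [drho] is the derivative of [rho]. *)
Definition cauchy_problem (alpha a1 : R) (k2 rho drho : R -> R) : Prop :=
  let q := sqrt (alpha ^ 2 + 1) in
  rho 0 = 0 /\ drho 0 = 0 /\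
  forall h, segment (a1 / q) h ->
    deriv_within (segment (a1 / q)) rho h (drho h) /\
    exists ddrho,
      deriv_within (segment (a1 / q)) drho h ddrho /\
      ddrho / Rpower (1 + drho h ^ 2) (3 / 2) = k2 (h * q).

Definition rho_tilde (alpha : R) (rho : R -> R) (x : R) : R :=
  rho (x / sqrt (alpha ^ 2 + 1)).

Definition Phi (alpha : R) (drho : R -> R) (x : R) : R :=
  / sqrt (1 + drho (x / sqrt (alpha ^ 2 + 1)) ^ 2).

Definition denominator (alpha : R) (k1 rho drho : R -> R) (x : R) : R :=
  rho_tilde alpha rho x * k1 x + Phi alpha drho x.

Definition operator_S (alpha : R) (k1 rho drho : R -> R)
    (Xw : (R -> R) * (R -> R)) : (R -> R) * (R -> R) :=
  let (X, w) := Xw in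
  (fun u => sqrt (alpha ^ 2 + 1) / alpha
            * (u - rho_tilde alpha rho (X u) * w u / sqrt (1 + w u ^ 2)),
   fun u => RInt (fun eta => k1 (X eta) * Rpower (1 + w eta ^ 2) (3 / 2)
                             / denominator alpha k1 rho drho (X eta)) 0 u).

Definition psi (alpha : R) : (R -> R) * (R -> R) :=
  (fun u => sqrt (alpha ^ 2 + 1) / alpha * u, fun _ => 0).

Definition iterate_S (alpha : R) (k1 rho drho : R -> R) (n : nat) :
    (R -> R) * (R -> R) :=
  Nat.iter n (operator_S alpha k1 rho drho) (psi alpha).

(** [k1], [rho_tilde] and [Phi] carry data only over [-a1,a1], so the operator
    is considered on pairs over an interval (-b,b) whose first component takes
    values in [-a1,a1].  Its values at u depend only on the arguments between
    0 and u. *)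
Definition admissible (a1 b : R) (Xw : (R -> R) * (R -> R)) : Prop :=
  forall u, Rabs u < b ->
    continuous (fst Xw) u /\ continuous (snd Xw) u /\ Rabs (fst Xw u) <= a1.

Definition system_solution (alpha a1 b : R) (k1 rho drho : R -> R)
    (Xw : (R -> R) * (R -> R)) : Prop :=
  admissible a1 b Xw /\
  forall u, Rabs u < b ->
    fst Xw u = fst (operator_S alpha k1 rho drho Xw) u /\
    snd Xw u = snd (operator_S alpha k1 rho drho Xw) u.

Definition uniform_limit (b : R) (s : nat -> (R -> R) * (R -> R))
    (Xw : (R -> R) * (R -> R)) : Prop :=
  forall eps, 0 < eps -> exists N : nat, forall n, (N <= n)%nat ->
    forall u, Rabs u < b ->
      Rabs (fst (s n) u - fst Xw u) < eps /\
      Rabs (snd (s n) u - snd Xw u) < eps.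

Definition v0 (w : R -> R) (u : R) : R := RInt w 0 u.

Definition U (w rho : R -> R) (u h : R) : R :=
  u - Derive (v0 w) u * rho h / sqrt (1 + Derive (v0 w) u ^ 2).

Definition V (w rho : R -> R) (u h : R) : R :=
  v0 w u + rho h / sqrt (1 + Derive (v0 w) u ^ 2).

Definition param_xy (alpha : R) (w rho : R -> R) (u h : R) : R * R :=
  ((h + alpha * U w rho u h) / sqrt (alpha ^ 2 + 1),
   (U w rho u h - alpha * h) / sqrt (alpha ^ 2 + 1)).

(** The graph of [f] over the rectangle is the part of the parametrized surface
    lying over the rectangle. *)
Definition represented (alpha a1 a b : R) (w rho : R -> R)
    (f : R * R -> R) : Prop :=
  forall (p : R * R) (z : R), Pi_rect alpha a p ->
    (z = f p <->
     exists u h, Rabs u < b /\ segment (a1 / sqrt (alpha ^ 2 + 1)) h /\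
       p = param_xy alpha w rho u h /\ z = V w rho u h).

(** The h-line of the parametrization with parameter u meets y = 0 at
    x = X(u), that is for h = X(u) / sqrt (alpha^2 + 1).  The point (u,h) is
    linked to the data on y = 0 if the part of this line between the two
    points stays over the rectangle. *)
Definition linked_to_data (alpha a : R) (X w rho : R -> R) (u h : R) : Prop :=
  let h0 := X u / sqrt (alpha ^ 2 + 1) in
  forall t, Rmin h0 h <= t <= Rmax h0 h ->
    Pi_rect alpha a (param_xy alpha w rho u t).

(* Main.v *)
(** Rotate the plane so that [h] runs along [(1, - alpha)] and [s] along
    [(alpha, 1)], put [q = sqrt (alpha ^ 2 + 1)] and let [F(h,s)] be the height.
    That the [s]-direction is principal is the equation
    [F_hs (1 + F_s^2) = F_h F_s F_ss], i.e. [F_h / sqrt (1 + F_s^2)] depends on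
    [h] only; comparing with [k2] on [y = 0] identifies it with [rho']. Hence the
    sections [h = const] are parallel curves of one plane curve, and the sine
    [z = F_s / sqrt (1 + F_s^2)] of their slope solves [z_h = rho' z z_s] and is
    carried along the lines [s = u - z rho(h)]. On the line [y = 0], where
    [k1] is given, [z] satisfies a linear ODE in [x]; it is solved explicitly,
    and [x |-> u] is then inverted to give the solution [(X, w)] of the system.
    Reading this backwards gives the surface; applied to a given surface, with
    Gronwall's inequality at every step, it gives uniqueness.

    The iteration contracts: the first component of the operator has a small
    Lipschitz constant because [rho] is small, the second one is of Volterra
    type, so that errors are of order [2^-n exp (L |u|)] for large [L]. *)
Require Import Defs.
From Stdlib Require Import Reals Lra Psatz.
From Coquelicot Require Import Coquelicot.
Open Scope R_scope.

(** Inclinations are recorded by sines because [(m / sqrt (1 + m ^ 2))' = m' / (1 + m ^ 2) ^ (3/2)]: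
    curvature becomes a plain derivative, so the Cauchy problem for [rho] turns into a quadrature
    and the equation on [y = 0] into a linear one. The denominator of the system comes from parallel
    curves: at distance [rho] a curvature [kappa] becomes [kappa / (1 - kappa rho)], and solving
    [Phi * kappa / (1 - kappa rho) = k1] for [kappa] gives [k1 / (rho k1 + Phi)]. The obstacle to
    uniqueness is the shape of the domain. The line [y = 0] is a diagonal of the rectangle. Segments
    [h = const] reach it without leaving the rectangle, but lines [u = const] drift by [z rho(h)] in
    the [s]-direction and may leave it before they meet the data. Hence two comparisons: over the
    smaller rectangle at points linked to the data, and, for surfaces over the larger rectangle, at
    every point of the smaller one. The second works because the drift is smaller than the gap
    between the two rectangles, which is one of the conditions that fix [delta]. *)

Definition between (a b x : R) : Prop := Rmin a b <= x <= Rmax a b.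

(** Precomposition with [clamp] makes a function that is continuous relative to a segment continuous
    on the whole line, as the mean value and extreme value theorems require. *)
Definition clamp (a b x : R) : R := Rmax (Rmin a b) (Rmin (Rmax a b) x).

Lemma clamp_between a b x : between a b (clamp a b x).
Proof.
  unfold between, clamp, Rmin, Rmax.
  repeat destruct Rle_dec; lra.
Qed.

Lemma clamp_id a b x : between a b x -> clamp a b x = x.
Proof.
  unfold between, clamp, Rmin, Rmax.
  repeat destruct Rle_dec; lra.
Qed.

Lemma clamp_contract a b x y :
  Rabs (clamp a b x - clamp a b y) <= Rabs (x - y).
Proof.
  unfold clamp, Rmin, Rmax, Rabs.
  repeat destruct Rle_dec; repeat destruct Rcase_abs; lra.
Qed.

Lemma continuous_lipschitz (f : R -> R) (L x : R) :
  (forall y, Rabs (f y - f x) <= L * Rabs (y - x)) -> continuous f x.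
Proof.
  intros H. apply filterlim_locally. intros eps.
  assert (HL : 0 < Rabs L + 1) by (pose proof (Rabs_pos L); lra).
  assert (Hd : 0 < eps / (Rabs L + 1)) by (apply Rdiv_lt_0_compat; [apply cond_pos | lra]).
  exists (mkposreal _ Hd). intros y Hy.
  change (Rabs (y - x) < eps / (Rabs L + 1)) in Hy.
  change (Rabs (f y - f x) < eps).
  apply Rle_lt_trans with (1 := H y).
  pose proof (Rle_abs L). pose proof (Rabs_pos (y - x)).
  apply Rle_lt_trans with ((Rabs L + 1) * Rabs (y - x)); [nra|].
  apply Rmult_lt_compat_l with (r := Rabs L + 1) in Hy; [|lra].
  replace ((Rabs L + 1) * (eps / (Rabs L + 1))) with (eps : R) in Hy by (field; lra).
  lra.
Qed.

Lemma continuous_on_clamp (f : R -> R) (a b : R) :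
  continuous_on (between a b) f ->
  forall x, continuous (fun t => f (clamp a b t)) x.
Proof.
  intros H x. unfold continuous.
  apply filterlim_comp with (within (between a b) (locally (clamp a b x))).
  - intros P HP.
    assert (Hc : continuous (clamp a b) x).
    { apply continuous_lipschitz with 1. intros y.
      rewrite Rmult_1_l. apply clamp_contract. }
    specialize (Hc _ HP). unfold filtermap in *.
    revert Hc. apply filter_imp. intros y Hy. apply Hy, clamp_between.
  - apply H, clamp_between.
Qed.

(** * Limits and derivatives relative to a set *)

Lemma is_filter_lim_within {T : UniformSpace} (D : T -> Prop) (x : T) :
  is_filter_lim (within D (locally x)) x.
Proof.
  intros P HP. unfold within. revert HP. apply filter_imp. auto.
Qed.

Lemma within_proper {T : UniformSpace} (D : T -> Prop) (x : T) :
  D x -> ProperFilter (within D (locally x)).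
Proof.
  intros HD. split.
  - intros P HP. exists x. exact (locally_singleton _ _ HP HD).
  - apply within_filter, locally_filter.
Qed.

(** The common source of all passages between derivatives relative to a set, to a subset and to a
    full neighbourhood. [filterdiff] quantifies over every limit point of the filter; properness of
    [F] leaves only [x]. *)
Lemma filterdiff_filter_le {U V : NormedModule R_AbsRing} (f l : U -> V)
    (F G : (U -> Prop) -> Prop) (x : U) :
  ProperFilter F -> is_filter_lim G x -> filter_le F G ->
  filterdiff f G l -> filterdiff f F l.
Proof.
  intros FF HG HFG [Hl Hd]. split; [exact Hl|].
  intros y Hy.
  assert (HF : is_filter_lim F x) by (intros P HP; apply HFG, HG, HP).
  rewrite <- (is_filter_lim_unique _ _ HF Hy).
  intros eps. apply HFG. apply (Hd _ HG).
Qed.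

Lemma deriv_within_interior (D : R -> Prop) (f : R -> R) (x l : R) :
  locally x D -> deriv_within D f x l -> is_derive f x l.
Proof.
  intros HD H. unfold is_derive.
  apply (filterdiff_filter_le (U := R_NormedModule) (V := R_NormedModule)
           f _ (locally x) (within D (locally x)) x);
    [apply locally_filter | apply is_filter_lim_within | | exact H].
  intros P HP. unfold within in HP.
  generalize (filter_and _ _ HD HP). apply filter_imp. intuition.
Qed.

Lemma is_derive_deriv_within (D : R -> Prop) (f : R -> R) (x l : R) :
  D x -> is_derive f x l -> deriv_within D f x l.
Proof.
  intros HD H. unfold deriv_within.
  apply (filterdiff_filter_le (U := R_NormedModule) (V := R_NormedModule)
           f _ (within D (locally x)) (locally x) x);
    [apply within_proper, HD | intros P HP; exact HP | | exact H].
  apply filter_le_within.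
Qed.

Lemma deriv_within_continuous (D : R -> Prop) (f : R -> R) (x l : R) :
  deriv_within D f x l -> filterlim f (within D (locally x)) (locally (f x)).
Proof.
  intros H.
  apply (filterdiff_continuous_aux (U := R_NormedModule) (V := R_NormedModule)
           (F := within D (locally x)) f (ex_intro (fun l => filterdiff _ _ l) _ H)).
  apply is_filter_lim_within.
Qed.

(** * Vanishing by Gronwall's inequality *)

Lemma locally_between a b x : Rmin a b < x < Rmax a b -> locally x (between a b).
Proof.
  intros [H1 H2].
  generalize (filter_and _ _ (open_gt (Rmin a b) x H1) (open_lt (Rmax a b) x H2)).
  apply filter_imp. unfold between. intros y [? ?]; lra.
Qed.

(** [f ^ 2 exp (- 2 C t)] is nonincreasing, nonnegative and zero at [a]. Derivatives are assumed
    only in the open interval, because at endpoints the surfaces below provide one-sided ones. *)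
Lemma zero_of_gronwall_right (f df : R -> R) (C a b : R) :
  a <= b ->
  continuous_on (between a b) f ->
  (forall t, a < t < b -> is_derive f t (df t) /\ Rabs (df t) <= C * Rabs (f t)) ->
  f a = 0 -> f b = 0.
Proof.
  intros Hab Hc Hd Ha.
  set (E := fun t => f (clamp a b t) * f (clamp a b t) * exp (- 2 * C * t)).
  assert (Hm : Rmin a b = a) by (apply Rmin_left, Hab).
  assert (HM : Rmax a b = b) by (apply Rmax_right, Hab).
  (* [MVT_gen] yields a point of the closed interval, possibly an endpoint where [E] need not be
     differentiable. Capping the derivative at 0 keeps its sign known there too. *)
  destruct (MVT_gen E a b (fun t => Rmin 0 (Derive E t))) as [c [_ Heq]].
  - rewrite Hm, HM. intros t Ht. destruct (Hd t Ht) as [H1 H2].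
    assert (HE : is_derive E t ((2 * f t * df t - 2 * C * (f t * f t)) * exp (- 2 * C * t))).
    { apply is_derive_ext_loc with (fun t => f t * f t * exp (- 2 * C * t)).
      - assert (Hl : locally t (between a b)) by (apply locally_between; lra).
        revert Hl. apply filter_imp. intros y Hy. unfold E. now rewrite clamp_id.
      - auto_derive.
        + repeat split; exists (df t); exact H1.
        + replace (Derive _ t) with (df t) by (symmetry; apply is_derive_unique, H1).
          ring. }
    rewrite (is_derive_unique _ _ _ HE).
    rewrite Rmin_right; [exact HE|].
    assert (f t * df t <= C * (f t * f t)).
    { apply Rle_trans with (Rabs (f t * df t)); [exact (Rle_abs _)|].
      rewrite (Rabs_mult (f t) (df t)).
      replace (f t * f t) with (Rabs (f t) * Rabs (f t))
        by (rewrite <- Rabs_mult; apply Rabs_right; nra).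
      pose proof (Rabs_pos (f t)). nra. }
    pose proof (exp_pos (- 2 * C * t)). nra.
  - intros t _. apply continuity_pt_filterlim.
    unfold E. apply (continuous_mult (K := R_AbsRing)
      (fun t => f (clamp a b t) * f (clamp a b t)) (fun t => exp (- 2 * C * t))).
    + apply (continuous_mult (K := R_AbsRing)); apply continuous_on_clamp, Hc.
    + apply (ex_derive_continuous (fun t => exp (- 2 * C * t))). auto_derive. auto.
  - assert (Hba : between a b a) by (unfold between; lra).
    assert (Hbb : between a b b) by (unfold between; lra).
    unfold E in Heq. rewrite !clamp_id in Heq by assumption. rewrite Ha in Heq.
    pose proof (Rmin_l 0 (Derive E c)).
    pose proof (exp_pos (- 2 * C * b)).
    assert (f b * f b * exp (- 2 * C * b) <= 0) by (unfold E in *; nra).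
    assert (f b * f b <= 0) by nra. nra.
Qed.

Lemma zero_of_gronwall (f df : R -> R) (C a b : R) :
  continuous_on (between a b) f ->
  (forall t, Rmin a b < t < Rmax a b ->
     is_derive f t (df t) /\ Rabs (df t) <= C * Rabs (f t)) ->
  f a = 0 -> f b = 0.
Proof.
  intros Hc Hd Ha. destruct (Rle_dec a b) as [Hab|Hab].
  - apply (zero_of_gronwall_right f df C a b); auto.
    rewrite Rmin_left, Rmax_right in Hd by assumption. exact Hd.
  - assert (Hab' : - a <= - b) by lra.
    replace b with (- - b) by ring.
    apply (zero_of_gronwall_right (fun t => f (- t)) (fun t => - df (- t)) C (- a) (- b));
      auto.
    + intros t Ht. unfold between in Ht. rewrite Rmin_left, Rmax_right in Ht by assumption.
      apply filterlim_comp with (within (between a b) (locally (- t))).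
      * intros P HP.
        assert (Ho : continuous Ropp t) by (apply (continuous_opp (V := R_NormedModule) (fun x : R => x)), continuous_id).
        specialize (Ho _ HP). unfold filtermap, within in *.
        revert Ho. apply filter_imp. intros y Hy Hb. apply Hy.
        unfold between in *. rewrite Rmin_left, Rmax_right in Hb by assumption.
        rewrite Rmin_right, Rmax_left by lra. lra.
      * apply Hc. unfold between. rewrite Rmin_right, Rmax_left by lra. lra.
    + intros t Ht. rewrite Rmin_right, Rmax_left in Hd by lra.
      destruct (Hd (- t)) as [H1 H2]; [lra|]. split.
      * auto_derive; [repeat split; exists (df (- t)); exact H1|].
        replace (Derive _ (- t)) with (df (- t)) by (symmetry; apply is_derive_unique, H1).
        ring.
      * now rewrite Rabs_Ropp.
    + now rewrite Ropp_involutive.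
Qed.

(** * Continuity on sets and the chain rule along curves *)

Lemma continuous_on_comp (D : R -> Prop) (f g : R -> R) :
  continuous_on D f -> (forall y, continuous g y) ->
  continuous_on D (fun x => g (f x)).
Proof.
  intros Hf Hg x Hx. eapply filterlim_comp; [apply Hf, Hx | apply Hg].
Qed.

Lemma continuous_on_op (D : R -> Prop) (f g : R -> R) (op : R -> R -> R) :
  (forall p : R * R, continuous (fun p : R * R => op (fst p) (snd p)) p) ->
  continuous_on D f -> continuous_on D g ->
  continuous_on D (fun x => op (f x) (g x)).
Proof.
  intros Hop Hf Hg x Hx.
  eapply filterlim_comp_2; [apply Hf, Hx | apply Hg, Hx |].
  intros P HP. specialize (Hop (f x, g x) P HP).
  destruct Hop as [eps He].
  exists (ball (f x) eps) (ball (g x) eps); try apply locally_ball.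
  intros a b Ha Hb. apply (He (a, b)). split; assumption.
Qed.

Lemma continuous_on_minus (D : R -> Prop) (f g : R -> R) :
  continuous_on D f -> continuous_on D g -> continuous_on D (fun x => f x - g x).
Proof.
  apply (continuous_on_op D f g Rminus). intros p.
  apply (continuous_minus (V := R_NormedModule)); [apply continuous_fst | apply continuous_snd].
Qed.

Lemma continuous_on_mult (D : R -> Prop) (f g : R -> R) :
  continuous_on D f -> continuous_on D g -> continuous_on D (fun x => f x * g x).
Proof.
  apply (continuous_on_op D f g Rmult). intros p.
  apply (continuous_mult (K := R_AbsRing)); [apply continuous_fst | apply continuous_snd].
Qed.

Lemma continuous_on_plus (D : R -> Prop) (f g : R -> R) :
  continuous_on D f -> continuous_on D g -> continuous_on D (fun x => f x + g x).
Proof.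
  apply (continuous_on_op D f g Rplus). intros p.
  apply (continuous_plus (V := R_NormedModule)); [apply continuous_fst | apply continuous_snd].
Qed.

Lemma continuous_on_of_continuous (D : R -> Prop) (f : R -> R) :
  (forall x, D x -> continuous f x) -> continuous_on D f.
Proof.
  intros H x Hx. apply filterlim_filter_le_1 with (2 := H x Hx).
  apply filter_le_within.
Qed.

Lemma continuous_on_bounded (f : R -> R) (a b : R) :
  continuous_on (between a b) f ->
  exists M, 0 <= M /\ forall x, between a b x -> Rabs (f x) <= M.
Proof.
  intros H.
  destruct (continuity_ab_maj (fun t => Rabs (f (clamp a b t))) (Rmin a b) (Rmax a b))
    as [m [Hm _]].
  - apply Rle_trans with a; [apply Rmin_l | apply Rmax_l].
  - intros c _. apply continuity_pt_filterlim.
    apply (continuous_comp (fun t => f (clamp a b t)) Rabs).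
    + apply continuous_on_clamp, H.
    + apply continuous_Rabs.
  - exists (Rabs (f (clamp a b m))). split; [apply Rabs_pos|].
    intros x Hx. specialize (Hm x Hx). simpl in Hm. now rewrite (clamp_id a b x Hx) in Hm.
Qed.

(** As the curve keeps to [D] on [I], the gradient relative to [D] is enough, even on the boundary
    of [D]; the resulting derivative is relative to [I]. *)
Lemma deriv_along_curve (D : R * R -> Prop) (I : R -> Prop) (f : R * R -> R)
    (c1 c2 : R -> R) (t fx fy l1 l2 : R) :
  I t -> (forall t', I t' -> D (c1 t', c2 t')) ->
  gradient_within D f (c1 t, c2 t) fx fy ->
  is_derive c1 t l1 -> is_derive c2 t l2 ->
  deriv_within I (fun t => f (c1 t, c2 t)) t (l1 * fx + l2 * fy).
Proof.
  intros Ht HID Hf H1 H2.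
  assert (HP := within_proper I t Ht).
  unfold deriv_within.
  apply filterdiff_ext_lin with
    (fun y : R => (scal y l1 : R) * fx + (scal y l2 : R) * fy).
  2: { intros y. unfold scal; simpl; unfold mult; simpl. ring. }
  apply (filterdiff_comp_2 (U := R_NormedModule) (V := R_NormedModule)
           (W := R_NormedModule) c1 c2 (fun a b => f (a, b))
           (fun y => scal y l1) (fun y => scal y l2) (fun a b => a * fx + b * fy)).
  - apply (is_derive_deriv_within I c1 t l1 Ht H1).
  - apply (is_derive_deriv_within I c2 t l2 Ht H2).
  - apply (filterdiff_filter_le
             (U := prod_NormedModule R_AbsRing R_NormedModule R_NormedModule)
             (V := R_NormedModule) _ _ _ (within D (locally (c1 t, c2 t)))
             (c1 t, c2 t)).
    + apply filtermap_proper_filter, HP.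
    + apply (is_filter_lim_within (T := prod_UniformSpace R_UniformSpace R_UniformSpace)).
    + intros P HP'. unfold filtermap, within in *.
      assert (C1 : continuous c1 t) by (apply (ex_derive_continuous c1); exists l1; exact H1).
      assert (C2 : continuous c2 t) by (apply (ex_derive_continuous c2); exists l2; exact H2).
      destruct HP' as [eps He].
      assert (B1 : locally t (fun y => ball (c1 t) eps (c1 y)))
        by exact (C1 _ (locally_ball (c1 t) eps)).
      assert (B2 : locally t (fun y => ball (c2 t) eps (c2 y)))
        by exact (C2 _ (locally_ball (c2 t) eps)).
      generalize (filter_and _ _ B1 B2). apply filter_imp.
      intros y [b1 b2] Hy. apply He; [split; assumption | apply HID, Hy].
    + unfold gradient_within in Hf.
      eapply filterdiff_ext; [|exact Hf]. intros [u v]. reflexivity.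
Qed.

Lemma gradient_within_of_differentiable (D : R * R -> Prop) (f : R * R -> R)
    (x y fx fy : R) :
  D (x, y) -> differentiable_pt_lim (fun x y => f (x, y)) x y fx fy ->
  gradient_within D f (x, y) fx fy.
Proof.
  intros HD H. apply filterdiff_differentiable_pt_lim in H.
  unfold gradient_within.
  apply (filterdiff_filter_le
           (U := prod_NormedModule R_AbsRing R_NormedModule R_NormedModule)
           (V := R_NormedModule) _ _ _ (locally (x, y)) (x, y)).
  - apply (within_proper (T := prod_UniformSpace R_UniformSpace R_UniformSpace)), HD.
  - intros P HP; exact HP.
  - intros P [e He]. exists e. intros z Hz _. apply He, Hz.
  - eapply filterdiff_ext; [|exact H]. intros [u v]. reflexivity.
Qed.

(** * Implicit and inverse functions *)

(** With an inverse [g] at hand and its increments bounded linearly, the first-order expansion of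
    [f] at [(g h s, h)] only has to be solved for the increment of [g]. *)
Lemma differentiable_implicit (f g : R -> R -> R) (h s fu fh C : R) :
  differentiable_pt_lim f (g h s) h fu fh -> fu <> 0 -> 1 <= C ->
  locally_2d (fun h' s' => f (g h' s') h' = s' /\
     Rabs (g h' s' - g h s) <= C * Rmax (Rabs (h' - h)) (Rabs (s' - s))) h s ->
  differentiable_pt_lim g h s (- fh / fu) (/ fu).
Proof.
  intros Hf Hu HC Hg eps.
  assert (Hfu : 0 < Rabs fu) by (apply Rabs_pos_lt, Hu).
  (* Dividing by [fu] and passing from increments of [(g, h)] to those of [(h, s)] costs the factor
     [C / Rabs fu], which this tolerance absorbs. *)
  assert (He : 0 < eps * Rabs fu / C).
  { apply Rdiv_lt_0_compat; [|lra]. apply Rmult_lt_0_compat; [apply cond_pos|assumption]. }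
  destruct (Hf (mkposreal _ He)) as [d Hd]. simpl in Hd.
  assert (HdC : 0 < d / C) by (apply Rdiv_lt_0_compat; [apply cond_pos|lra]).
  assert (Heq : f (g h s) h = s).
  { apply locally_2d_singleton in Hg. apply Hg. }
  assert (Hl : locally_2d (fun h' s' => Rabs (h' - h) < d / C /\ Rabs (s' - s) < d / C) h s)
    by (exists (mkposreal _ HdC); simpl; auto).
  generalize (locally_2d_and _ _ _ _ Hg Hl).
  apply locally_2d_impl. apply locally_2d_forall. intros h' s' [[E B] [L1 L2]].
  set (m := Rmax (Rabs (h' - h)) (Rabs (s' - s))) in *.
  assert (Hm : m < d / C) by (apply Rmax_lub_lt; assumption).
  assert (Hm0 : 0 <= m) by (apply Rle_trans with (2 := Rmax_l _ _); apply Rabs_pos).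
  assert (HCm : C * m < d).
  { apply Rmult_lt_compat_l with (r := C) in Hm; [|lra].
    replace (C * (d / C)) with (d : R) in Hm by (field; lra). exact Hm. }
  assert (Hh : Rabs (h' - h) <= C * m).
  { apply Rle_trans with m; [apply Rmax_l|]. nra. }
  specialize (Hd (g h' s') h').
  assert (Hd' := Hd ltac:(lra) ltac:(lra)). clear Hd. rewrite E, Heq in Hd'.
  assert (Hmx : Rmax (Rabs (g h' s' - g h s)) (Rabs (h' - h)) <= C * m)
    by (apply Rmax_lub; assumption).
  replace (g h' s' - g h s - (- fh / fu * (h' - h) + / fu * (s' - s)))
    with (- / fu * (s' - s - (fu * (g h' s' - g h s) + fh * (h' - h))))
    by (field; assumption).
  rewrite Rabs_mult, Rabs_Ropp, Rabs_inv.
  apply Rle_trans with (/ Rabs fu * (eps * Rabs fu / C * (C * m))).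
  - apply Rmult_le_compat_l; [left; apply Rinv_0_lt_compat, Hfu|].
    apply Rle_trans with (1 := Hd'). apply Rmult_le_compat_l; lra.
  - right. field. lra.
Qed.

Lemma increment_ge (f df : R -> R) (c x y : R) :
  (forall x, is_derive f x (df x)) -> (forall x, c <= df x) ->
  x <= y -> c * (y - x) <= f y - f x.
Proof.
  intros Hf Hc Hxy.
  destruct (MVT_gen f x y df) as [z [_ Hz]].
  - auto.
  - intros t _. apply continuity_pt_filterlim, (ex_derive_continuous f).
    exists (df t). apply Hf.
  - rewrite Hz. apply Rmult_le_compat_r; [lra | apply Hc].
Qed.

Lemma increment_abs_ge (f df : R -> R) (c x y : R) :
  (forall x, is_derive f x (df x)) -> (forall x, c <= df x) ->
  c * Rabs (y - x) <= Rabs (f y - f x).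
Proof.
  intros Hf Hc. destruct (Rle_dec x y) as [H|H].
  - pose proof (increment_ge f df c x y Hf Hc H).
    rewrite (Rabs_right (y - x)) by lra. pose proof (Rle_abs (f y - f x)). lra.
  - assert (H' : y <= x) by lra. pose proof (increment_ge f df c y x Hf Hc H').
    rewrite (Rabs_left1 (y - x)) by lra.
    rewrite (Rabs_minus_sym (f y)). pose proof (Rle_abs (f x - f y)). lra.
Qed.

(** A sigma type, so that the inverse functions [axis_of_u] and [foot] are projections. Growth at
    rate at least [c] reaches [y] within distance [Rabs (y - f 0) / c] of 0. *)
Definition surjective_of_increasing (f df : R -> R) (c : R)
    (Hf : forall x, is_derive f x (df x)) (Hpos : 0 < c) (Hc : forall x, c <= df x)
    (y : R) : {x | f x = y}.
Proof.
  set (r := Rabs (y - f 0) / c).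
  assert (Hr : 0 <= r).
  { apply Rmult_le_pos; [apply Rabs_pos | left; apply Rinv_0_lt_compat, Hpos]. }
  assert (Hcr : c * r = Rabs (y - f 0)) by (unfold r; field; lra).
  destruct (IVT_gen f (- r) r y) as [x [_ Hx]].
  - intros t. apply continuity_pt_filterlim, (ex_derive_continuous f).
    exists (df t). apply Hf.
  - pose proof (increment_ge f df c 0 r Hf Hc Hr).
    pose proof (increment_ge f df c (- r) 0 Hf Hc ltac:(lra)).
    assert (f (- r) <= y <= f r).
    { rewrite Rminus_0_r in H. replace (c * (0 - - r)) with (c * r) in H0 by ring.
      rewrite Hcr in *. pose proof (Rle_abs (y - f 0)).
      pose proof (Rle_abs (- (y - f 0))). rewrite Rabs_Ropp in *. lra. }
    rewrite Rmin_left, Rmax_right by lra. assumption.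
  - exists x. exact Hx.
Defined.

(** The two-variable rule with a dummy variable on which nothing depends; the lower bound on [df]
    makes the inverse Lipschitz with constant [/ c]. *)
Lemma is_derive_right_inverse (f df g : R -> R) (c : R) :
  (forall x, is_derive f x (df x)) -> 0 < c -> (forall x, c <= df x) ->
  (forall y, f (g y) = y) ->
  forall y, is_derive g y (/ df (g y)).
Proof.
  intros Hf Hpos Hc Hg y.
  apply is_derive_Reals, (differentiable_pt_lim_proj1_1 g y 0).
  assert (H := differentiable_implicit (fun u _ => f u) (fun _ s => g s) 0 y
                 (df (g y)) 0 (Rmax 1 (/ c))).
  assert (D : differentiable_pt_lim (fun _ s => g s) 0 y (- 0 / df (g y)) (/ df (g y))).
  { apply H.
    - apply differentiable_pt_lim_proj1_0, is_derive_Reals, Hf.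
    - specialize (Hc (g y)). lra.
    - apply Rmax_l.
    - apply locally_2d_forall. intros h' s'. split; [apply Hg|].
      assert (B := increment_abs_ge f df c (g y) (g s') Hf Hc). rewrite !Hg in B.
      apply Rle_trans with (/ c * Rabs (s' - y)).
      + apply Rmult_le_reg_l with c; [exact Hpos|].
        replace (c * (/ c * Rabs (s' - y))) with (Rabs (s' - y)) by (field; lra). exact B.
      + apply Rmult_le_compat; [left; apply Rinv_0_lt_compat, Hpos | apply Rabs_pos
                               | apply Rmax_r | apply Rmax_r]. }
  intros eps. destruct (D eps) as [d Hd]. exists d. intros u v Hu Hv.
  specialize (Hd 0 u). rewrite Rminus_0_r, Rabs_R0 in Hd.
  specialize (Hd (cond_pos d) Hu).
  replace (- 0 / df (g y) * 0 + / df (g y) * (u - y))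
    with (/ df (g y) * (u - y) + 0 * (v - 0)) in Hd
    by (field; specialize (Hc (g y)); lra).
  apply Rle_trans with (1 := Hd). apply Rmult_le_compat_l; [left; apply cond_pos|].
  rewrite Rmax_right by apply Rabs_pos. apply Rmax_l.
Qed.

(** * Bounds for integrals *)

Lemma ex_RInt_of_continuous (g : R -> R) (a b : R) :
  (forall x, continuous g x) -> ex_RInt g a b.
Proof. intros H. apply (ex_RInt_continuous (V := R_CompleteNormedModule)). auto. Qed.

Lemma is_derive_RInt_of_continuous (g : R -> R) (a x : R) :
  (forall x, continuous g x) -> is_derive (fun x => RInt g a x) x (g x).
Proof.
  intros H. apply (is_derive_RInt (V := R_NormedModule) g _ a).
  - apply filter_forall. intros y.
    apply (RInt_correct (V := R_CompleteNormedModule)), ex_RInt_of_continuous, H.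
  - apply H.
Qed.

Lemma Rabs_RInt_le_const (g : R -> R) (a b M : R) :
  (forall x, between a b x -> continuous g x) ->
  (forall x, between a b x -> Rabs (g x) <= M) ->
  Rabs (RInt g a b) <= M * Rabs (b - a).
Proof.
  intros Hg HM.
  assert (He : ex_RInt g a b) by (apply (ex_RInt_continuous (V := R_CompleteNormedModule)); exact Hg).
  unfold between in *.
  destruct (Rle_dec a b) as [H|H].
  - rewrite Rmin_left, Rmax_right in HM by assumption.
    rewrite (Rabs_right (b - a)) by lra. rewrite Rmult_comm.
    now apply abs_RInt_le_const.
  - rewrite Rmin_right, Rmax_left in HM by lra.
    rewrite <- (opp_RInt_swap (V := R_CompleteNormedModule)) by (apply ex_RInt_swap; exact He).
    unfold opp; simpl. rewrite Rabs_Ropp, (Rabs_left1 (b - a)) by lra.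
    replace (M * - (b - a)) with ((a - b) * M) by ring.
    apply abs_RInt_le_const; [lra | apply ex_RInt_swap, He | exact HM].
Qed.

(** Beyond the clamped endpoint the integrand vanishes, so the bound does not grow with [x]. All
    global smallness estimates below rest on this. *)
Lemma Rabs_RInt_le_support (g : R -> R) (A M x : R) :
  0 <= A -> (forall x, continuous g x) -> (forall x, Rabs (g x) <= M) ->
  (forall x, A <= Rabs x -> g x = 0) ->
  Rabs (RInt g 0 x) <= M * A.
Proof.
  intros HA Hg HM Hs.
  assert (HM0 : 0 <= M) by (apply Rle_trans with (2 := HM 0), Rabs_pos).
  set (y := clamp (- A) A x).
  assert (Hy : between (- A) A y) by apply clamp_between.
  unfold between in Hy. rewrite Rmin_left, Rmax_right in Hy by lra.
  rewrite <- (RInt_Chasles (V := R_CompleteNormedModule) g 0 y x)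
    by (apply ex_RInt_of_continuous, Hg).
  rewrite (RInt_ext (V := R_CompleteNormedModule) g (fun _ => 0) y x).
  - rewrite (RInt_const (V := R_CompleteNormedModule)).
    unfold plus, scal; simpl; unfold mult; simpl. rewrite Rmult_0_r, Rplus_0_r.
    apply Rle_trans with (M * Rabs (y - 0)).
    + apply Rabs_RInt_le_const; auto.
    + apply Rmult_le_compat_l; [exact HM0|]. apply Rabs_le. lra.
  - intros t Ht. apply Hs. revert Ht. unfold y, clamp.
    unfold Rmin, Rmax, Rabs. repeat destruct Rle_dec; repeat destruct Rcase_abs; lra.
Qed.

(** In the norm with weight [exp (- L |t|)], integration from 0 has norm at most [1 / L]. For large
    [L] it therefore turns any Lipschitz integrand into a contraction. *)
Lemma Rabs_RInt_le_exp (g : R -> R) (M L u : R) :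
  0 < L -> 0 <= M ->
  (forall t, between 0 u t -> continuous g t) ->
  (forall t, between 0 u t -> Rabs (g t) <= M * exp (L * Rabs t)) ->
  Rabs (RInt g 0 u) <= M / L * exp (L * Rabs u).
Proof.
  intros HL HM.
  assert (Hpos : forall (g : R -> R) u, 0 <= u ->
    (forall t, 0 <= t <= u -> continuous g t) ->
    (forall t, 0 <= t <= u -> Rabs (g t) <= M * exp (L * t)) ->
    Rabs (RInt g 0 u) <= M / L * exp (L * u)).
  { clear g u. intros g u Hu Hc Hb.
    assert (He : ex_RInt g 0 u).
    { apply (ex_RInt_continuous (V := R_CompleteNormedModule)).
      rewrite Rmin_left, Rmax_right by assumption. exact Hc. }
    assert (HI : is_RInt (fun t => M * exp (L * t)) 0 u (M / L * exp (L * u) - M / L)).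
    { replace (M / L * exp (L * u) - M / L)
        with (minus (M / L * exp (L * u)) (M / L * exp (L * 0)) : R).
      - apply (is_RInt_derive (V := R_CompleteNormedModule) (fun t => M / L * exp (L * t))).
        + intros t _. auto_derive; [auto|]. field. lra.
        + intros t _. apply (ex_derive_continuous (fun t => M * exp (L * t))).
          auto_derive. auto.
      - rewrite Rmult_0_r, exp_0. unfold minus, plus, opp; simpl. ring. }
    apply Rle_trans with (1 := abs_RInt_le g 0 u Hu He).
    apply Rle_trans with (RInt (fun t => M * exp (L * t)) 0 u).
    - apply RInt_le; [exact Hu | | exists (M / L * exp (L * u) - M / L); exact HI
                     | intros t Ht; apply Hb; lra].
      apply ((ex_RInt_norm g 0 u)), He.
    - rewrite (is_RInt_unique (V := R_CompleteNormedModule) _ _ _ _ HI).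
      assert (0 <= M / L) by (apply Rmult_le_pos; [lra | left; apply Rinv_0_lt_compat, HL]).
      lra. }
  intros Hc Hb. unfold between in *. destruct (Rle_dec 0 u) as [Hu|Hu].
  - rewrite Rmin_left, Rmax_right in Hc, Hb by assumption.
    rewrite (Rabs_right u) by lra. apply Hpos; auto.
    intros t Ht. rewrite <- (Rabs_right t) at 2 by lra. auto.
  - rewrite Rmin_right, Rmax_left in Hc, Hb by lra.
    rewrite (Rabs_left1 u) by lra.
    assert (He : ex_RInt g (- 0) (- - u)).
    { apply (ex_RInt_continuous (V := R_CompleteNormedModule)).
      rewrite Ropp_0, Ropp_involutive, Rmin_right, Rmax_left by lra. exact Hc. }
    replace (RInt g 0 u) with (RInt (fun t => - g (- t)) 0 (- u)).
    + apply (Hpos (fun t => - g (- t))); [lra | |].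
      * intros t Ht. apply (continuous_opp (V := R_NormedModule) (fun t => g (- t))).
        apply (continuous_comp Ropp g); [|apply Hc; lra].
        apply (continuous_opp (V := R_NormedModule) (fun x : R => x)), continuous_id.
      * intros t Ht. rewrite Rabs_Ropp. specialize (Hb (- t)).
        rewrite Rabs_Ropp, (Rabs_right t) in Hb by lra. apply Hb. lra.
    + apply is_RInt_unique.
      apply (is_RInt_comp_opp (V := R_CompleteNormedModule)).
      rewrite Ropp_0, Ropp_involutive in *.
      apply (RInt_correct (V := R_CompleteNormedModule)), He.
Qed.

(** * Functions on a symmetric segment and their extension *)

Lemma Rabs_lt_of_sup_norm (D : R -> Prop) (k : R -> R) (d x : R) :
  Rbar_lt (sup_norm D k) d -> D x -> Rabs (k x) < d.
Proof.
  intros H Hx. unfold sup_norm in H.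
  destruct (Lub_Rbar_correct (fun y => exists x, D x /\ y = Rabs (k x))) as [Hub _].
  change (Rbar_lt (Rabs (k x)) d). eapply Rbar_le_lt_trans; [|exact H].
  apply Hub. exists x. auto.
Qed.

Lemma segment_between c x : 0 <= c -> (segment c x <-> between (- c) c x).
Proof.
  intros Hc. unfold segment, between. rewrite Rmin_left, Rmax_right by lra.
  apply Rabs_le_between.
Qed.

Lemma continuous_on_sub {T V : UniformSpace} (D D' : T -> Prop) (f : T -> V) :
  (forall x, D' x -> D x) -> continuous_on D f -> continuous_on D' f.
Proof.
  intros HD Hf x Hx. apply filterlim_filter_le_1 with (2 := Hf x (HD x Hx)).
  intros P HP. unfold within in *. revert HP. apply filter_imp. auto.
Qed.

Lemma deriv_within_sub (D D' : R -> Prop) (f : R -> R) (x l : R) :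
  (forall x, D' x -> D x) -> D' x -> deriv_within D f x l -> deriv_within D' f x l.
Proof.
  intros HD Hx H.
  apply (filterdiff_filter_le (U := R_NormedModule) (V := R_NormedModule)
           f _ _ (within D (locally x)) x);
    [apply within_proper, Hx | apply is_filter_lim_within | | exact H].
  intros P HP. unfold within in *. revert HP. apply filter_imp. auto.
Qed.

Definition lipschitz_on (c : R) (f : R -> R) : Prop :=
  exists L, 0 <= L /\ forall x y, segment c x -> segment c y ->
    Rabs (f x - f y) <= L * Rabs (x - y).

Lemma lipschitz_of_C1_on (c : R) (f : R -> R) :
  0 <= c -> C1_on (segment c) f -> lipschitz_on c f.
Proof.
  intros Hc [df [Hd Hcont]].
  assert (HS : forall x, between (- c) c x -> segment c x) by (intros x; now apply segment_between).
  destruct (continuous_on_bounded df (- c) c) as [M [HM0 HM]].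
  { apply continuous_on_sub with (2 := Hcont), HS. }
  exists M. split; [exact HM0|]. intros x y Hx Hy.
  assert (HI : forall t, between x y t -> segment c t).
  { intros t Ht. apply segment_between in Hx; [|exact Hc]. apply segment_between in Hy; [|exact Hc].
    apply segment_between; [exact Hc|]. unfold between in *.
    revert Ht Hx Hy. unfold Rmin, Rmax. repeat destruct Rle_dec; lra. }
  assert (Hcl : continuous_on (between x y) f).
  { intros t Ht. apply (deriv_within_continuous _ f t (df t)).
    apply deriv_within_sub with (segment c); auto. }
  (* The mean value point may be an endpoint, where only a one-sided derivative exists; the default
     0 meets the bound trivially. *)
  destruct (MVT_gen (fun t => f (clamp x y t)) x y
              (fun t => if Rlt_dec (Rmin x y) t then
                          if Rlt_dec t (Rmax x y) then df t else 0 else 0))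
    as [z [Hz Heq]].
  - intros t Ht. destruct Rlt_dec; [|lra]. destruct Rlt_dec; [|lra].
    assert (Hl := locally_between x y t Ht).
    apply is_derive_ext_loc with f.
    + revert Hl. apply filter_imp. intros s Hs. now rewrite clamp_id.
    + apply (deriv_within_interior (between x y)); [exact Hl|].
      apply deriv_within_sub with (segment c); auto.
      * unfold between; lra.
      * apply Hd, HI. unfold between; lra.
  - intros t _. apply continuity_pt_filterlim. now apply continuous_on_clamp.
  - assert (Bx : between x y x) by (unfold between; split; [apply Rmin_l | apply Rmax_l]).
    assert (By : between x y y) by (unfold between; split; [apply Rmin_r | apply Rmax_r]).
    rewrite !clamp_id in Heq by assumption.
    rewrite Rabs_minus_sym, Heq, Rabs_mult, (Rabs_minus_sym y x).
    apply Rmult_le_compat_r; [apply Rabs_pos|].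
    destruct Rlt_dec; [destruct Rlt_dec|]; try (now rewrite Rabs_R0).
    apply HM. apply segment_between; [exact Hc|]. apply HI. exact Hz.
Qed.

Lemma lipschitz_on_bounded (c : R) (f : R -> R) :
  0 <= c -> lipschitz_on c f -> exists M, 0 <= M /\ forall x, segment c x -> Rabs (f x) <= M.
Proof.
  intros Hc [L [HL Hf]]. exists (Rabs (f 0) + L * c).
  split; [pose proof (Rabs_pos (f 0)); nra|]. intros x Hx.
  specialize (Hf x 0 Hx). assert (S0 : segment c 0) by (unfold segment; now rewrite Rabs_R0).
  specialize (Hf S0). rewrite Rminus_0_r in Hf. unfold segment in Hx.
  replace (f x) with (f 0 + (f x - f 0)) by ring.
  apply Rle_trans with (1 := Rabs_triang _ _). nra.
Qed.

Lemma lipschitz_on_mult (c : R) (f g : R -> R) :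
  0 <= c -> lipschitz_on c f -> lipschitz_on c g -> lipschitz_on c (fun x => f x * g x).
Proof.
  intros Hc Hf Hg.
  destruct (lipschitz_on_bounded c f Hc Hf) as [M [HM Bf]].
  destruct (lipschitz_on_bounded c g Hc Hg) as [N [HN Bg]].
  destruct Hf as [L [HL Hf]]. destruct Hg as [K [HK Hg]].
  exists (L * N + M * K). split; [nra|]. intros x y Hx Hy.
  replace (f x * g x - f y * g y) with ((f x - f y) * g x + f y * (g x - g y)) by ring.
  apply Rle_trans with (1 := Rabs_triang _ _). rewrite !Rabs_mult.
  specialize (Hf x y Hx Hy). specialize (Hg x y Hx Hy).
  specialize (Bf y Hy). specialize (Bg x Hx).
  pose proof (Rabs_pos (f x - f y)). pose proof (Rabs_pos (g x - g y)).
  pose proof (Rabs_pos (f y)). pose proof (Rabs_pos (g x)).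
  assert (Rabs (f x - f y) * Rabs (g x) <= L * Rabs (x - y) * N)
    by (apply Rmult_le_compat; assumption).
  assert (Rabs (f y) * Rabs (g x - g y) <= M * (K * Rabs (x - y)))
    by (apply Rmult_le_compat; assumption).
  lra.
Qed.

Lemma lipschitz_on_plus (c : R) (f g : R -> R) :
  lipschitz_on c f -> lipschitz_on c g -> lipschitz_on c (fun x => f x + g x).
Proof.
  intros [L [HL Hf]] [K [HK Hg]]. exists (L + K). split; [lra|]. intros x y Hx Hy.
  replace (f x + g x - (f y + g y)) with ((f x - f y) + (g x - g y)) by ring.
  apply Rle_trans with (1 := Rabs_triang _ _).
  specialize (Hf x y Hx Hy). specialize (Hg x y Hx Hy). lra.
Qed.

Lemma lipschitz_on_inv (c m : R) (f : R -> R) :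
  0 < m -> (forall x, segment c x -> m <= f x) ->
  lipschitz_on c f -> lipschitz_on c (fun x => / f x).
Proof.
  intros Hm Hf [L [HL HfL]]. exists (L / (m * m)).
  split; [apply Rmult_le_pos; [lra | left; apply Rinv_0_lt_compat; nra]|].
  intros x y Hx Hy. assert (Ax := Hf x Hx). assert (Ay := Hf y Hy).
  replace (/ f x - / f y) with ((f y - f x) * / (f x * f y)) by (field; lra).
  rewrite Rabs_mult, Rabs_inv, Rabs_minus_sym.
  rewrite (Rabs_right (f x * f y)) by nra.
  replace (L / (m * m) * Rabs (x - y)) with (L * Rabs (x - y) * / (m * m))
    by (unfold Rdiv; ring).
  apply Rmult_le_compat; [apply Rabs_pos | left; apply Rinv_0_lt_compat; nra
                         | auto | apply Rinv_le_contravar; nra].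
Qed.

Lemma lipschitz_on_of_is_derive (c : R) (f df : R -> R) :
  0 <= c -> (forall x, is_derive f x (df x)) -> (forall x, continuous df x) ->
  lipschitz_on c f.
Proof.
  intros Hc Hf Hdf. apply lipschitz_of_C1_on; [exact Hc|]. exists df. split.
  - intros x Hx. now apply is_derive_deriv_within.
  - intros x Hx. apply filterlim_filter_le_1 with (2 := Hdf x). apply filter_le_within.
Qed.

(** Constant continuation past the endpoints, multiplied by a cutoff that falls linearly from 1 to 0
    on [c <= |x| <= c + 1]. The factor lies in [[0, 1]], so the sup bound survives. *)
Lemma compactly_supported_extension (k : R -> R) (c d : R) :
  0 <= c -> continuous_on (segment c) k -> (forall x, segment c x -> Rabs (k x) < d) ->
  exists kc : R -> R,
    (forall x, continuous kc x) /\ (forall x, segment c x -> kc x = k x) /\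
    (forall x, Rabs (kc x) <= d) /\ (forall x, c + 1 <= Rabs x -> kc x = 0).
Proof.
  intros Hc Hk Hd.
  set (chi := fun x => 1 - clamp 0 1 (Rabs x - c)).
  assert (Hcl : forall t, 0 <= clamp 0 1 t <= 1).
  { intros t. assert (B := clamp_between 0 1 t). unfold between in B.
    rewrite Rmin_left, Rmax_right in B by lra. exact B. }
  exists (fun x => k (clamp (- c) c x) * chi x). repeat split.
  - intros x. apply (continuous_mult (K := R_AbsRing)).
    + apply continuous_on_clamp. apply continuous_on_sub with (2 := Hk).
      intros t. now apply segment_between.
    + apply continuous_lipschitz with 1. intros y. unfold chi.
      replace (1 - clamp 0 1 (Rabs y - c) - (1 - clamp 0 1 (Rabs x - c)))
        with (clamp 0 1 (Rabs x - c) - clamp 0 1 (Rabs y - c)) by ring.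
      apply Rle_trans with (1 := clamp_contract _ _ _ _).
      replace (Rabs x - c - (Rabs y - c)) with (Rabs x - Rabs y) by ring.
      rewrite Rmult_1_l, (Rabs_minus_sym y x). apply Rabs_triang_inv2.
  - intros x Hx. rewrite clamp_id by (now apply segment_between).
    unfold chi. replace (clamp 0 1 (Rabs x - c)) with 0; [ring|].
    unfold segment in Hx. unfold clamp, Rmin, Rmax. repeat destruct Rle_dec; lra.
  - intros x. rewrite Rabs_mult. specialize (Hd (clamp (- c) c x)).
    assert (S : segment c (clamp (- c) c x)) by (apply segment_between; [exact Hc | apply clamp_between]).
    specialize (Hd S). pose proof (Hcl (Rabs x - c)).
    rewrite (Rabs_right (chi x)) by (unfold chi; lra).
    pose proof (Rabs_pos (k (clamp (- c) c x))).
    assert (Rabs (k (clamp (- c) c x)) * chi x <= Rabs (k (clamp (- c) c x)) * 1)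
      by (apply Rmult_le_compat_l; unfold chi; lra). lra.
  - intros x Hx. unfold chi. replace (clamp 0 1 (Rabs x - c)) with 1; [ring|].
    unfold clamp, Rmin, Rmax. repeat destruct Rle_dec; lra.
Qed.
Lemma Rabs_increment_le (f df : R -> R) (M x y : R) :
  (forall t, is_derive f t (df t)) -> (forall t, Rabs (df t) <= M) ->
  Rabs (f y - f x) <= M * Rabs (y - x).
Proof.
  intros Hf HM.
  destruct (MVT_gen f x y df) as [z [_ Hz]].
  - auto.
  - intros t _. apply continuity_pt_filterlim, (ex_derive_continuous f).
    exists (df t). apply Hf.
  - rewrite Hz, Rabs_mult. apply Rmult_le_compat_r; [apply Rabs_pos | apply HM].
Qed.

(** * Differentiable functions of two variables *)

Lemma differentiable_comp1 (f : R -> R) (g : R -> R -> R) (x y l gx gy : R) :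
  is_derive f (g x y) l -> differentiable_pt_lim g x y gx gy ->
  differentiable_pt_lim (fun a b => f (g a b)) x y (l * gx) (l * gy).
Proof.
  intros Hf Hg.
  assert (H := differentiable_pt_lim_comp (fun a _ => f a) g g x y l 0 gx gy gx gy
    (differentiable_pt_lim_proj1_0 f _ _ l (proj1 (is_derive_Reals _ _ _) Hf)) Hg Hg).
  now rewrite !Rmult_0_l, !Rplus_0_r in H.
Qed.

Lemma differentiable_fst x y : differentiable_pt_lim (fun a _ => a) x y 1 0.
Proof.
  apply differentiable_pt_lim_proj1_0, is_derive_Reals.
  apply (is_derive_id (K := R_AbsRing)).
Qed.

Lemma differentiable_snd x y : differentiable_pt_lim (fun _ b => b) x y 0 1.
Proof.
  intros e. exists e. intros u v _ _.
  replace (v - y - (0 * (u - x) + 1 * (v - y))) with 0 by ring.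
  rewrite Rabs_R0. apply Rmult_le_pos; [left; apply cond_pos|].
  apply Rle_trans with (2 := Rmax_l _ _), Rabs_pos.
Qed.

Lemma differentiable_linear (m n x y : R) :
  differentiable_pt_lim (fun a b => m * a + n * b) x y m n.
Proof.
  intros e. exists e. intros u v _ _.
  replace (m * u + n * v - (m * x + n * y) - (m * (u - x) + n * (v - y))) with 0 by ring.
  rewrite Rabs_R0. apply Rmult_le_pos; [left; apply cond_pos|].
  apply Rle_trans with (2 := Rmax_l _ _), Rabs_pos.
Qed.

Lemma differentiable_plus (f g : R -> R -> R) (x y fx fy gx gy : R) :
  differentiable_pt_lim f x y fx fy -> differentiable_pt_lim g x y gx gy ->
  differentiable_pt_lim (fun a b => f a b + g a b) x y (fx + gx) (fy + gy).
Proof.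
  intros Hf Hg.
  assert (H := differentiable_pt_lim_comp (fun a b => 1 * a + 1 * b) f g x y 1 1 fx fy gx gy
    (differentiable_linear 1 1 _ _) Hf Hg).
  rewrite !Rmult_1_l in H. revert H. apply differentiable_pt_lim_ext.
  apply locally_2d_forall. intros. ring.
Qed.

Lemma differentiable_mult (f g : R -> R -> R) (x y fx fy gx gy : R) :
  differentiable_pt_lim f x y fx fy -> differentiable_pt_lim g x y gx gy ->
  differentiable_pt_lim (fun a b => f a b * g a b) x y
    (g x y * fx + f x y * gx) (g x y * fy + f x y * gy).
Proof.
  intros Hf Hg.
  refine (differentiable_pt_lim_comp Rmult f g x y (g x y) (f x y) fx fy gx gy _ Hf Hg).
  intros e. exists e. intros u v Hu Hv.
  replace (u * v - f x y * g x y - (g x y * (u - f x y) + f x y * (v - g x y)))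
    with ((u - f x y) * (v - g x y)) by ring.
  rewrite Rabs_mult. apply Rmult_le_compat; try apply Rabs_pos; [lra | apply Rmax_r].
Qed.

Lemma continuous_of_differentiable (f : R -> R -> R) (x y fx fy : R) :
  differentiable_pt_lim f x y fx fy ->
  continuous (fun p : R * R => f (fst p) (snd p)) (x, y).
Proof.
  intros H. apply filterdiff_differentiable_pt_lim in H.
  apply (filterdiff_continuous
    (U := prod_NormedModule R_AbsRing R_NormedModule R_NormedModule) (V := R_NormedModule)).
  eexists. exact H.
Qed.

(** * Rotated axes and the shape operator *)

Section Rotation.

Variable alpha : R.
Local Notation q := (sqrt (alpha ^ 2 + 1)).

Definition rot_h (p : R * R) : R := (fst p - alpha * snd p) / q.
Definition rot_s (p : R * R) : R := (alpha * fst p + snd p) / q.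

(** Derivatives of the graph along the unit vectors [(1, - alpha) / q] and
    [(alpha, 1) / q], the latter being the horizontal part of the [k1]-direction. *)
Definition jet_h (J : derivatives) p := (d_x J p - alpha * d_y J p) / q.
Definition jet_s (J : derivatives) p := (alpha * d_x J p + d_y J p) / q.
Definition jet_hh (J : derivatives) p :=
  (d_xx J p - 2 * alpha * d_xy J p + alpha ^ 2 * d_yy J p) / (alpha ^ 2 + 1).
Definition jet_hs (J : derivatives) p :=
  (alpha * d_xx J p + (1 - alpha ^ 2) * d_xy J p - alpha * d_yy J p) / (alpha ^ 2 + 1).
Definition jet_ss (J : derivatives) p :=
  (alpha ^ 2 * d_xx J p + 2 * alpha * d_xy J p + d_yy J p) / (alpha ^ 2 + 1).

Lemma rot_q_pos : 0 < q.
Proof. apply sqrt_lt_R0. nra. Qed.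

Lemma rot_q_sqr : q * q = alpha ^ 2 + 1.
Proof. apply sqrt_sqrt. nra. Qed.

(** Multiplying [I^{-1} II v = k v] by the invertible form [I], whose determinant is [W ^ 2], gives
    [II v = k I v], which is linear in the second derivatives and can be rotated term by term. *)
Lemma principal_direction_forms (J : derivatives) (p v : R * R) (k : R) :
  let W := sqrt (1 + d_x J p ^ 2 + d_y J p ^ 2) in
  shape_operator J p v = (k * fst v, k * snd v) <->
  d_xx J p * fst v + d_xy J p * snd v
    = k * W * (fst v + d_x J p * (d_x J p * fst v + d_y J p * snd v)) /\
  d_xy J p * fst v + d_yy J p * snd v
    = k * W * (snd v + d_y J p * (d_x J p * fst v + d_y J p * snd v)).
Proof.
  intros W. unfold shape_operator. fold W.
  set (x := d_x J p) in *. set (y := d_y J p) in *.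
  set (A := d_xx J p). set (B := d_xy J p). set (C := d_yy J p).
  destruct v as [v1 v2]. cbn [fst snd].
  assert (HW : 0 < W) by (apply sqrt_lt_R0; nra).
  assert (HD : (1 + x ^ 2) * (1 + y ^ 2) - (x * y) ^ 2 <> 0) by nra.
  split.
  - intros H. injection H as H1 H2.
    set (P := A / W * v1 + B / W * v2) in *. set (Q := B / W * v1 + C / W * v2) in *.
    assert (E1 : (1 + y ^ 2) * P - x * y * Q = k * v1 * ((1 + x ^ 2) * (1 + y ^ 2) - (x * y) ^ 2))
      by (rewrite <- H1; field; intro Z; apply HD; rewrite <- Z; ring).
    assert (E2 : (1 + x ^ 2) * Q - x * y * P = k * v2 * ((1 + x ^ 2) * (1 + y ^ 2) - (x * y) ^ 2))
      by (rewrite <- H2; field; intro Z; apply HD; rewrite <- Z; ring).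
    assert (EP : P = k * (v1 + x * (x * v1 + y * v2))).
    { apply Rmult_eq_reg_l with ((1 + x ^ 2) * (1 + y ^ 2) - (x * y) ^ 2); [|exact HD].
      transitivity ((1 + x ^ 2) * ((1 + y ^ 2) * P - x * y * Q)
                    + x * y * ((1 + x ^ 2) * Q - x * y * P)); [ring|].
      rewrite E1, E2. ring. }
    assert (EQ : Q = k * (v2 + y * (x * v1 + y * v2))).
    { apply Rmult_eq_reg_l with ((1 + x ^ 2) * (1 + y ^ 2) - (x * y) ^ 2); [|exact HD].
      transitivity ((1 + y ^ 2) * ((1 + x ^ 2) * Q - x * y * P)
                    + x * y * ((1 + y ^ 2) * P - x * y * Q)); [ring|].
      rewrite E1, E2. ring. }
    split.
    + replace (A * v1 + B * v2) with (W * P) by (unfold P; field; lra). rewrite EP. ring.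
    + replace (B * v1 + C * v2) with (W * Q) by (unfold Q; field; lra). rewrite EQ. ring.
  - intros [H1 H2].
    replace (A / W * v1 + B / W * v2) with (k * (v1 + x * (x * v1 + y * v2)))
      by (apply Rmult_eq_reg_l with W; [|lra]; transitivity (A * v1 + B * v2);
          [rewrite H1; ring | field; lra]).
    replace (B / W * v1 + C / W * v2) with (k * (v2 + y * (x * v1 + y * v2)))
      by (apply Rmult_eq_reg_l with W; [|lra]; transitivity (B * v1 + C * v2);
          [rewrite H2; ring | field; lra]).
    f_equal; field; intro Z; apply HD; rewrite <- Z; ring.
Qed.

Lemma rot_jet_sqr J p : d_x J p ^ 2 + d_y J p ^ 2 = jet_h J p ^ 2 + jet_s J p ^ 2.
Proof.
  unfold jet_h, jet_s. assert (Q := rot_q_pos). assert (S := rot_q_sqr).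
  set (x := d_x J p). set (y := d_y J p). set (r := q) in *.
  replace (((x - alpha * y) / r) ^ 2 + ((alpha * x + y) / r) ^ 2)
    with ((x ^ 2 + y ^ 2) * (alpha ^ 2 + 1) / (r * r)) by (field; lra).
  rewrite S. field. nra.
Qed.

(** [rotated_principal J p a b k] is [II v = k I v] for [v = a (1, - alpha) + b (alpha, 1)]. *)
Definition rotated_principal J p a b k : Prop :=
  let W := sqrt (1 + jet_h J p ^ 2 + jet_s J p ^ 2) in
  jet_hh J p * a + jet_hs J p * b
    = k * W * ((1 + jet_h J p ^ 2) * a + jet_h J p * jet_s J p * b) /\
  jet_hs J p * a + jet_ss J p * b
    = k * W * (jet_h J p * jet_s J p * a + (1 + jet_s J p ^ 2) * b).

Lemma principal_direction_rotated J p a b k :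
  shape_operator J p (a + alpha * b, b - alpha * a)
    = (k * (a + alpha * b), k * (b - alpha * a)) <->
  rotated_principal J p a b k.
Proof.
  unfold rotated_principal.
  rewrite (principal_direction_forms J p (a + alpha * b, b - alpha * a)). cbn [fst snd].
  replace (1 + d_x J p ^ 2 + d_y J p ^ 2) with (1 + jet_h J p ^ 2 + jet_s J p ^ 2)
    by (rewrite Rplus_assoc, <- rot_jet_sqr; ring).
  set (W := sqrt _).
  assert (Q := rot_q_pos). assert (S := rot_q_sqr).
  assert (Dx : d_x J p = (jet_h J p + alpha * jet_s J p) / q).
  { unfold jet_h, jet_s. set (r := q) in *.
    transitivity (d_x J p * (alpha ^ 2 + 1) / (r * r)); [rewrite S; field; nra | field; lra]. }
  assert (Dy : d_y J p = (jet_s J p - alpha * jet_h J p) / q).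
  { unfold jet_h, jet_s. set (r := q) in *.
    transitivity (d_y J p * (alpha ^ 2 + 1) / (r * r)); [rewrite S; field; nra | field; lra]. }
  set (Hh := jet_hh J p * a + jet_hs J p * b).
  set (Hs := jet_hs J p * a + jet_ss J p * b).
  replace (d_xx J p * (a + alpha * b) + d_xy J p * (b - alpha * a))
    with (Hh + alpha * Hs) by (unfold Hh, Hs, jet_hh, jet_hs, jet_ss; field; nra).
  replace (d_xy J p * (a + alpha * b) + d_yy J p * (b - alpha * a))
    with (Hs - alpha * Hh) by (unfold Hh, Hs, jet_hh, jet_hs, jet_ss; field; nra).
  set (m := jet_h J p) in *. set (n := jet_s J p) in *.
  assert (G : d_x J p * (a + alpha * b) + d_y J p * (b - alpha * a) = q * (m * a + n * b)).
  { rewrite Dx, Dy. set (r := q) in *.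
    transitivity ((m * a + n * b) * (alpha ^ 2 + 1) / r); [field; lra|]. rewrite <- S. field. lra. }
  rewrite G, Dx, Dy.
  replace ((m + alpha * n) / q * (q * (m * a + n * b)))
    with ((m + alpha * n) * (m * a + n * b)) by (field; lra).
  replace ((n - alpha * m) / q * (q * (m * a + n * b)))
    with ((n - alpha * m) * (m * a + n * b)) by (field; lra).
  set (k' := k * W).
  set (Ih := (1 + m ^ 2) * a + m * n * b). set (Is := m * n * a + (1 + n ^ 2) * b).
  replace (a + alpha * b + (m + alpha * n) * (m * a + n * b)) with (Ih + alpha * Is)
    by (unfold Ih, Is; ring).
  replace (b - alpha * a + (n - alpha * m) * (m * a + n * b)) with (Is - alpha * Ih)
    by (unfold Ih, Is; ring).
  split.
  (* The pair [E1], [E2] is the wanted pair multiplied by the matrix with rows [(1, alpha)] and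
     [(- alpha, 1)], of determinant [alpha ^ 2 + 1]. *)
  - intros [E1 E2]. split; apply Rmult_eq_reg_l with (alpha ^ 2 + 1); nra.
  - intros [E1 E2]. rewrite E1, E2. split; ring.
Qed.

Variables F Fh Fs Fhh Fhs Fss : R -> R -> R.

Definition rot_graph (p : R * R) : R := F (rot_h p) (rot_s p).

Definition rot_jet : derivatives :=
  Derivatives
    (fun p => (Fh (rot_h p) (rot_s p) + alpha * Fs (rot_h p) (rot_s p)) / q)
    (fun p => (Fs (rot_h p) (rot_s p) - alpha * Fh (rot_h p) (rot_s p)) / q)
    (fun p => (Fhh (rot_h p) (rot_s p) + 2 * alpha * Fhs (rot_h p) (rot_s p)
               + alpha ^ 2 * Fss (rot_h p) (rot_s p)) / (alpha ^ 2 + 1))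
    (fun p => (- alpha * Fhh (rot_h p) (rot_s p) + (1 - alpha ^ 2) * Fhs (rot_h p) (rot_s p)
               + alpha * Fss (rot_h p) (rot_s p)) / (alpha ^ 2 + 1))
    (fun p => (alpha ^ 2 * Fhh (rot_h p) (rot_s p) - 2 * alpha * Fhs (rot_h p) (rot_s p)
               + Fss (rot_h p) (rot_s p)) / (alpha ^ 2 + 1)).

Lemma jet_h_rot p : jet_h rot_jet p = Fh (rot_h p) (rot_s p).
Proof.
  unfold jet_h, rot_jet; cbn [rot_jet d_x d_y d_xx d_xy d_yy]. assert (Q := rot_q_pos). assert (S := rot_q_sqr).
  set (m := Fh _ _). set (n := Fs _ _). set (r := q) in *.
  transitivity (m * (alpha ^ 2 + 1) / (r * r)); [field; lra | rewrite S; field; nra].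
Qed.

Lemma jet_s_rot p : jet_s rot_jet p = Fs (rot_h p) (rot_s p).
Proof.
  unfold jet_s, rot_jet; cbn [rot_jet d_x d_y d_xx d_xy d_yy]. assert (Q := rot_q_pos). assert (S := rot_q_sqr).
  set (m := Fh _ _). set (n := Fs _ _). set (r := q) in *.
  transitivity (n * (alpha ^ 2 + 1) / (r * r)); [field; lra | rewrite S; field; nra].
Qed.

Lemma jet_hh_rot p : jet_hh rot_jet p = Fhh (rot_h p) (rot_s p).
Proof. unfold jet_hh, rot_jet; cbn [rot_jet d_x d_y d_xx d_xy d_yy]. field. nra. Qed.

Lemma jet_hs_rot p : jet_hs rot_jet p = Fhs (rot_h p) (rot_s p).
Proof. unfold jet_hs, rot_jet; cbn [rot_jet d_x d_y d_xx d_xy d_yy]. field. nra. Qed.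

Lemma jet_ss_rot p : jet_ss rot_jet p = Fss (rot_h p) (rot_s p).
Proof. unfold jet_ss, rot_jet; cbn [rot_jet d_x d_y d_xx d_xy d_yy]. field. nra. Qed.

Lemma differentiable_rotated (G : R -> R -> R) (x y gh gs : R) :
  differentiable_pt_lim G (rot_h (x, y)) (rot_s (x, y)) gh gs ->
  differentiable_pt_lim (fun x y => G (rot_h (x, y)) (rot_s (x, y))) x y
    ((gh + alpha * gs) / q) ((gs - alpha * gh) / q).
Proof.
  intros H. assert (Q := rot_q_pos).
  replace ((gh + alpha * gs) / q) with (gh * (1 / q) + gs * (alpha / q)) by (field; lra).
  replace ((gs - alpha * gh) / q) with (gh * (- alpha / q) + gs * (1 / q)) by (field; lra).
  apply (differentiable_pt_lim_comp G (fun x y => rot_h (x, y)) (fun x y => rot_s (x, y))).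
  - exact H.
  - generalize (differentiable_linear (1 / q) (- alpha / q) x y).
    apply differentiable_pt_lim_ext. apply locally_2d_forall. intros.
    unfold rot_h; cbn [fst snd]. field. lra.
  - generalize (differentiable_linear (alpha / q) (1 / q) x y).
    apply differentiable_pt_lim_ext. apply locally_2d_forall. intros.
    unfold rot_s; cbn [fst snd]. field. lra.
Qed.

Lemma differentiable_lincomb (G K : R -> R -> R) (m n x y gx gy kx ky : R) :
  differentiable_pt_lim G x y gx gy -> differentiable_pt_lim K x y kx ky ->
  differentiable_pt_lim (fun a b => m * G a b + n * K a b) x y (m * gx + n * kx) (m * gy + n * ky).
Proof.
  intros HG HK.
  exact (differentiable_pt_lim_comp (fun a b => m * a + n * b) G K x y m n _ _ _ _
    (differentiable_linear m n _ _) HG HK).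
Qed.

Lemma continuous_rotated (G : R -> R -> R) (p : R * R) :
  continuous (fun p => G (fst p) (snd p)) (rot_h p, rot_s p) ->
  continuous (fun p => G (rot_h p) (rot_s p)) p.
Proof.
  intros H. destruct p as [x y].
  apply (continuous_comp_2 rot_h rot_s G (x, y)).
  - apply (continuous_of_differentiable (fun x y => rot_h (x, y)) x y (1 / q) (- alpha / q)).
    generalize (differentiable_linear (1 / q) (- alpha / q) x y).
    apply differentiable_pt_lim_ext. apply locally_2d_forall. intros.
    unfold rot_h; cbn [fst snd]. assert (Q := rot_q_pos). field. lra.
  - apply (continuous_of_differentiable (fun x y => rot_s (x, y)) x y (alpha / q) (1 / q)).
    generalize (differentiable_linear (alpha / q) (1 / q) x y).
    apply differentiable_pt_lim_ext. apply locally_2d_forall. intros.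
    unfold rot_s; cbn [fst snd]. assert (Q := rot_q_pos). field. lra.
  - exact H.
Qed.

(** In use, [ok] is an open band containing the rotated rectangle, so that ordinary derivatives
    restrict to relative ones up to the boundary. *)
Lemma is_C2_rotated (D : R * R -> Prop) (ok : R -> R -> Prop) :
  (forall p, D p -> ok (rot_h p) (rot_s p)) ->
  (forall h s, ok h s -> differentiable_pt_lim F h s (Fh h s) (Fs h s)) ->
  (forall h s, ok h s -> differentiable_pt_lim Fh h s (Fhh h s) (Fhs h s)) ->
  (forall h s, ok h s -> differentiable_pt_lim Fs h s (Fhs h s) (Fss h s)) ->
  (forall h s, ok h s -> continuous (fun p => Fhh (fst p) (snd p)) (h, s)) ->
  (forall h s, ok h s -> continuous (fun p => Fhs (fst p) (snd p)) (h, s)) ->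
  (forall h s, ok h s -> continuous (fun p => Fss (fst p) (snd p)) (h, s)) ->
  is_C2 D rot_graph rot_jet.
Proof.
  intros Hok D0 Dh Ds Chh Chs Css.
  assert (Q := rot_q_pos). assert (S := rot_q_sqr).
  assert (cont3 : forall c1 c2 c3, continuous_on D (fun p =>
     (c1 * Fhh (rot_h p) (rot_s p) + c2 * Fhs (rot_h p) (rot_s p)
       + c3 * Fss (rot_h p) (rot_s p)) / (alpha ^ 2 + 1))).
  { intros c1 c2 c3 p Hp. specialize (Hok p Hp).
    assert (Lim : continuous (fun p =>
     (c1 * Fhh (rot_h p) (rot_s p) + c2 * Fhs (rot_h p) (rot_s p)
       + c3 * Fss (rot_h p) (rot_s p)) / (alpha ^ 2 + 1)) p).
    { apply (continuous_mult (K := R_AbsRing)); [|apply continuous_const].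
      repeat apply (continuous_plus (V := R_NormedModule));
        apply (continuous_mult (K := R_AbsRing)); try apply continuous_const;
        apply continuous_rotated; auto. }
    apply filterlim_filter_le_1 with (2 := Lim).
    intros P [e He]. exists e. intros z Hz _. apply He, Hz. }
  split; [|split; [|split]].
  - intros [x y] Hp. specialize (Hok _ Hp). split; [|split].
    + apply (gradient_within_of_differentiable D rot_graph); [exact Hp|].
      cbn [rot_jet d_x d_y d_xx d_xy d_yy].
      apply (differentiable_rotated F). auto.
    + cbn [rot_jet d_x d_y d_xx d_xy d_yy].
      apply (gradient_within_of_differentiable D (fun p =>
       (Fh (rot_h p) (rot_s p) + alpha * Fs (rot_h p) (rot_s p)) / q));
        [exact Hp|].
      assert (T := differentiable_lincomb _ _ (1 / q) (alpha / q) x y _ _ _ _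
        (differentiable_rotated Fh x y _ _ (Dh _ _ Hok))
        (differentiable_rotated Fs x y _ _ (Ds _ _ Hok))).
      set (A := Fhh _ _) in *. set (B := Fhs _ _) in *. set (C := Fss _ _) in *.
      replace ((A + 2 * alpha * B + alpha ^ 2 * C) / (alpha ^ 2 + 1))
        with (1 / q * ((A + alpha * B) / q) + alpha / q * ((B + alpha * C) / q))
        by (set (r := q) in *; rewrite <- S; field; lra).
      replace ((- alpha * A + (1 - alpha ^ 2) * B + alpha * C) / (alpha ^ 2 + 1))
        with (1 / q * ((B - alpha * A) / q) + alpha / q * ((C - alpha * B) / q))
        by (set (r := q) in *; rewrite <- S; field; lra).
      revert T. apply differentiable_pt_lim_ext, locally_2d_forall.
      intros; field; lra.
    + cbn [rot_jet d_x d_y d_xx d_xy d_yy].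
      apply (gradient_within_of_differentiable D (fun p =>
       (Fs (rot_h p) (rot_s p) - alpha * Fh (rot_h p) (rot_s p)) / q));
        [exact Hp|].
      assert (T := differentiable_lincomb _ _ (- alpha / q) (1 / q) x y _ _ _ _
        (differentiable_rotated Fh x y _ _ (Dh _ _ Hok))
        (differentiable_rotated Fs x y _ _ (Ds _ _ Hok))).
      set (A := Fhh _ _) in *. set (B := Fhs _ _) in *. set (C := Fss _ _) in *.
      replace ((- alpha * A + (1 - alpha ^ 2) * B + alpha * C) / (alpha ^ 2 + 1))
        with (- alpha / q * ((A + alpha * B) / q) + 1 / q * ((B + alpha * C) / q))
        by (set (r := q) in *; rewrite <- S; field; lra).
      replace ((alpha ^ 2 * A - 2 * alpha * B + C) / (alpha ^ 2 + 1))
        with (- alpha / q * ((B - alpha * A) / q) + 1 / q * ((C - alpha * B) / q))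
        by (set (r := q) in *; rewrite <- S; field; lra).
      revert T. apply differentiable_pt_lim_ext, locally_2d_forall.
      intros; field; lra.
  - generalize (cont3 1 (2 * alpha) (alpha ^ 2)). apply continuous_on_ext.
    intros p _. cbn [rot_jet d_xx]. match goal with |- @eq _ ?l ?r => change (@eq R l r) end. field. nra.
  - exact (cont3 (- alpha) (1 - alpha ^ 2) alpha).
  - generalize (cont3 (alpha ^ 2) (- (2 * alpha)) 1). apply continuous_on_ext.
    intros p _. cbn [rot_jet d_yy]. match goal with |- @eq _ ?l ?r => change (@eq R l r) end. field. nra.
Qed.

End Rotation.

(** * Slopes and sines of inclination angles *)

(** For an inclination with tangent [m], [sine_of_slope m] is its sine; its derivative
    [(1 + m ^ 2) ^ (-3/2)] is the factor that turns a second derivative into a curvature. *)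
Definition slope_of_sine (s : R) : R := s / sqrt (1 - s ^ 2).
Definition sine_of_slope (m : R) : R := m / sqrt (1 + m ^ 2).

Lemma sqrt_one_plus_pos m : 0 < sqrt (1 + m ^ 2).
Proof. apply sqrt_lt_R0. nra. Qed.

Lemma sqr_sqrt_one_plus m : sqrt (1 + m ^ 2) * sqrt (1 + m ^ 2) = 1 + m ^ 2.
Proof. apply sqrt_sqrt. nra. Qed.

Lemma one_minus_sqr_pos s : Rabs s < 1 -> 0 < 1 - s ^ 2.
Proof. intros H. apply Rabs_def2 in H. nra. Qed.

Lemma sqrt_one_minus_pos s : Rabs s < 1 -> 0 < sqrt (1 - s ^ 2).
Proof. intros H. apply sqrt_lt_R0, one_minus_sqr_pos, H. Qed.

Lemma sqr_sqrt_one_minus s : Rabs s < 1 -> sqrt (1 - s ^ 2) * sqrt (1 - s ^ 2) = 1 - s ^ 2.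
Proof. intros H. apply sqrt_sqrt. apply one_minus_sqr_pos in H. lra. Qed.

Lemma one_plus_slope_of_sine s : Rabs s < 1 -> 1 + slope_of_sine s ^ 2 = / (1 - s ^ 2).
Proof.
  intros H. unfold slope_of_sine. assert (P := one_minus_sqr_pos s H).
  assert (Q := sqr_sqrt_one_minus s H). assert (S := sqrt_one_minus_pos s H).
  replace ((s / sqrt (1 - s ^ 2)) ^ 2) with (s ^ 2 / (sqrt (1 - s ^ 2) * sqrt (1 - s ^ 2)))
    by (field; lra).
  rewrite Q. field. lra.
Qed.

Lemma sqrt_one_plus_slope_of_sine s :
  Rabs s < 1 -> sqrt (1 + slope_of_sine s ^ 2) = / sqrt (1 - s ^ 2).
Proof.
  intros H. rewrite one_plus_slope_of_sine by exact H.
  apply sqrt_inv.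
Qed.

Lemma sine_of_slope_of_sine s : Rabs s < 1 -> sine_of_slope (slope_of_sine s) = s.
Proof.
  intros H. unfold sine_of_slope. rewrite sqrt_one_plus_slope_of_sine by exact H.
  unfold slope_of_sine. assert (S := sqrt_one_minus_pos s H). field. lra.
Qed.

Lemma one_minus_sine_of_slope m : 1 - sine_of_slope m ^ 2 = / (1 + m ^ 2).
Proof.
  unfold sine_of_slope. assert (P := sqrt_one_plus_pos m). assert (Q := sqr_sqrt_one_plus m).
  replace ((m / sqrt (1 + m ^ 2)) ^ 2) with (m ^ 2 / (sqrt (1 + m ^ 2) * sqrt (1 + m ^ 2)))
    by (field; lra).
  rewrite Q. field. nra.
Qed.

Lemma Rabs_sine_of_slope m : Rabs (sine_of_slope m) < 1.
Proof.
  assert (H := one_minus_sine_of_slope m).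
  assert (0 < / (1 + m ^ 2)) by (apply Rinv_0_lt_compat; nra).
  apply Rabs_def1; nra.
Qed.

Lemma slope_of_sine_of_slope m : slope_of_sine (sine_of_slope m) = m.
Proof.
  unfold slope_of_sine. rewrite one_minus_sine_of_slope, sqrt_inv.
  unfold sine_of_slope. assert (P := sqrt_one_plus_pos m). field. lra.
Qed.

Lemma is_derive_sine_of_slope m :
  is_derive sine_of_slope m (/ ((1 + m ^ 2) * sqrt (1 + m ^ 2))).
Proof.
  unfold sine_of_slope. assert (P := sqrt_one_plus_pos m). assert (Q := sqr_sqrt_one_plus m).
  auto_derive.
  - replace (1 + m * (m * 1)) with (1 + m ^ 2) by ring. repeat split; nra.
  - replace (1 + m * (m * 1)) with (1 + m ^ 2) by ring.
    set (r := sqrt (1 + m ^ 2)) in *. rewrite <- Q. field_simplify; try lra.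
    replace (m ^ 2) with (r * r - 1) by lra. field. lra.
Qed.

Lemma is_derive_slope_of_sine s :
  Rabs s < 1 -> is_derive slope_of_sine s (/ ((1 - s ^ 2) * sqrt (1 - s ^ 2))).
Proof.
  intros H. unfold slope_of_sine. assert (P := one_minus_sqr_pos s H).
  assert (Q := sqr_sqrt_one_minus s H). assert (S := sqrt_one_minus_pos s H).
  auto_derive.
  - replace (1 + - (s * (s * 1))) with (1 - s ^ 2) by ring. repeat split; lra.
  - replace (1 + - (s * (s * 1))) with (1 - s ^ 2) by ring.
    set (r := sqrt (1 - s ^ 2)) in *. rewrite <- Q. field_simplify; try lra.
    replace (s ^ 2) with (1 - r * r) by lra. field. lra.
Qed.

Lemma Rpower_three_halves z : 0 < z -> Rpower z (3 / 2) = z * sqrt z.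
Proof.
  intros Hz. replace (3 / 2) with (1 + / 2) by field.
  rewrite Rpower_plus, Rpower_1, Rpower_sqrt by exact Hz. reflexivity.
Qed.

Lemma sqrt_one_minus_ge_half s : Rabs s <= / 2 -> / 2 <= sqrt (1 - s ^ 2) <= 1.
Proof.
  intros H. apply Rabs_le_between in H. split.
  - apply Rle_trans with (sqrt (/ 2 * / 2)); [rewrite sqrt_square; lra|].
    apply sqrt_le_1_alt. nra.
  - apply Rle_trans with (sqrt 1); [apply sqrt_le_1_alt; nra | rewrite sqrt_1; lra].
Qed.

Lemma Rabs_slope_of_sine_le s : Rabs s <= / 2 -> Rabs (slope_of_sine s) <= 2 * Rabs s.
Proof.
  intros H. assert (B := sqrt_one_minus_ge_half s H). unfold slope_of_sine, Rdiv.
  rewrite Rabs_mult, Rabs_inv, (Rabs_right (sqrt _)) by lra.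
  rewrite Rmult_comm. apply Rmult_le_compat_r; [apply Rabs_pos|].
  replace 2 with (/ / 2) by field. apply Rinv_le_contravar; lra.
Qed.

Ltac rewrite_derive H :=
  match type of H with
  | is_derive ?f ?x ?l =>
      replace (Derive (fun y => f y) x) with l
        by (symmetry; exact (is_derive_unique f x l H))
  end.

Lemma Rabs_inv_le z m : 0 < m -> m <= z -> Rabs (/ z) <= / m.
Proof.
  intros Hm Hz. rewrite Rabs_right.
  - apply Rinv_le_contravar; lra.
  - left. apply Rinv_0_lt_compat. lra.
Qed.

Lemma exp_le_3_of_half x : Rabs x <= / 2 -> Rabs (exp x) <= 3.
Proof.
  intros H. apply Rabs_le_between in H.
  rewrite Rabs_right by (left; apply exp_pos).
  apply Rle_trans with (2 := exp_le_3). left. apply exp_increasing. lra.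
Qed.

Lemma exp_monotone x y : x <= y -> exp x <= exp y.
Proof.
  intros [H|H]; [left; now apply exp_increasing | right; now rewrite H].
Qed.

Lemma is_derive_sqrt_one_plus m : is_derive (fun m => sqrt (1 + m ^ 2)) m (m / sqrt (1 + m ^ 2)).
Proof.
  assert (P := sqrt_one_plus_pos m). auto_derive.
  - replace (1 + m * (m * 1)) with (1 + m ^ 2) by ring. nra.
  - replace (1 + m * (m * 1)) with (1 + m ^ 2) by ring. field. lra.
Qed.

Lemma is_derive_sqrt_one_minus s :
  Rabs s < 1 -> is_derive (fun s => sqrt (1 - s ^ 2)) s (- slope_of_sine s).
Proof.
  intros H. assert (P := one_minus_sqr_pos s H). assert (S := sqrt_one_minus_pos s H).
  unfold slope_of_sine. auto_derive.
  - replace (1 + - (s * (s * 1))) with (1 - s ^ 2) by ring. lra.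
  - replace (1 + - (s * (s * 1))) with (1 - s ^ 2) by ring. field. lra.
Qed.

Lemma Rabs_sine_of_slope_increment m n :
  Rabs (sine_of_slope m - sine_of_slope n) <= Rabs (m - n).
Proof.
  assert (H := Rabs_increment_le sine_of_slope _ 1 n m is_derive_sine_of_slope).
  rewrite Rmult_1_l in H. apply H. intros t.
  assert (P := sqrt_one_plus_pos t). assert (Q := sqr_sqrt_one_plus t).
  assert (1 <= sqrt (1 + t ^ 2)) by nra.
  assert (B := Rabs_inv_le ((1 + t ^ 2) * sqrt (1 + t ^ 2)) 1). rewrite Rinv_1 in B.
  apply B; nra.
Qed.

(** The power [(1 + m ^ 2) ^ (3/2)] in a form open to [auto_derive]; it agrees with [Rpower] by
    [Rpower_three_halves]. *)
Definition cube_norm (m : R) : R := (1 + m ^ 2) * sqrt (1 + m ^ 2).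

Lemma cube_norm_cont m : continuous cube_norm m.
Proof.
  assert (P := sqrt_one_plus_pos m). apply (ex_derive_continuous cube_norm). unfold cube_norm.
  auto_derive. nra.
Qed.

Lemma cube_norm_lipschitz : lipschitz_on 1 cube_norm.
Proof.
  apply lipschitz_on_of_is_derive with (df := fun m => 3 * m * sqrt (1 + m ^ 2)); [lra | |].
  - intros m. assert (P := sqrt_one_plus_pos m). assert (Q := sqr_sqrt_one_plus m).
    unfold cube_norm. auto_derive.
    + replace (1 + m * (m * 1)) with (1 + m ^ 2) by ring. nra.
    + replace (1 + m * (m * 1)) with (1 + m ^ 2) by ring.
      set (r := sqrt (1 + m ^ 2)) in *. rewrite <- Q. field. lra.
  - intros m. assert (P := sqrt_one_plus_pos m).
    apply (ex_derive_continuous (fun m => 3 * m * sqrt (1 + m ^ 2))). auto_derive. nra.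
Qed.

Lemma cube_norm_bound m : Rabs m <= 1 -> 0 <= cube_norm m <= 4.
Proof.
  intros H. apply Rabs_le_between in H. unfold cube_norm.
  assert (P := sqrt_one_plus_pos m). assert (Q := sqr_sqrt_one_plus m).
  assert (sqrt (1 + m ^ 2) <= 2) by nra. split; nra.
Qed.

Lemma Rabs_div_pos_le_iff x y c : 0 < c -> (Rabs x <= y <-> Rabs (x / c) <= y / c).
Proof.
  intros Hc. unfold Rdiv. rewrite Rabs_mult, (Rabs_right (/ c))
    by (left; apply Rinv_0_lt_compat, Hc).
  assert (I := Rinv_0_lt_compat c Hc). split; intros H.
  - apply Rmult_le_compat_r; lra.
  - apply Rmult_le_reg_r with (/ c); assumption.
Qed.

Lemma between_0_segment c h t : segment c h -> between 0 h t -> segment c t.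
Proof.
  unfold segment, between. intros H Ht. apply Rabs_le_between in H. apply Rabs_le.
  revert Ht. unfold Rmin, Rmax. destruct Rle_dec; lra.
Qed.

Lemma between_0_lt b u t : Rabs u < b -> between 0 u t -> Rabs t < b.
Proof.
  unfold between. intros H Ht. apply Rabs_def2 in H. apply Rabs_def1;
  revert Ht; unfold Rmin, Rmax; destruct Rle_dec; lra.
Qed.

Lemma locally_Rabs_lt b u : Rabs u < b -> locally u (fun t => Rabs t < b).
Proof.
  intros H. assert (Hd : 0 < b - Rabs u) by lra. exists (mkposreal _ Hd).
  intros t Ht. change (Rabs (t - u) < b - Rabs u) in Ht.
  replace t with ((t - u) + u) by ring. apply Rle_lt_trans with (1 := Rabs_triang _ _). lra.
Qed.

(** * Functions along a segment *)

(** The regularity that [zero_of_gronwall] asks for; the values of [df] at the endpoints are left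
    free. *)
Definition smooth_between (t0 t1 : R) (f df : R -> R) : Prop :=
  continuous_on (between t0 t1) f /\
  forall t, Rmin t0 t1 < t < Rmax t0 t1 -> is_derive f t (df t).

Lemma smooth_of_deriv_within t0 t1 f df :
  (forall t, between t0 t1 t -> deriv_within (between t0 t1) f t (df t)) ->
  smooth_between t0 t1 f df.
Proof.
  intros H. split.
  - intros t Ht. exact (deriv_within_continuous _ f t (df t) (H t Ht)).
  - intros t Ht. apply (deriv_within_interior (between t0 t1)).
    + now apply locally_between.
    + apply H. unfold between; lra.
Qed.

Lemma smooth_ext t0 t1 f df f' df' :
  (forall t, f t = f' t) -> (forall t, between t0 t1 t -> df t = df' t) ->
  smooth_between t0 t1 f df -> smooth_between t0 t1 f' df'.
Proof.
  intros Hf Hd [C D]. split.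
  - apply continuous_on_ext with (2 := C). intros; apply Hf.
  - intros t Ht. rewrite <- Hd by (unfold between; lra).
    apply is_derive_ext with (2 := D t Ht). exact Hf.
Qed.

Lemma smooth_minus t0 t1 f df f' df' :
  smooth_between t0 t1 f df -> smooth_between t0 t1 f' df' ->
  smooth_between t0 t1 (fun t => f t - f' t) (fun t => df t - df' t).
Proof.
  intros [C1 D1] [C2 D2]. split; [now apply continuous_on_minus|].
  intros t Ht. apply (is_derive_minus (K := R_AbsRing) (V := R_NormedModule)); auto.
Qed.

Lemma smooth_of_is_derive t0 t1 f df :
  (forall t, is_derive f t (df t)) -> smooth_between t0 t1 f df.
Proof.
  intros H. split; [|auto]. apply continuous_on_of_continuous. intros t _.
  apply (ex_derive_continuous f). eexists. apply H.
Qed.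

Lemma zero_of_smooth t0 t1 f df C :
  smooth_between t0 t1 f df ->
  (forall t, Rmin t0 t1 < t < Rmax t0 t1 -> Rabs (df t) <= C * Rabs (f t)) ->
  f t0 = 0 -> f t1 = 0.
Proof.
  intros [HC HD] HB. apply (zero_of_gronwall f df C); [exact HC|]. intros t Ht. auto.
Qed.

Lemma continuous_on_curve (D : R * R -> Prop) (I : R -> Prop) (f : R * R -> R) (x1 x2 : R -> R) :
  (forall t, I t -> D (x1 t, x2 t)) ->
  (forall t, I t -> continuous x1 t /\ continuous x2 t) ->
  continuous_on D f -> continuous_on I (fun t => f (x1 t, x2 t)).
Proof.
  intros HD Hx Hf t Ht.
  apply filterlim_comp with (within D (locally (x1 t, x2 t))); [|apply Hf, HD, Ht].
  intros P [e He]. destruct (Hx t Ht) as [C1 C2].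
  assert (B1 : locally t (fun y => ball (x1 t) e (x1 y))) by exact (C1 _ (locally_ball (x1 t) e)).
  assert (B2 : locally t (fun y => ball (x2 t) e (x2 y))) by exact (C2 _ (locally_ball (x2 t) e)).
  unfold filtermap, within. generalize (filter_and _ _ B1 B2). apply filter_imp.
  intros y [b1 b2] Hy. apply He; [split; assumption | apply HD, Hy].
Qed.

Lemma continuous_of_fst (f : R -> R) h s :
  (forall x, continuous f x) ->
  continuous (fun p : R * R => f (fst p)) (h, s).
Proof.
  intros Hf. apply (continuous_comp fst f); [apply continuous_fst | apply Hf].
Qed.

(** The condition on the [k1]-direction says exactly that [cross_slope] of the
    first derivatives along the rotated axes depends on [h] alone; it is then [rho']. *)
Definition cross_slope (jh js : R) : R := jh / sqrt (1 + js ^ 2).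

Lemma is_derive_cross_slope (f g : R -> R) (t l m : R) :
  is_derive f t l -> is_derive g t m ->
  is_derive (fun t => cross_slope (f t) (g t)) t
    (l / sqrt (1 + g t ^ 2) - f t * g t * m / ((1 + g t ^ 2) * sqrt (1 + g t ^ 2))).
Proof.
  intros Hf Hg. unfold cross_slope.
  assert (P := sqrt_one_plus_pos (g t)). assert (Q := sqr_sqrt_one_plus (g t)).
  auto_derive.
  - replace (1 + g t * (g t * 1)) with (1 + g t ^ 2) by ring.
    repeat split; try (eexists; eassumption); nra.
  - replace (1 + g t * (g t * 1)) with (1 + g t ^ 2) by ring.
    rewrite_derive Hf. rewrite_derive Hg.
    set (r := sqrt (1 + g t ^ 2)) in *. rewrite <- Q. field. lra.
Qed.

(** From [1 + m ^ 2 + n ^ 2 = (1 + n ^ 2) (1 + m ^ 2 / (1 + n ^ 2))]. The first factor cancels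
    against the derivative of the sine of [n], and what remains of the normal depends on
    [cross_slope] alone. *)
Lemma normal_cross_slope m n :
  sqrt (1 + m ^ 2 + n ^ 2) = sqrt (1 + n ^ 2) * sqrt (1 + cross_slope m n ^ 2).
Proof.
  assert (P := sqrt_one_plus_pos n). assert (Q := sqr_sqrt_one_plus n).
  rewrite <- sqrt_mult by nra. f_equal. unfold cross_slope.
  set (r := sqrt (1 + n ^ 2)) in *. rewrite <- Q.
  replace (1 + m ^ 2 + n ^ 2) with (r * r + m ^ 2) by lra. field. lra.
Qed.

(** * Construction from curvatures prescribed on the whole line *)

Section Profile.

(** [c1] and [c2] are the prescribed curvatures, continued beyond [[- a1, a1]];
    compact support keeps their integrals small on the whole line, so that all
    the maps below are defined globally. *)
Variables (alpha N eps delta : R) (c1 c2 : R -> R).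
Hypothesis alpha_pos : 0 < alpha.
Hypothesis N_ge_1 : 1 <= N.
Hypothesis eps_pos : 0 < eps.
Hypothesis eps_def : delta * N = eps.
Hypothesis eps_small : eps <= / 100.
Hypothesis eps_alpha : 8 * sqrt (alpha ^ 2 + 1) * N * eps <= alpha.
Hypothesis c1_cont : forall x, continuous c1 x.
Hypothesis c2_cont : forall x, continuous c2 x.
Hypothesis c1_bound : forall x, Rabs (c1 x) <= delta.
Hypothesis c2_bound : forall x, Rabs (c2 x) <= delta.
Hypothesis c1_support : forall x, N <= Rabs x -> c1 x = 0.
Hypothesis c2_support : forall x, N <= Rabs x -> c2 x = 0.

Local Notation q := (sqrt (alpha ^ 2 + 1)).

Lemma q_sqr : q * q = alpha ^ 2 + 1.
Proof. apply sqrt_sqrt. nra. Qed.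

Lemma q_ge_1 : 1 <= q.
Proof.
  apply Rle_trans with (sqrt 1); [rewrite sqrt_1; lra | apply sqrt_le_1_alt; nra].
Qed.

Lemma alpha_le_q : alpha <= q.
Proof. assert (A := q_sqr). assert (B := q_ge_1). nra. Qed.

Lemma delta_bounds : 0 < delta <= eps.
Proof. split; nra. Qed.

(** The sine of the inclination of [rho]. Its derivative is the left-hand side of the Cauchy
    equation, so one integration solves for it and [drho] follows algebraically. *)
Definition tilt (h : R) : R := RInt (fun t => c2 (t * q)) 0 h.
Definition drho (h : R) : R := slope_of_sine (tilt h).
Definition rho (h : R) : R := RInt drho 0 h.
Definition ddrho (h : R) : R := c2 (h * q) / ((1 - tilt h ^ 2) * sqrt (1 - tilt h ^ 2)).

Lemma c2_scaled_cont t : continuous (fun t => c2 (t * q)) t.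
Proof.
  apply (continuous_comp (fun t => t * q) c2); [|apply c2_cont].
  apply (ex_derive_continuous (fun t => t * q)). auto_derive. auto.
Qed.

Lemma is_derive_tilt h : is_derive tilt h (c2 (h * q)).
Proof. exact (is_derive_RInt_of_continuous _ 0 h c2_scaled_cont). Qed.

Lemma tilt_bound h : Rabs (tilt h) <= eps.
Proof.
  assert (Q := q_ge_1). assert (D := delta_bounds).
  apply Rle_trans with (delta * (N / q)).
  - apply Rabs_RInt_le_support.
    + apply Rmult_le_pos; [lra | left; apply Rinv_0_lt_compat; lra].
    + apply c2_scaled_cont.
    + intros x. apply c2_bound.
    + intros x Hx. apply c2_support. rewrite Rabs_mult, (Rabs_right q) by lra.
      apply Rmult_le_compat_r with (r := q) in Hx; [|lra].
      replace (N / q * q) with N in Hx by (field; lra). exact Hx.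
  - rewrite <- eps_def. apply Rmult_le_compat_l; [lra|].
    apply Rmult_le_reg_r with q; [lra|]. unfold Rdiv.
    rewrite Rmult_assoc, Rinv_l by lra. nra.
Qed.

Lemma tilt_half h : Rabs (tilt h) <= / 2.
Proof. assert (H := tilt_bound h). lra. Qed.

Lemma tilt_lt_1 h : Rabs (tilt h) < 1.
Proof. assert (H := tilt_bound h). lra. Qed.

Lemma is_derive_drho h : is_derive drho h (ddrho h).
Proof.
  unfold ddrho.
  apply (is_derive_comp (K := R_AbsRing) (V := R_NormedModule) slope_of_sine tilt).
  - apply is_derive_slope_of_sine, tilt_lt_1.
  - apply is_derive_tilt.
Qed.

Lemma drho_cont h : continuous drho h.
Proof. apply (ex_derive_continuous drho). exists (ddrho h). apply is_derive_drho. Qed.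

Lemma drho_bound h : Rabs (drho h) <= 2 * eps.
Proof.
  apply Rle_trans with (1 := Rabs_slope_of_sine_le _ (tilt_half h)).
  assert (H := tilt_bound h). lra.
Qed.

Lemma is_derive_rho h : is_derive rho h (drho h).
Proof. exact (is_derive_RInt_of_continuous _ 0 h drho_cont). Qed.

Lemma rho_cont h : continuous rho h.
Proof. apply (ex_derive_continuous rho). exists (drho h). apply is_derive_rho. Qed.

Lemma tilt_0 : tilt 0 = 0.
Proof. apply (RInt_point (V := R_CompleteNormedModule)). Qed.

Lemma rho_0 : rho 0 = 0.
Proof. apply (RInt_point (V := R_CompleteNormedModule)). Qed.

Lemma drho_0 : drho 0 = 0.
Proof. unfold drho, slope_of_sine. rewrite tilt_0. unfold Rdiv. apply Rmult_0_l. Qed.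

Lemma tilt_cont h : continuous tilt h.
Proof. apply (ex_derive_continuous tilt). eexists. apply is_derive_tilt. Qed.

Lemma ddrho_cont h : continuous ddrho h.
Proof.
  unfold ddrho. apply (continuous_mult (K := R_AbsRing)); [apply c2_scaled_cont|].
  apply (continuous_comp tilt (fun t => / ((1 - t ^ 2) * sqrt (1 - t ^ 2)))).
  - apply tilt_cont.
  - assert (P := one_minus_sqr_pos _ (tilt_lt_1 h)).
    assert (S := sqrt_one_minus_pos _ (tilt_lt_1 h)).
    apply (ex_derive_continuous (fun t => / ((1 - t ^ 2) * sqrt (1 - t ^ 2)))).
    auto_derive. replace (1 + - (tilt h * (tilt h * 1))) with (1 - tilt h ^ 2) by ring.
    repeat split; nra.
Qed.

Lemma rho_bound h : Rabs (rho h) <= 2 * eps * Rabs h.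
Proof.
  unfold rho. rewrite <- (Rminus_0_r h) at 2. apply Rabs_RInt_le_const.
  - intros; apply drho_cont.
  - intros; apply drho_bound.
Qed.

(** [Phi] is the cosine that belongs to the sine [tilt]. *)
Lemma Phi_eq x : Phi alpha drho x = sqrt (1 - tilt (x / q) ^ 2).
Proof.
  unfold Phi, drho. rewrite sqrt_one_plus_slope_of_sine by apply tilt_lt_1.
  apply Rinv_inv.
Qed.

Local Notation Ph x := (sqrt (1 - tilt (x / q) ^ 2)).

Lemma Ph_bounds x : / 2 <= Ph x <= 1.
Proof. apply sqrt_one_minus_ge_half, tilt_half. Qed.

Lemma scaled_cont (f : R -> R) x : (forall y, continuous f y) -> continuous (fun x => f (x / q)) x.
Proof.
  intros Hf. apply (continuous_comp (fun x => x / q) f); [|apply Hf].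
  apply (ex_derive_continuous (fun x => x / q)). auto_derive. auto.
Qed.

Lemma inv_Ph_cont x : continuous (fun x => / Ph x) x.
Proof.
  apply (continuous_comp (fun x => tilt (x / q)) (fun t => / sqrt (1 - t ^ 2))).
  - apply scaled_cont, tilt_cont.
  - assert (P := one_minus_sqr_pos _ (tilt_lt_1 (x / q))).
    assert (S := Ph_bounds x).
    apply (ex_derive_continuous (fun t => / sqrt (1 - t ^ 2))).
    auto_derive. replace (1 + - (tilt (x / q) * (tilt (x / q) * 1))) with (1 - tilt (x / q) ^ 2) by ring.
    repeat split; lra.
Qed.

(** * The linear equation on the axis *)

(** Coefficients of [s' = sine_rate * s + sine_source]. Both contain the factor [c1], so their
    integrals stay bounded on the whole line. *)
Definition sine_rate (x : R) : R := c1 x * drho (x / q) / q * / Ph x.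
Definition sine_source (x : R) : R := c1 x * (alpha / q) * / Ph x.
Definition sine_exponent (x : R) : R := RInt sine_rate 0 x.

(** Along [y = 0] the sine [s(x)] of the slope of the surface in the direction
    of the [k1]-lines solves the linear equation
    [s' = k1 / Phi * (alpha + rho' (x / q) * s) / q], [s 0 = 0], with
    [q = sqrt (alpha ^ 2 + 1)]. *)
Definition sine_on_axis (x : R) : R :=
  exp (sine_exponent x) * RInt (fun t => exp (- sine_exponent t) * sine_source t) 0 x.

Lemma sine_rate_cont x : continuous sine_rate x.
Proof.
  apply (continuous_mult (K := R_AbsRing)); [|apply inv_Ph_cont].
  apply (continuous_mult (K := R_AbsRing)); [|apply continuous_const].
  apply (continuous_mult (K := R_AbsRing)); [apply c1_cont|].
  apply scaled_cont, drho_cont.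
Qed.

Lemma sine_source_cont x : continuous sine_source x.
Proof.
  apply (continuous_mult (K := R_AbsRing)); [|apply inv_Ph_cont].
  apply (continuous_mult (K := R_AbsRing)); [apply c1_cont | apply continuous_const].
Qed.

Lemma sine_exponent_bound x : Rabs (sine_exponent x) <= / 2.
Proof.
  assert (Q := q_ge_1). assert (D := delta_bounds).
  apply Rle_trans with (4 * delta * eps * N).
  - apply Rabs_RInt_le_support; [lra | apply sine_rate_cont | |].
    + intros t. unfold sine_rate, Rdiv. rewrite !Rabs_mult.
      assert (B1 := c1_bound t). assert (B2 := drho_bound (t * / q)).
      assert (B3 := Rabs_inv_le (Ph t) (/ 2) ltac:(lra) (proj1 (Ph_bounds t))).
      assert (B4 := Rabs_inv_le q 1 ltac:(lra) Q).
      rewrite Rinv_1 in B4. unfold Rdiv in B3. rewrite Rinv_inv in B3.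
      replace (4 * delta * eps) with (delta * (2 * eps) * 1 * 2) by ring.
      repeat apply Rmult_le_compat; repeat apply Rmult_le_pos; try apply Rabs_pos; assumption.
    + intros t Ht. unfold sine_rate. rewrite c1_support by exact Ht.
      unfold Rdiv. ring.
  - replace (4 * delta * eps * N) with (4 * (delta * N) * eps) by ring.
    rewrite eps_def. nra.
Qed.

Lemma sine_exponent_cont x : continuous sine_exponent x.
Proof.
  apply (ex_derive_continuous sine_exponent). exists (sine_rate x).
  exact (is_derive_RInt_of_continuous _ 0 x sine_rate_cont).
Qed.

Lemma sine_integrand_cont t : continuous (fun t => exp (- sine_exponent t) * sine_source t) t.
Proof.
  apply (continuous_mult (K := R_AbsRing)); [|apply sine_source_cont].
  apply (continuous_comp sine_exponent (fun y => exp (- y))); [apply sine_exponent_cont|].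
  apply (ex_derive_continuous (fun y => exp (- y))). auto_derive. auto.
Qed.

Lemma sine_on_axis_bound x : Rabs (sine_on_axis x) <= 18 * eps.
Proof.
  assert (Q := q_ge_1). assert (D := delta_bounds). assert (AQ := alpha_le_q).
  unfold sine_on_axis. rewrite Rabs_mult.
  (* Here 18 is 3 * 3 * 2: both exponentials are at most 3, since the exponent stays within 1/2, and
     [/ Ph] is at most 2. *)
  replace (18 * eps) with (3 * (6 * delta * N)) by (rewrite <- eps_def; ring).
  apply Rmult_le_compat; try apply Rabs_pos.
  - apply exp_le_3_of_half, sine_exponent_bound.
  - apply Rabs_RInt_le_support; [lra | apply sine_integrand_cont | |].
    + intros t. unfold sine_source. rewrite !Rabs_mult.
      assert (B1 := c1_bound t).
      assert (B3 := Rabs_inv_le (Ph t) (/ 2) ltac:(lra) (proj1 (Ph_bounds t))).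
      rewrite Rinv_inv in B3.
      assert (B2 : Rabs (exp (- sine_exponent t)) <= 3).
      { apply exp_le_3_of_half. rewrite Rabs_Ropp. apply sine_exponent_bound. }
      assert (B4 : Rabs (alpha / q) <= 1).
      { rewrite Rabs_right.
        - apply Rmult_le_reg_r with q; [lra|]. unfold Rdiv.
          rewrite Rmult_assoc, Rinv_l by lra. lra.
        - left. apply Rdiv_lt_0_compat; lra. }
      replace (6 * delta) with (3 * (delta * 1 * 2)) by ring.
      repeat apply Rmult_le_compat; repeat apply Rmult_le_pos; try apply Rabs_pos; assumption.
    + intros t Ht. unfold sine_source. rewrite c1_support by exact Ht. ring.
Qed.

Lemma is_derive_sine_on_axis x :
  is_derive sine_on_axis x (c1 x / Ph x * (alpha + drho (x / q) * sine_on_axis x) / q).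
Proof.
  assert (Q := q_ge_1). assert (P := Ph_bounds x).
  assert (H1 : is_derive sine_exponent x (sine_rate x))
    by exact (is_derive_RInt_of_continuous _ 0 x sine_rate_cont).
  set (T := fun x => RInt (fun t => exp (- sine_exponent t) * sine_source t) 0 x).
  assert (H2 : is_derive T x (exp (- sine_exponent x) * sine_source x))
    by exact (is_derive_RInt_of_continuous _ 0 x sine_integrand_cont).
  change sine_on_axis with (fun x => exp (sine_exponent x) * T x).
  auto_derive.
  - repeat split; eexists; [exact H1 | exact H2].
  - rewrite_derive H1. rewrite_derive H2.
    assert (HE : exp (sine_exponent x) * exp (- sine_exponent x) = 1)
      by (rewrite <- exp_plus, Rplus_opp_r; apply exp_0).
    replace (1 * sine_rate x * exp (sine_exponent x) * T x
             + exp (sine_exponent x) * (1 * (exp (- sine_exponent x) * sine_source x)))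
      with (sine_rate x * (exp (sine_exponent x) * T x)
            + (exp (sine_exponent x) * exp (- sine_exponent x)) * sine_source x) by ring.
    rewrite HE. unfold sine_rate, sine_source. field. lra.
Qed.

Lemma sine_on_axis_0 : sine_on_axis 0 = 0.
Proof.
  unfold sine_on_axis. rewrite (RInt_point (V := R_CompleteNormedModule)).
  unfold zero; simpl. ring.
Qed.

(** The bound on [rho] grows linearly, but [c1] vanishes where it would become large. *)
Lemma rho_c1_bound x : Rabs (rho (x / q) * c1 x) <= 2 * eps * eps.
Proof.
  assert (Q := q_ge_1). assert (D := delta_bounds).
  destruct (Rle_dec N (Rabs x)) as [H|H].
  - rewrite c1_support, Rmult_0_r, Rabs_R0 by exact H. nra.
  - rewrite Rabs_mult.
    replace (2 * eps * eps) with (2 * eps * N * delta) by (rewrite <- eps_def at 3; ring).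
    apply Rmult_le_compat; try apply Rabs_pos; [|apply c1_bound].
    apply Rle_trans with (1 := rho_bound _). apply Rmult_le_compat_l; [lra|].
    unfold Rdiv. rewrite Rabs_mult.
    assert (B4 := Rabs_inv_le q 1 ltac:(lra) Q). rewrite Rinv_1 in B4.
    pose proof (Rabs_pos x). pose proof (Rabs_pos (/ q)). nra.
Qed.

Local Notation den x := (Ph x + rho (x / q) * c1 x).

Lemma den_ge x : / 4 <= den x.
Proof.
  assert (A := rho_c1_bound x). assert (B := Ph_bounds x).
  apply Rabs_le_between in A. nra.
Qed.

(** * The change of parameter between [x] and [u] *)

(** The point [(x, 0)] has rotated coordinates [(x / q, alpha * x / q)]; this is the parameter [u]
    of the line [s = u - z rho(h)] through it, with [z] the sine found on the axis. *)
Definition axis_to_u (x : R) : R := alpha * x / q + rho (x / q) * sine_on_axis x.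
(** Factored so that [alpha + rho' s] and [Ph] cancel against the derivative of [sine_on_axis]; only
    [c1] over the denominator of the system is then left. *)
Definition axis_to_u_deriv (x : R) : R :=
  (alpha + drho (x / q) * sine_on_axis x) / q * (den x / Ph x).

Lemma is_derive_scaled (f : R -> R) (l x : R) :
  is_derive f (x / q) l -> is_derive (fun x => f (x / q)) x (l / q).
Proof.
  intros H. assert (Q := q_ge_1).
  replace (l / q) with (scal (/ q) l : R)
    by (unfold scal; simpl; unfold mult; simpl; unfold Rdiv; ring).
  apply (is_derive_comp (K := R_AbsRing) (V := R_NormedModule) f (fun x => x / q)); [exact H|].
  set (p := q) in *. auto_derive; [exact I|]. field. lra.
Qed.

Lemma is_derive_axis_to_u x : is_derive axis_to_u x (axis_to_u_deriv x).
Proof.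
  assert (Q := q_ge_1). assert (P := Ph_bounds x).
  assert (H1 := is_derive_scaled rho _ x (is_derive_rho (x / q))).
  assert (H2 := is_derive_sine_on_axis x).
  assert (G : forall (p : R) (r s : R -> R) (l m : R),
    is_derive r x l -> is_derive s x m ->
    is_derive (fun x => alpha * x / p + r x * s x) x (alpha / p + (l * s x + r x * m))).
  { intros p r s l m Hr Hs. auto_derive.
    - repeat split; eexists; [exact Hr | exact Hs].
    - rewrite_derive Hr. rewrite_derive Hs. unfold Rdiv. ring. }
  replace (axis_to_u_deriv x) with
    (alpha / q + (drho (x / q) / q * sine_on_axis x
       + rho (x / q) * (c1 x / Ph x * (alpha + drho (x / q) * sine_on_axis x) / q)))
    by (unfold axis_to_u_deriv; field; lra).
  apply (G q (fun x => rho (x / q)) sine_on_axis); assumption.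
Qed.

Lemma slope_factor_ge x : alpha / 2 <= alpha + drho (x / q) * sine_on_axis x.
Proof.
  assert (Q := q_ge_1).
  assert (B1 := drho_bound (x / q)). assert (B2 := sine_on_axis_bound x).
  assert (B : Rabs (drho (x / q) * sine_on_axis x) <= 2 * eps * (18 * eps)).
  { rewrite Rabs_mult. apply Rmult_le_compat; try apply Rabs_pos; assumption. }
  apply Rabs_le_between in B.
  assert (8 * eps <= alpha).
  { apply Rle_trans with (2 := eps_alpha). assert (1 <= q * N) by nra. nra. }
  nra.
Qed.

Lemma axis_to_u_deriv_ge x : alpha / (8 * q) <= axis_to_u_deriv x.
Proof.
  assert (Q := q_ge_1). assert (P := Ph_bounds x). assert (D := den_ge x).
  assert (S := slope_factor_ge x). unfold axis_to_u_deriv.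
  replace (alpha / (8 * q)) with (alpha / 2 / q * / 4) by (field; lra).
  apply Rmult_le_compat; [| lra | |].
  - apply Rmult_le_pos; [lra | left; apply Rinv_0_lt_compat; lra].
  - apply Rmult_le_compat_r; [left; apply Rinv_0_lt_compat; lra | exact S].
  - apply Rmult_le_reg_r with (Ph x); [lra|]. unfold Rdiv.
    rewrite Rmult_assoc, Rinv_l by lra. nra.
Qed.

Lemma axis_rate_pos : 0 < alpha / (8 * q).
Proof. assert (Q := q_ge_1). apply Rdiv_lt_0_compat; lra. Qed.

(** The first component [X] of the solution of the system. *)
Definition axis_of_u (u : R) : R :=
  proj1_sig (surjective_of_increasing axis_to_u axis_to_u_deriv _
               is_derive_axis_to_u axis_rate_pos axis_to_u_deriv_ge u).

Lemma axis_to_u_of_u u : axis_to_u (axis_of_u u) = u.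
Proof. exact (proj2_sig (surjective_of_increasing _ _ _ _ _ _ u)). Qed.

Lemma axis_of_u_to_u x : axis_of_u (axis_to_u x) = x.
Proof.
  assert (H := increment_abs_ge _ _ _ x (axis_of_u (axis_to_u x)) is_derive_axis_to_u axis_to_u_deriv_ge).
  rewrite axis_to_u_of_u, Rminus_diag, Rabs_R0 in H.
  assert (P := axis_rate_pos). pose proof (Rabs_pos (axis_of_u (axis_to_u x) - x)).
  assert (Rabs (axis_of_u (axis_to_u x) - x) = 0) by nra.
  apply Rabs_eq_0 in H1. lra.
Qed.

Lemma is_derive_axis_of_u u : is_derive axis_of_u u (/ axis_to_u_deriv (axis_of_u u)).
Proof.
  exact (is_derive_right_inverse _ _ _ _ is_derive_axis_to_u axis_rate_pos
           axis_to_u_deriv_ge axis_to_u_of_u u).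
Qed.

Lemma axis_of_u_cont u : continuous axis_of_u u.
Proof. apply (ex_derive_continuous axis_of_u). eexists. apply is_derive_axis_of_u. Qed.

(** * The base curve [v0] *)

(** At [x = axis_of_u u] this is the curvature of the graph of [v0] at [u], because it is the
    derivative of its sine. *)
Definition curvature_rate (x : R) : R := c1 x / den x.
Definition sine (u : R) : R := sine_on_axis (axis_of_u u).
Definition slope (u : R) : R := slope_of_sine (sine u).
Definition dslope (u : R) : R :=
  curvature_rate (axis_of_u u) * ((1 + slope u ^ 2) * sqrt (1 + slope u ^ 2)).

Lemma sine_bound u : Rabs (sine u) <= 18 * eps.
Proof. apply sine_on_axis_bound. Qed.

Lemma sine_half u : Rabs (sine u) <= / 2.
Proof. assert (H := sine_bound u). lra. Qed.

Lemma sine_lt_1 u : Rabs (sine u) < 1.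
Proof. assert (H := sine_bound u). lra. Qed.

Lemma is_derive_sine u : is_derive sine u (curvature_rate (axis_of_u u)).
Proof.
  assert (Q := q_ge_1). assert (P := Ph_bounds (axis_of_u u)).
  assert (D := den_ge (axis_of_u u)). assert (S := slope_factor_ge (axis_of_u u)).
  assert (H := is_derive_comp (K := R_AbsRing) (V := R_NormedModule) sine_on_axis axis_of_u u _ _
                 (is_derive_sine_on_axis _) (is_derive_axis_of_u u)).
  assert (E : / axis_to_u_deriv (axis_of_u u) *
      (c1 (axis_of_u u) / Ph (axis_of_u u)
        * (alpha + drho (axis_of_u u / q) * sine_on_axis (axis_of_u u)) / q)
      = curvature_rate (axis_of_u u))
    by (unfold curvature_rate, axis_to_u_deriv; field; repeat split; lra).
  rewrite <- E. exact H.
Qed.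

Lemma is_derive_slope u : is_derive slope u (dslope u).
Proof.
  unfold dslope, slope. rewrite sqrt_one_plus_slope_of_sine by apply sine_lt_1.
  rewrite one_plus_slope_of_sine by apply sine_lt_1. rewrite <- Rinv_mult.
  apply (is_derive_comp (K := R_AbsRing) (V := R_NormedModule) slope_of_sine sine).
  - apply is_derive_slope_of_sine, sine_lt_1.
  - apply is_derive_sine.
Qed.

Lemma slope_cont u : continuous slope u.
Proof. apply (ex_derive_continuous slope). eexists. apply is_derive_slope. Qed.

Lemma sine_cont u : continuous sine u.
Proof. apply (ex_derive_continuous sine). eexists. apply is_derive_sine. Qed.

Lemma sine_of_slope_slope u : slope u / sqrt (1 + slope u ^ 2) = sine u.
Proof. apply sine_of_slope_of_sine, sine_lt_1. Qed.

Lemma slope_bound u : Rabs (slope u) <= 1.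
Proof.
  apply Rle_trans with (1 := Rabs_slope_of_sine_le _ (sine_half u)).
  assert (H := sine_half u). lra.
Qed.

Lemma axis_of_0 : axis_of_u 0 = 0.
Proof.
  transitivity (axis_of_u (axis_to_u 0)); [f_equal | apply axis_of_u_to_u].
  unfold axis_to_u. rewrite sine_on_axis_0. unfold Rdiv. ring.
Qed.

Lemma slope_0 : slope 0 = 0.
Proof.
  unfold slope, sine. rewrite axis_of_0, sine_on_axis_0. unfold slope_of_sine, Rdiv. ring.
Qed.

Lemma curvature_rate_bound x : Rabs (curvature_rate x) <= 4 * delta.
Proof.
  unfold curvature_rate, Rdiv. rewrite Rabs_mult, Rmult_comm.
  assert (D := den_ge x). assert (B := Rabs_inv_le _ (/ 4) ltac:(lra) D).
  rewrite Rinv_inv in B. apply Rmult_le_compat; try apply Rabs_pos; [exact B | apply c1_bound].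
Qed.

Lemma den_cont x : continuous (fun x => den x) x.
Proof.
  apply (continuous_plus (V := R_NormedModule)).
  - apply (continuous_comp (fun x => tilt (x / q)) (fun t => sqrt (1 - t ^ 2))).
    + apply scaled_cont, tilt_cont.
    + assert (P := one_minus_sqr_pos _ (tilt_lt_1 (x / q))).
      apply (ex_derive_continuous (fun t => sqrt (1 - t ^ 2))). auto_derive.
      replace (1 + - (tilt (x / q) * (tilt (x / q) * 1))) with (1 - tilt (x / q) ^ 2) by ring.
      repeat split; lra.
  - apply (continuous_mult (K := R_AbsRing)); [apply scaled_cont, rho_cont | apply c1_cont].
Qed.

Lemma curvature_rate_cont x : continuous curvature_rate x.
Proof.
  apply (continuous_mult (K := R_AbsRing)); [apply c1_cont|].
  apply continuous_Rinv_comp; [apply den_cont|]. assert (D := den_ge x). lra.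
Qed.

Lemma dslope_cont u : continuous dslope u.
Proof.
  apply (continuous_mult (K := R_AbsRing)).
  - apply (continuous_comp axis_of_u curvature_rate); [apply axis_of_u_cont | apply curvature_rate_cont].
  - apply (continuous_comp slope (fun m => (1 + m ^ 2) * sqrt (1 + m ^ 2))); [apply slope_cont|].
    apply (ex_derive_continuous (fun m => (1 + m ^ 2) * sqrt (1 + m ^ 2))). auto_derive.
    repeat split; nra.
Qed.

Lemma axis_equation u : axis_of_u u = q / alpha * (u - rho (axis_of_u u / q) * sine u).
Proof.
  assert (Q := q_ge_1). assert (H := axis_to_u_of_u u). unfold axis_to_u in H.
  rewrite <- H at 2. unfold sine. field. lra.
Qed.

Lemma rho_curvature_rate_bound h x :
  Rabs h <= N -> Rabs (rho h * curvature_rate x) <= / 2.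
Proof.
  intros Hh. assert (B := curvature_rate_bound x). assert (R := rho_bound h).
  assert (D := delta_bounds). rewrite Rabs_mult.
  apply Rle_trans with (2 * eps * N * (4 * delta)).
  - apply Rmult_le_compat; try apply Rabs_pos; [|exact B].
    apply Rle_trans with (1 := R). apply Rmult_le_compat_l; lra.
  - replace (2 * eps * N * (4 * delta)) with (8 * eps * (delta * N)) by ring.
    rewrite eps_def. nra.
Qed.

Lemma Derive_v0 u : Derive (v0 slope) u = slope u.
Proof.
  apply is_derive_unique. exact (is_derive_RInt_of_continuous slope 0 u slope_cont).
Qed.

(** * The parallel curves and the inversion of the parametrization *)

(** For fixed [h], [(offset, height)] is the parallel curve of the graph of [v0] at signed distance
    [rho h] along the upward normal. Accordingly [offset_u] is [1 - curvature * distance], which is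
    positive short of the focal set. *)
Definition offset (u h : R) : R := u - sine u * rho h.
Definition offset_u (u h : R) : R := 1 - curvature_rate (axis_of_u u) * rho h.
Definition height (u h : R) : R := v0 slope u + rho h * sqrt (1 - sine u ^ 2).

Lemma sqrt_one_plus_slope u : sqrt (1 + slope u ^ 2) = / sqrt (1 - sine u ^ 2).
Proof. apply sqrt_one_plus_slope_of_sine, sine_lt_1. Qed.

Lemma U_eq u h : U slope rho u h = offset u h.
Proof.
  unfold U, offset. rewrite Derive_v0.
  replace (slope u * rho h / sqrt (1 + slope u ^ 2))
    with (slope u / sqrt (1 + slope u ^ 2) * rho h) by (unfold Rdiv; ring).
  now rewrite sine_of_slope_slope.
Qed.

Lemma V_eq u h : V slope rho u h = height u h.
Proof.
  unfold V, height. rewrite Derive_v0, sqrt_one_plus_slope.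
  unfold Rdiv. now rewrite Rinv_inv.
Qed.

Lemma offset_u_ge u h : Rabs h <= N -> / 2 <= offset_u u h.
Proof.
  intros Hh. assert (B := rho_curvature_rate_bound h (axis_of_u u) Hh).
  apply Rabs_le_between in B. unfold offset_u. lra.
Qed.

Lemma is_derive_offset_u u h : is_derive (fun u => offset u h) u (offset_u u h).
Proof.
  assert (H := is_derive_sine u). unfold offset, offset_u. auto_derive.
  - eexists; exact H.
  - rewrite_derive H. ring.
Qed.

Lemma clamp_N h : Rabs (clamp (- N) N h) <= N.
Proof.
  assert (B := clamp_between (- N) N h). unfold between in B.
  rewrite Rmin_left, Rmax_right in B by lra. now apply Rabs_le.
Qed.

Lemma clamp_N_id h : Rabs h <= N -> clamp (- N) N h = h.
Proof.
  intros H. apply clamp_id. unfold between.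
  rewrite Rmin_left, Rmax_right by lra. now apply Rabs_le_between.
Qed.

(** The inverse of [offset] in its first argument; clamping [h] only serves to
    make it total. *)
Definition foot (h s : R) : R :=
  proj1_sig (surjective_of_increasing (fun u => offset u (clamp (- N) N h))
    (fun u => offset_u u (clamp (- N) N h)) (/ 2)
    (fun u => is_derive_offset_u u _) (Rinv_0_lt_compat 2 Rlt_0_2)
    (fun u => offset_u_ge u _ (clamp_N h)) s).

Lemma offset_foot h s : Rabs h <= N -> offset (foot h s) h = s.
Proof.
  intros H. rewrite <- (clamp_N_id h H) at 2.
  unfold foot. match goal with |- context [proj1_sig ?x] => exact (proj2_sig x) end.
Qed.

Lemma offset_increment u u' h :
  Rabs h <= N -> / 2 * Rabs (u' - u) <= Rabs (offset u' h - offset u h).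
Proof.
  intros H.
  exact (increment_abs_ge (fun u => offset u h) (fun u => offset_u u h) (/ 2) u u'
    (fun u => is_derive_offset_u u h) (fun u => offset_u_ge u h H)).
Qed.

Lemma foot_offset h u : Rabs h <= N -> foot h (offset u h) = u.
Proof.
  intros H. assert (B := offset_increment u (foot h (offset u h)) h H).
  rewrite offset_foot, Rminus_diag, Rabs_R0 in B by exact H.
  pose proof (Rabs_pos (foot h (offset u h) - u)).
  assert (Z : Rabs (foot h (offset u h) - u) = 0) by lra.
  apply Rabs_eq_0 in Z. lra.
Qed.

Lemma rho_increment h h' : Rabs (rho h' - rho h) <= 2 * eps * Rabs (h' - h).
Proof. exact (Rabs_increment_le rho drho _ h h' is_derive_rho drho_bound). Qed.

(** The linear bound that [differentiable_implicit] asks of the inverse: [offset] expands in [u] by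
    at least 1/2, while a change of [h] moves it by at most a small multiple of that change. *)
Lemma foot_lipschitz h s h' s' : Rabs h <= N -> Rabs h' <= N ->
  Rabs (foot h' s' - foot h s) <= 4 * Rmax (Rabs (h' - h)) (Rabs (s' - s)).
Proof.
  intros H H'. assert (B := offset_increment (foot h s) (foot h' s') h' H').
  rewrite offset_foot in B by exact H'.
  replace (s' - offset (foot h s) h')
    with ((s' - s) + sine (foot h s) * (rho h' - rho h)) in B
    by (rewrite <- (offset_foot h s H) at 1; unfold offset; ring).
  assert (T := Rabs_triang (s' - s) (sine (foot h s) * (rho h' - rho h))).
  rewrite Rabs_mult in T.
  assert (R1 := rho_increment h h'). assert (R2 := sine_half (foot h s)).
  assert (M1 := Rmax_l (Rabs (h' - h)) (Rabs (s' - s))).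
  assert (M2 := Rmax_r (Rabs (h' - h)) (Rabs (s' - s))).
  pose proof (Rabs_pos (h' - h)). pose proof (Rabs_pos (rho h' - rho h)).
  pose proof (Rabs_pos (sine (foot h s))).
  assert (Rabs (sine (foot h s)) * Rabs (rho h' - rho h) <= / 2 * (2 * eps * Rabs (h' - h)))
    by (apply Rmult_le_compat; assumption).
  nra.
Qed.

Lemma differentiable_offset u h :
  differentiable_pt_lim offset u h (offset_u u h) (- (sine u * drho h)).
Proof.
  assert (Hs : differentiable_pt_lim (fun u _ => sine u) u h (curvature_rate (axis_of_u u)) 0)
    by apply differentiable_pt_lim_proj1_0, is_derive_Reals, is_derive_sine.
  assert (Hr := differentiable_comp1 rho (fun _ h => h) u h _ _ _ (is_derive_rho h)
                  (differentiable_snd u h)).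
  assert (Hm := differentiable_mult _ _ _ _ _ _ _ _ Hs Hr).
  assert (H := differentiable_lincomb (fun u _ => u) _ 1 (-1) u h _ _ _ _
                 (differentiable_fst u h) Hm).
  unfold offset_u.
  replace (1 - curvature_rate (axis_of_u u) * rho h)
    with (1 * 1 + -1 * (rho h * curvature_rate (axis_of_u u) + sine u * (drho h * 0))) by ring.
  replace (- (sine u * drho h)) with (1 * 0 + -1 * (rho h * 0 + sine u * (drho h * 1))) by ring.
  revert H. apply differentiable_pt_lim_ext, locally_2d_forall.
  intros. unfold offset. ring.
Qed.

Definition foot_h (h s : R) : R := sine (foot h s) * drho h / offset_u (foot h s) h.
Definition foot_s (h s : R) : R := / offset_u (foot h s) h.

Lemma differentiable_foot h s :
  Rabs h < N -> differentiable_pt_lim foot h s (foot_h h s) (foot_s h s).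
Proof.
  intros H. unfold foot_h, foot_s.
  replace (sine (foot h s) * drho h / offset_u (foot h s) h)
    with (- - (sine (foot h s) * drho h) / offset_u (foot h s) h)
    by (rewrite Ropp_involutive; reflexivity).
  apply (differentiable_implicit offset foot h s _ _ 4).
  - apply differentiable_offset.
  - assert (B := offset_u_ge (foot h s) h). lra.
  - lra.
  - assert (Hd : 0 < N - Rabs h) by lra.
    exists (mkposreal _ Hd). intros h' s' Hh' _. simpl in Hh'.
    assert (Rabs h' <= N).
    { replace h' with ((h' - h) + h) by ring.
      apply Rle_trans with (1 := Rabs_triang _ _). lra. }
    split; [now apply offset_foot | apply foot_lipschitz; lra].
Qed.

(** * The graph and its derivatives *)

Definition graph (h s : R) : R := height (foot h s) h.
Definition graph_s (h s : R) : R := slope (foot h s).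
(** The relation [cross_slope F_h F_s = rho'], solved for [F_h]. *)
Definition graph_h (h s : R) : R := drho h * sqrt (1 + graph_s h s ^ 2).
Definition graph_ss (h s : R) : R := dslope (foot h s) * foot_s h s.
Definition graph_hs (h s : R) : R := dslope (foot h s) * foot_h h s.
Definition graph_hh (h s : R) : R :=
  ddrho h * sqrt (1 + graph_s h s ^ 2) + drho h * sine (foot h s) * graph_hs h s.

Lemma differentiable_graph_s h s :
  Rabs h < N -> differentiable_pt_lim graph_s h s (graph_hs h s) (graph_ss h s).
Proof.
  intros H. apply (differentiable_comp1 slope foot); [apply is_derive_slope|].
  now apply differentiable_foot.
Qed.

Lemma differentiable_graph_h h s :
  Rabs h < N -> differentiable_pt_lim graph_h h s (graph_hh h s) (graph_hs h s).
Proof.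
  intros H. assert (P := sqrt_one_plus_pos (graph_s h s)).
  assert (Hr := differentiable_pt_lim_proj1_0 drho h s _ (proj1 (is_derive_Reals _ _ _) (is_derive_drho h))).
  assert (Hq := differentiable_comp1 (fun m => sqrt (1 + m ^ 2)) graph_s h s _ _ _
    (is_derive_sqrt_one_plus _) (differentiable_graph_s h s H)).
  assert (Hm := differentiable_mult _ _ _ _ _ _ _ _ Hr Hq).
  assert (B : 0 < offset_u (foot h s) h) by (assert (B := offset_u_ge (foot h s) h); lra).
  assert (E : graph_s h s / sqrt (1 + graph_s h s ^ 2) = sine (foot h s))
    by apply sine_of_slope_slope.
  rewrite E in Hm.
  replace (graph_hh h s) with (sqrt (1 + graph_s h s ^ 2) * ddrho h
     + drho h * (sine (foot h s) * graph_hs h s)) by (unfold graph_hh; ring).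
  (* The mixed derivatives agree because [foot_h = sine * rho' * foot_s]: [foot] is constant along
     the lines [s = u - sine u * rho h]. *)
  replace (graph_hs h s) with (sqrt (1 + graph_s h s ^ 2) * 0
     + drho h * (sine (foot h s) * graph_ss h s)) at 2
    by (unfold graph_ss, graph_hs, foot_s, foot_h; field; lra).
  exact Hm.
Qed.

(** Parallel curves have the same tangent at corresponding points, [height_u = slope * offset_u], so
    that [offset_u] cancels and [F_s] is the slope at the foot. In [F_h] the motion of the foot
    contributes [rho' sin^2 / cos] and the growth of the distance [rho' cos]; they add up to
    [rho' / cos]. *)
Lemma differentiable_graph h s :
  Rabs h < N -> differentiable_pt_lim graph h s (graph_h h s) (graph_s h s).
Proof.
  intros H. set (u := foot h s).
  assert (S := sqrt_one_minus_pos _ (sine_lt_1 u)).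
  assert (B : 0 < offset_u u h) by (assert (B := offset_u_ge u h); lra).
  assert (Hf := differentiable_foot h s H).
  assert (Hv := differentiable_comp1 (v0 slope) foot h s _ _ _
    (is_derive_RInt_of_continuous slope 0 _ slope_cont) Hf).
  assert (Hr := differentiable_pt_lim_proj1_0 rho h s _ (proj1 (is_derive_Reals _ _ _) (is_derive_rho h))).
  assert (Hsine := differentiable_comp1 sine foot h s _ _ _ (is_derive_sine _) Hf).
  assert (Hc := differentiable_comp1 (fun t => sqrt (1 - t ^ 2)) (fun h s => sine (foot h s)) h s _ _ _
    (is_derive_sqrt_one_minus _ (sine_lt_1 _)) Hsine).
  assert (Hm := differentiable_mult _ _ _ _ _ _ _ _ Hr Hc).
  assert (Ht := differentiable_plus _ _ _ _ _ _ _ _ Hv Hm).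
  fold u in Ht. change (slope_of_sine (sine u)) with (slope u) in Ht.
  replace (graph_h h s) with (slope u * foot_h h s + (sqrt (1 - sine u ^ 2) * drho h +
      rho h * (- slope u * (curvature_rate (axis_of_u u) * foot_h h s)))).
  replace (graph_s h s) with (slope u * foot_s h s + (sqrt (1 - sine u ^ 2) * 0 +
      rho h * (- slope u * (curvature_rate (axis_of_u u) * foot_s h s)))).
  - exact Ht.
  - unfold graph_s, foot_s. fold u. transitivity (slope u * / offset_u u h * offset_u u h).
    + unfold offset_u at 4. ring.
    + field. lra.
  - unfold graph_h, foot_h, graph_s. fold u. rewrite sqrt_one_plus_slope.
    transitivity (slope u * (sine u * drho h / offset_u u h) * offset_u u h
                  + sqrt (1 - sine u ^ 2) * drho h).
    + unfold offset_u at 4. ring.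
    + assert (Q := sqr_sqrt_one_minus _ (sine_lt_1 u)).
      transitivity (slope u * sine u * drho h + sqrt (1 - sine u ^ 2) * drho h); [field; lra|].
      unfold slope, slope_of_sine. set (r := sqrt (1 - sine u ^ 2)) in *.
      transitivity ((sine u ^ 2 + r * r) * drho h / r); [field; lra | rewrite Q; field; lra].
Qed.

Lemma continuous_foot h s :
  Rabs h < N -> continuous (fun p => foot (fst p) (snd p)) (h, s).
Proof.
  intros H. exact (continuous_of_differentiable _ _ _ _ _ (differentiable_foot h s H)).
Qed.

Lemma continuous_of_foot (f : R -> R) h s :
  Rabs h < N -> (forall x, continuous f x) ->
  continuous (fun p : R * R => f (foot (fst p) (snd p))) (h, s).
Proof.
  intros H Hf. apply (continuous_comp (fun p : R * R => foot (fst p) (snd p)) f);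
    [now apply continuous_foot | apply Hf].
Qed.

Lemma continuous_foot_s h s :
  Rabs h < N -> continuous (fun p => foot_s (fst p) (snd p)) (h, s).
Proof.
  intros H. unfold foot_s.
  apply (continuous_comp (fun p : R * R => offset_u (foot (fst p) (snd p)) (fst p)) Rinv);
    [|apply continuous_Rinv].
  - apply (continuous_minus (V := R_NormedModule)); [apply continuous_const|].
    apply (continuous_mult (K := R_AbsRing)).
    + apply (continuous_of_foot (fun u => curvature_rate (axis_of_u u)) h s H).
      intros x. apply (continuous_comp axis_of_u curvature_rate);
        [apply axis_of_u_cont | apply curvature_rate_cont].
    + apply continuous_of_fst, rho_cont.
  - cbn [fst snd]. assert (B := offset_u_ge (foot h s) h). lra.
Qed.

Lemma continuous_graph_ss h s :
  Rabs h < N -> continuous (fun p => graph_ss (fst p) (snd p)) (h, s).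
Proof.
  intros H. unfold graph_ss. apply (continuous_mult (K := R_AbsRing)).
  - apply (continuous_of_foot dslope h s H dslope_cont).
  - now apply continuous_foot_s.
Qed.

Lemma continuous_graph_hs h s :
  Rabs h < N -> continuous (fun p => graph_hs (fst p) (snd p)) (h, s).
Proof.
  intros H. unfold graph_hs, foot_h. apply (continuous_mult (K := R_AbsRing)).
  - apply (continuous_of_foot dslope h s H dslope_cont).
  - apply (continuous_mult (K := R_AbsRing)); [|now apply continuous_foot_s].
    apply (continuous_mult (K := R_AbsRing)).
    + apply (continuous_of_foot sine h s H sine_cont).
    + apply continuous_of_fst, drho_cont.
Qed.

Lemma continuous_graph_hh h s :
  Rabs h < N -> continuous (fun p => graph_hh (fst p) (snd p)) (h, s).
Proof.
  intros H. unfold graph_hh. apply (continuous_plus (V := R_NormedModule)).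
  - apply (continuous_mult (K := R_AbsRing)); [apply continuous_of_fst, ddrho_cont|].
    apply (continuous_of_foot (fun u => sqrt (1 + slope u ^ 2)) h s H).
    intros x. apply (continuous_comp slope (fun m => sqrt (1 + m ^ 2))); [apply slope_cont|].
    apply (ex_derive_continuous (fun m => sqrt (1 + m ^ 2))). eexists. apply is_derive_sqrt_one_plus.
  - apply (continuous_mult (K := R_AbsRing)); [|now apply continuous_graph_hs].
    apply (continuous_mult (K := R_AbsRing)).
    + apply continuous_of_fst, drho_cont.
    + apply (continuous_of_foot sine h s H sine_cont).
Qed.

(** * Principal curvatures of the graph *)

(** The curvature [kappa / (1 - kappa rho)] of the parallel curve, times the cosine of the angle
    between its normal and that of the surface: Meusnier's theorem for the section [h = const]. *)
Definition curvature1 (h s : R) : R :=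
  curvature_rate (axis_of_u (foot h s)) / offset_u (foot h s) h * sqrt (1 - tilt h ^ 2).

Lemma graph_normal h s :
  sqrt (1 + graph_h h s ^ 2 + graph_s h s ^ 2)
  = sqrt (1 + graph_s h s ^ 2) / sqrt (1 - tilt h ^ 2).
Proof.
  assert (P := sqrt_one_plus_pos (graph_s h s)). assert (Q := sqr_sqrt_one_plus (graph_s h s)).
  assert (T := sqrt_one_minus_pos _ (tilt_lt_1 h)).
  assert (T2 := sqr_sqrt_one_minus _ (tilt_lt_1 h)).
  apply sqrt_lem_1; [nra | left; apply Rdiv_lt_0_compat; assumption|].
  assert (O := one_plus_slope_of_sine _ (tilt_lt_1 h)). fold (drho h) in O.
  unfold graph_h. set (n := sqrt (1 + graph_s h s ^ 2)) in *. set (r := sqrt (1 - tilt h ^ 2)) in *.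
  transitivity (n * n * / (r * r)); [field; lra|].
  rewrite T2, <- O. transitivity (n * n + (drho h * n) ^ 2); [ring | rewrite Q; ring].
Qed.

Lemma graph_ss_eq h s : Rabs h < N ->
  graph_ss h s = curvature1 h s * sqrt (1 + graph_h h s ^ 2 + graph_s h s ^ 2) * (1 + graph_s h s ^ 2).
Proof.
  intros H. rewrite graph_normal. unfold graph_ss, curvature1, dslope, foot_s.
  fold (graph_s h s). assert (T := sqrt_one_minus_pos _ (tilt_lt_1 h)).
  assert (B := offset_u_ge (foot h s) h). field. lra.
Qed.

Lemma graph_hs_eq h s : Rabs h < N ->
  graph_hs h s = curvature1 h s * sqrt (1 + graph_h h s ^ 2 + graph_s h s ^ 2) * (graph_h h s * graph_s h s).
Proof.
  intros H. assert (B := offset_u_ge (foot h s) h).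
  assert (T := sqrt_one_minus_pos _ (tilt_lt_1 h)).
  rewrite graph_normal. unfold graph_h, graph_hs, foot_h, curvature1, dslope.
  rewrite <- sine_of_slope_slope. fold (graph_s h s).
  assert (P := sqrt_one_plus_pos (graph_s h s)). assert (Q := sqr_sqrt_one_plus (graph_s h s)).
  set (n := sqrt (1 + graph_s h s ^ 2)) in *. rewrite <- Q. field. lra.
Qed.

(** The left side is the [h]-component of [II v] for [v = (1 + F_s^2, - F_h F_s)], which is
    orthogonal to the [s]-direction in the first fundamental form; the [h]-component of [I v] is
    [W ^ 2]. *)
Lemma graph_hh_eq h s : Rabs h < N ->
  let W := sqrt (1 + graph_h h s ^ 2 + graph_s h s ^ 2) in
  (1 + graph_s h s ^ 2) * graph_hh h s - graph_h h s * graph_s h s * graph_hs h s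
  = c2 (h * q) * W * (W * W).
Proof.
  intros H. unfold graph_hh. rewrite graph_normal. cbn zeta.
  rewrite <- sine_of_slope_slope. fold (graph_s h s). unfold graph_h, ddrho.
  assert (P := sqrt_one_plus_pos (graph_s h s)). assert (Q := sqr_sqrt_one_plus (graph_s h s)).
  assert (T := sqrt_one_minus_pos _ (tilt_lt_1 h)).
  assert (T2 := sqr_sqrt_one_minus _ (tilt_lt_1 h)).
  set (n := sqrt (1 + graph_s h s ^ 2)) in *. set (r := sqrt (1 - tilt h ^ 2)) in *.
  rewrite <- T2, <- Q. field. lra.
Qed.

Lemma scaled_q_le x : Rabs (x / q) <= Rabs x.
Proof.
  assert (Q := q_ge_1). unfold Rdiv. rewrite Rabs_mult.
  assert (B4 := Rabs_inv_le q 1 ltac:(lra) Q). rewrite Rinv_1 in B4.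
  pose proof (Rabs_pos x). pose proof (Rabs_pos (/ q)). nra.
Qed.

Lemma Pi_rect_rotated c p :
  Pi_rect alpha c p <-> Rabs (rot_h alpha p) <= c / q /\ Rabs (rot_s alpha p) <= c * alpha / q.
Proof.
  assert (Q := q_ge_1). unfold Pi_rect, rot_h, rot_s.
  rewrite <- !Rabs_div_pos_le_iff by lra. tauto.
Qed.

Lemma foot_on_axis x : Rabs x <= N -> foot (x / q) (alpha * x / q) = axis_to_u x.
Proof.
  intros H. assert (B := scaled_q_le x).
  replace (alpha * x / q) with (offset (axis_to_u x) (x / q)).
  - apply foot_offset. lra.
  - unfold offset, sine. rewrite axis_of_u_to_u. unfold axis_to_u. ring.
Qed.

(** The denominator was designed for this: with [kappa = c1 / (Ph + rho c1)] one gets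
    [kappa / (1 - kappa rho) = c1 / Ph], and the cosine factor removes [Ph]. *)
Lemma curvature1_on_axis x : Rabs x <= N -> curvature1 (x / q) (alpha * x / q) = c1 x.
Proof.
  intros H. unfold curvature1. rewrite foot_on_axis by exact H.
  unfold offset_u. rewrite axis_of_u_to_u. unfold curvature_rate.
  assert (D := den_ge x). assert (P := Ph_bounds x).
  set (r := sqrt (1 - tilt (x / q) ^ 2)) in *. field. lra.
Qed.

Lemma prescribed_graph c : 0 < c < N -> prescribed_PC_graph alpha c c1 c2 (rot_graph alpha graph).
Proof.
  intros Hc. assert (Q := q_ge_1).
  assert (Hh : forall p, Pi_rect alpha c p -> Rabs (rot_h alpha p) < N).
  { intros p Hp. apply Pi_rect_rotated in Hp. apply Rle_lt_trans with (1 := proj1 Hp).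
    apply Rle_lt_trans with (2 := proj2 Hc). apply Rmult_le_reg_r with q; [lra|].
    unfold Rdiv. rewrite Rmult_assoc, Rinv_l by lra. nra. }
  set (J := rot_jet alpha graph_h graph_s graph_hh graph_hs graph_ss).
  assert (H00 : rot_h alpha (0, 0) = 0 /\ rot_s alpha (0, 0) = 0)
    by (unfold rot_h, rot_s, Rdiv; cbn [fst snd]; split; ring).
  assert (F0 : foot 0 0 = 0).
  { replace 0 with (offset 0 0) at 2.
    - apply foot_offset. rewrite Rabs_R0. lra.
    - unfold offset. rewrite rho_0. ring. }
  assert (G0 : graph_s 0 0 = 0) by (unfold graph_s; rewrite F0; apply slope_0).
  assert (Gh0 : graph_h 0 0 = 0) by (unfold graph_h; rewrite drho_0; ring).
  assert (P1 : forall p, Pi_rect alpha c p -> shape_operator J p (alpha, 1) =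
     (curvature1 (rot_h alpha p) (rot_s alpha p) * alpha, curvature1 (rot_h alpha p) (rot_s alpha p) * 1)).
  { intros p Hp. specialize (Hh p Hp).
    replace (alpha, 1) with (0 + alpha * 1, 1 - alpha * 0) by (f_equal; ring).
    rewrite (proj2 (principal_direction_rotated alpha J p 0 1 (curvature1 (rot_h alpha p) (rot_s alpha p)))).
    - f_equal; ring.
    - unfold rotated_principal, J.
      rewrite jet_h_rot, jet_s_rot, jet_hh_rot, jet_hs_rot, jet_ss_rot.
      rewrite (graph_hs_eq _ _ Hh), (graph_ss_eq _ _ Hh). split; ring. }
  assert (D1 : forall p, dot (1, - alpha, 0) (lift J p (alpha, 1)) = 0)
    by (intros p; unfold dot, lift; cbn [fst snd]; ring).
  assert (V1 : (alpha, 1) <> (0, 0)) by (intros E; injection E; lra).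
  exists J, (fun p => curvature1 (rot_h alpha p) (rot_s alpha p)), (fun p => c2 (rot_h alpha p * q)).
  split; [|split; [|split; [|split; [|split; [|split]]]]].
  - apply (is_C2_rotated alpha graph graph_h graph_s graph_hh graph_hs graph_ss
             (Pi_rect alpha c) (fun h _ => Rabs h < N)).
    + exact Hh.
    + apply differentiable_graph.
    + apply differentiable_graph_h.
    + apply differentiable_graph_s.
    + apply continuous_graph_hh.
    + apply continuous_graph_hs.
    + apply continuous_graph_ss.
  - unfold rot_graph. rewrite (proj1 H00), (proj2 H00). unfold graph, height.
    rewrite F0, rho_0. unfold v0. rewrite (RInt_point (V := R_CompleteNormedModule)).
    unfold zero; simpl. ring.
  - cbn [J rot_jet d_x]. rewrite (proj1 H00), (proj2 H00), G0, Gh0. unfold Rdiv. ring.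
  - cbn [J rot_jet d_y]. rewrite (proj1 H00), (proj2 H00), G0, Gh0. unfold Rdiv. ring.
  (* The horizontal part [(alpha, 1)] of the [k1]-direction is parallel to all planes
     [x - alpha y = const], so one of them serves as [beta]. *)
  - exists (Plane (1, - alpha, 0) 0). split.
    + cbn [nondegenerate]. unfold zero3. intros E. injection E. lra.
    + intros p Hp. exists (alpha, 1), (curvature1 (rot_h alpha p) (rot_s alpha p)).
      split; [split; [exact V1 | exact (P1 p Hp)] | exact (D1 p)].
  - intros p Hp. specialize (Hh p Hp). set (h := rot_h alpha p) in *. set (s := rot_s alpha p) in *.
    (* In the rotated axes [(m, n)] is the orthogonal complement of the [s]-direction in the first
       fundamental form, hence the second principal direction. *)
    set (m := 1 + graph_s h s ^ 2). set (n := - (graph_h h s * graph_s h s)).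
    exists (alpha, 1), (m + alpha * n, n - alpha * m).
    assert (Hm : 0 < m) by (unfold m; nra).
    split; [split; [exact V1 | exact (P1 p Hp)] |].
    split; [exact (D1 p)|].
    assert (Hdet : alpha * (n - alpha * m) - 1 * (m + alpha * n) <> 0) by nra.
    split; [|exact Hdet].
    split; [intros E; injection E; intros E1 E2; apply Hdet; rewrite E1, E2; ring|].
    cbn [fst snd]. apply principal_direction_rotated. unfold rotated_principal, J.
    rewrite jet_h_rot, jet_s_rot, jet_hh_rot, jet_hs_rot, jet_ss_rot. fold h s.
    assert (E := graph_hh_eq h s Hh). cbn zeta in E.
    rewrite (sqrt_sqrt (1 + graph_h h s ^ 2 + graph_s h s ^ 2)) in E by nra. split.
    + transitivity ((1 + graph_s h s ^ 2) * graph_hh h s - graph_h h s * graph_s h s * graph_hs h s);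
        [unfold m, n; ring|]. rewrite E. unfold m, n. ring.
    + rewrite (graph_hs_eq _ _ Hh), (graph_ss_eq _ _ Hh). unfold m, n. ring.
  - intros x Hx. unfold rot_h, rot_s. cbn [fst snd].
    replace ((x - alpha * 0) / q) with (x / q) by (unfold Rdiv; ring).
    replace ((alpha * x + 0) / q) with (alpha * x / q) by (unfold Rdiv; ring).
    split; [apply curvature1_on_axis; lra|]. f_equal. field. lra.
Qed.

Lemma denominator_eq x : denominator alpha c1 rho drho x = den x.
Proof. unfold denominator, rho_tilde. rewrite Phi_eq. ring. Qed.

(** * The data on the segment and the parameter range *)

Variables (a1 a : R) (k1 k2 : R -> R).
Hypothesis a_range : 0 < a < a1.
Hypothesis N_def : N = a1 + 1.
Hypothesis eps_gap : 8 * q * N * eps <= alpha * (a1 - a).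
Hypothesis k1_eq : forall x, segment a1 x -> c1 x = k1 x.
Hypothesis k2_eq : forall x, segment a1 x -> c2 x = k2 x.
Hypothesis c1_lipschitz : lipschitz_on a1 c1.

(** The midpoint of [a * alpha / q] and [a1 * alpha / q], the half-widths of the two rectangles in
    the [s]-direction. The margin on either side exceeds the drift [sine * rho], so lines with
    [|u| < u_range] cover the small rectangle and stay over the large one for [|h| <= a1 / q]. *)
Definition u_range : R := alpha * (a1 + a) / (2 * q).

Lemma u_range_pos : 0 < u_range.
Proof. assert (Q := q_ge_1). apply Rdiv_lt_0_compat; nra. Qed.

Lemma u_range_gap : u_range + 4 * eps * N <= a1 * alpha / q /\ a * alpha / q + 4 * eps * N <= u_range.
Proof.
  assert (Q := q_ge_1).
  assert (E : 4 * eps * N <= alpha * (a1 - a) / (2 * q)).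
  { apply Rmult_le_reg_r with (2 * q); [lra|].
    replace (alpha * (a1 - a) / (2 * q) * (2 * q)) with (alpha * (a1 - a)) by (field; lra). lra. }
  unfold u_range. split.
  - replace (a1 * alpha / q) with (alpha * (a1 + a) / (2 * q) + alpha * (a1 - a) / (2 * q))
      by (field; lra). lra.
  - replace (alpha * (a1 + a) / (2 * q)) with (a * alpha / q + alpha * (a1 - a) / (2 * q))
      by (field; lra). lra.
Qed.

Lemma u_range_le : u_range <= N.
Proof.
  assert (Q := q_ge_1). assert (AQ := alpha_le_q). assert (G := u_range_gap).
  assert (a1 * alpha / q <= a1).
  { apply Rmult_le_reg_r with q; [lra|]. unfold Rdiv. rewrite Rmult_assoc, Rinv_l by lra. nra. }
  nra.
Qed.

Lemma rho_axis_bound x : Rabs x <= N -> Rabs (rho (x / q)) <= 2 * eps * N.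
Proof.
  intros H. apply Rle_trans with (1 := rho_bound _). apply Rmult_le_compat_l; [lra|].
  assert (B := scaled_q_le x). lra.
Qed.

(** At the two ends of the data segment [axis_to_u] is within [2 eps N] of [alpha * x / q], which
    already lies outside the range of [u]; monotonicity does the rest. *)
Lemma axis_of_u_bound u : Rabs u < u_range -> Rabs (axis_of_u u) <= a1.
Proof.
  intros Hu. assert (G := proj1 u_range_gap). assert (Q := q_ge_1).
  assert (P := axis_rate_pos).
  assert (near : forall x, Rabs x = a1 -> Rabs (axis_to_u x - alpha * x / q) <= 2 * eps * N).
  { intros x Hx. replace (axis_to_u x - alpha * x / q) with (rho (x / q) * sine_on_axis x)
      by (unfold axis_to_u; ring).
    rewrite Rabs_mult. assert (B1 := rho_axis_bound x ltac:(lra)).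
    assert (B2 := sine_on_axis_bound x).
    apply Rle_trans with (2 * eps * N * 1); [|lra].
    apply Rmult_le_compat; try apply Rabs_pos; lra. }
  apply Rabs_def2 in Hu. apply Rabs_le. split; apply Rnot_lt_le; intros C.
  - assert (I := increment_ge _ _ _ _ _ is_derive_axis_to_u axis_to_u_deriv_ge (Rlt_le _ _ C)).
    rewrite axis_to_u_of_u in I.
    assert (B := near (- a1)). rewrite Rabs_Ropp, Rabs_right in B by lra.
    specialize (B eq_refl). apply Rabs_le_between in B.
    replace (alpha * - a1 / q) with (- (a1 * alpha / q)) in B by (field; lra). nra.
  - assert (I := increment_ge _ _ _ _ _ is_derive_axis_to_u axis_to_u_deriv_ge (Rlt_le _ _ C)).
    rewrite axis_to_u_of_u in I.
    assert (B := near a1). rewrite Rabs_right in B by lra.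
    specialize (B eq_refl). apply Rabs_le_between in B.
    replace (alpha * a1 / q) with (a1 * alpha / q) in B by (field; lra). nra.
Qed.

Lemma segment_scaled h : segment (a1 / q) h -> segment a1 (h * q).
Proof.
  assert (Q := q_ge_1). unfold segment. intros Hh. rewrite Rabs_mult, (Rabs_right q) by lra.
  apply Rmult_le_compat_r with (r := q) in Hh; [|lra].
  replace (a1 / q * q) with a1 in Hh by (field; lra). exact Hh.
Qed.

(** * The Cauchy problem for [rho] *)

Lemma cauchy_problem_rho : cauchy_problem alpha a1 k2 rho drho.
Proof.
  assert (Q := q_ge_1). split; [exact rho_0 | split; [exact drho_0|]].
  intros h Hh. split.
  - apply is_derive_deriv_within; [exact Hh | apply is_derive_rho].
  - exists (ddrho h). split.
    + apply is_derive_deriv_within; [exact Hh | apply is_derive_drho].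
    + assert (T := sqrt_one_minus_pos _ (tilt_lt_1 h)).
      assert (T2 := one_minus_sqr_pos _ (tilt_lt_1 h)).
      unfold drho. rewrite one_plus_slope_of_sine by apply tilt_lt_1.
      rewrite Rpower_three_halves by (apply Rinv_0_lt_compat, T2). rewrite sqrt_inv.
      rewrite <- k2_eq.
      * unfold ddrho. field. lra.
      * now apply segment_scaled.
Qed.

(** The sine of any solution's slope has the same derivative as [tilt], so Gronwall's inequality is
    applied with constant 0, once to the sines and once to the functions. *)
Lemma cauchy_problem_unique r dr :
  cauchy_problem alpha a1 k2 r dr -> forall h, segment (a1 / q) h -> r h = rho h.
Proof.
  intros [R0 [DR0 HR]].
  assert (Hint : forall h t f l, segment (a1 / q) h -> Rmin 0 h < t < Rmax 0 h ->
     deriv_within (segment (a1 / q)) f t l -> is_derive f t l).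
  { intros h t f l Hh Ht Hd. apply (deriv_within_interior (between 0 h)).
    - now apply locally_between.
    - apply deriv_within_sub with (segment (a1 / q)); auto.
      + intros x Hx. now apply between_0_segment with h.
      + unfold between; lra. }
  assert (Hcont : forall h (f : R -> R), segment (a1 / q) h ->
     (forall t, segment (a1 / q) t -> exists l, deriv_within (segment (a1 / q)) f t l) ->
     continuous_on (between 0 h) f).
  { intros h f Hh Hf. apply continuous_on_sub with (segment (a1 / q)).
    - intros t Ht. now apply between_0_segment with h.
    - intros t Ht. destruct (Hf t Ht) as [l Hl]. exact (deriv_within_continuous _ f t l Hl). }
  assert (Hdr : forall h, segment (a1 / q) h -> dr h = drho h).
  { intros h Hh.
    assert (Z : sine_of_slope (dr h) - tilt h = 0).
    { apply (zero_of_gronwall (fun t => sine_of_slope (dr t) - tilt t) (fun _ => 0) 0 0 h).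
      - apply continuous_on_minus.
        + apply (continuous_on_comp _ dr sine_of_slope).
          * apply Hcont; auto. intros t Ht. destruct (HR t Ht) as [_ [l [Hl _]]]. now exists l.
          * intros y. apply (ex_derive_continuous sine_of_slope). eexists.
            apply is_derive_sine_of_slope.
        + apply continuous_on_of_continuous. intros t _. apply tilt_cont.
      - intros t Ht. assert (Hs : segment (a1 / q) t)
          by (apply between_0_segment with h; [exact Hh | unfold between; lra]).
        split; [|rewrite Rabs_R0; lra].
        destruct (HR t Hs) as [_ [l [Hl El]]].
        assert (Dl := Hint h t dr l Hh Ht Hl).
        assert (P : 0 < 1 + dr t ^ 2) by nra.
        rewrite Rpower_three_halves in El by exact P.
        assert (S := sqrt_one_plus_pos (dr t)).
        assert (Ds : is_derive (fun t => sine_of_slope (dr t)) t (c2 (t * q))).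
        { rewrite k2_eq by (now apply segment_scaled). rewrite <- El.
          apply (is_derive_comp (K := R_AbsRing) (V := R_NormedModule) sine_of_slope dr t _ l
                   (is_derive_sine_of_slope (dr t)) Dl). }
        replace 0 with (minus (c2 (t * q)) (c2 (t * q)) : R)
          by (unfold minus, plus, opp; simpl; ring).
        apply (is_derive_minus (K := R_AbsRing) (V := R_NormedModule)); [exact Ds | apply is_derive_tilt].
      - rewrite DR0, tilt_0. unfold sine_of_slope, Rdiv. ring. }
    rewrite <- (slope_of_sine_of_slope (dr h)). unfold drho. f_equal. lra. }
  intros h Hh.
  assert (Z : r h - rho h = 0).
  { apply (zero_of_gronwall (fun t => r t - rho t) (fun _ => 0) 0 0 h).
    - apply continuous_on_minus.
      + apply Hcont; auto. intros t Ht. exists (dr t). apply HR, Ht.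
      + apply continuous_on_of_continuous. intros t _. apply rho_cont.
    - intros t Ht. assert (Hs : segment (a1 / q) t)
        by (apply between_0_segment with h; [exact Hh | unfold between; lra]).
      split; [|rewrite Rabs_R0; lra].
      replace 0 with (minus (drho t) (drho t) : R) by (unfold minus, plus, opp; simpl; ring).
      apply (is_derive_minus (K := R_AbsRing) (V := R_NormedModule)).
      + rewrite <- Hdr by exact Hs. apply (Hint h t r); auto. apply HR, Hs.
      + apply is_derive_rho.
    - rewrite R0, rho_0. ring. }
  lra.
Qed.

(** * The system and its iteration *)

Definition rate (x m : R) : R := curvature_rate x * cube_norm m.

(** Here the differentiability of [k1] enters, through [c1_lipschitz]; both uniqueness for the
    system and convergence of the iterates draw on it. *)
Lemma curvature_rate_lipschitz : lipschitz_on a1 curvature_rate.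
Proof.
  assert (Q := q_ge_1). unfold curvature_rate.
  apply lipschitz_on_mult; [lra | exact c1_lipschitz|].
  apply lipschitz_on_inv with (/ 4); [lra | intros; apply den_ge|].
  apply lipschitz_on_plus.
  - apply lipschitz_on_of_is_derive with (df := fun x => - drho (x / q) * c2 (x / q * q) / q); [lra | |].
    + intros x. apply (is_derive_scaled (fun h => sqrt (1 - tilt h ^ 2))).
      replace (- drho (x / q) * c2 (x / q * q)) with (scal (c2 (x / q * q)) (- drho (x / q)) : R)
        by (change (@scal R_AbsRing R_NormedModule) with Rmult; apply Rmult_comm).
      apply (is_derive_comp (K := R_AbsRing) (V := R_NormedModule) (fun t => sqrt (1 - t ^ 2)) tilt).
      * apply is_derive_sqrt_one_minus, tilt_lt_1.
      * apply is_derive_tilt.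
    + intros x. apply (continuous_mult (K := R_AbsRing)); [|apply continuous_const].
      apply (scaled_cont (fun h => - drho h * c2 (h * q))). intros h.
      apply (continuous_mult (K := R_AbsRing)); [|apply c2_scaled_cont].
      apply (continuous_opp (V := R_NormedModule)), drho_cont.
  - apply lipschitz_on_mult; [lra | | exact c1_lipschitz].
    apply lipschitz_on_of_is_derive with (df := fun x => drho (x / q) / q); [lra | |].
    + intros x. apply is_derive_scaled, is_derive_rho.
    + intros x. apply (continuous_mult (K := R_AbsRing)); [|apply continuous_const].
      apply scaled_cont, drho_cont.
Qed.

Lemma system_integrand x m :
  segment a1 x ->
  k1 x * Rpower (1 + m ^ 2) (3 / 2) / denominator alpha k1 rho drho x = rate x m.
Proof.
  intros Hx. replace (denominator alpha k1 rho drho x) with (denominator alpha c1 rho drho x)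
    by (unfold denominator; now rewrite k1_eq).
  rewrite denominator_eq, <- k1_eq by exact Hx.
  rewrite Rpower_three_halves by nra. unfold rate, curvature_rate, cube_norm. unfold Rdiv. ring.
Qed.

Lemma fst_operator_S Xw u :
  fst (operator_S alpha k1 rho drho Xw) u
  = q / alpha * (u - rho (fst Xw u / q) * sine_of_slope (snd Xw u)).
Proof.
  destruct Xw as [X w]. cbn [operator_S fst snd]. unfold rho_tilde, sine_of_slope, Rdiv. ring.
Qed.

Lemma snd_operator_S b Xw u :
  admissible a1 b Xw -> Rabs u < b ->
  snd (operator_S alpha k1 rho drho Xw) u
  = RInt (fun t => rate (fst Xw t) (snd Xw t)) 0 u.
Proof.
  destruct Xw as [X w]. intros Ha Hu. cbn [operator_S fst snd].
  apply RInt_ext. intros t Ht. apply system_integrand.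
  apply (Ha t). apply between_0_lt with u; [exact Hu|]. unfold between; lra.
Qed.

Lemma continuous_rate b Xw u :
  admissible a1 b Xw -> Rabs u < b -> continuous (fun t => rate (fst Xw t) (snd Xw t)) u.
Proof.
  intros Ha Hu. destruct (Ha u Hu) as [C1 [C2 _]]. apply (continuous_mult (K := R_AbsRing)).
  - apply (continuous_comp (fst Xw) curvature_rate); [exact C1 | apply curvature_rate_cont].
  - apply (continuous_comp (snd Xw) cube_norm); [exact C2 | apply cube_norm_cont].
Qed.

Lemma is_RInt_rate b Xw u :
  admissible a1 b Xw -> Rabs u < b ->
  is_RInt (fun t => rate (fst Xw t) (snd Xw t)) 0 u
    (snd (operator_S alpha k1 rho drho Xw) u).
Proof.
  intros Ha Hu. rewrite (snd_operator_S b) by assumption.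
  apply (RInt_correct (V := R_CompleteNormedModule)).
  apply (ex_RInt_continuous (V := R_CompleteNormedModule)). intros t Ht.
  apply (continuous_rate b); [exact Ha|]. now apply between_0_lt with u.
Qed.

Lemma is_derive_snd_operator_S b Xw u :
  admissible a1 b Xw -> Rabs u < b ->
  is_derive (snd (operator_S alpha k1 rho drho Xw)) u (rate (fst Xw u) (snd Xw u)).
Proof.
  intros Ha Hu.
  apply (is_derive_RInt (V := R_NormedModule) (fun t => rate (fst Xw t) (snd Xw t)) _ 0).
  - generalize (locally_Rabs_lt b u Hu). apply filter_imp. intros t Ht.
    now apply is_RInt_rate with b.
  - now apply continuous_rate with b.
Qed.

Lemma admissible_solution : admissible a1 u_range (axis_of_u, slope).
Proof.
  intros u Hu. cbn [fst snd].
  split; [apply axis_of_u_cont | split; [apply slope_cont | now apply axis_of_u_bound]].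
Qed.

Lemma system_solution_slope : system_solution alpha a1 u_range k1 rho drho (axis_of_u, slope).
Proof.
  split; [apply admissible_solution|]. intros u Hu. split.
  - rewrite fst_operator_S. cbn [fst snd]. rewrite axis_equation at 1. do 3 f_equal.
    symmetry. apply sine_of_slope_slope.
  - rewrite (snd_operator_S u_range) by (exact admissible_solution || exact Hu). cbn [fst snd].
    symmetry. apply is_RInt_unique.
    replace (slope u) with (minus (slope u) (slope 0) : R)
      by (rewrite slope_0; unfold minus, plus, opp; simpl; ring).
    apply (is_RInt_derive (V := R_CompleteNormedModule) slope).
    + intros t _. exact (is_derive_slope t).
    + intros t _. exact (dslope_cont t).
Qed.

(** The condition [8 q N eps <= alpha] is made for these quarters. They add up to the factor 1/2
    gained per iteration, and the first one lets the error of [X] be absorbed when two solutions are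
    compared. *)
Lemma axis_map_contraction u x y s t :
  segment a1 x -> segment a1 y -> Rabs s <= 1 ->
  Rabs (q / alpha * (u - rho (x / q) * s) - q / alpha * (u - rho (y / q) * t))
  <= / 4 * Rabs (x - y) + / 4 * Rabs (s - t).
Proof.
  intros Hx Hy Hs. assert (Q := q_ge_1). unfold segment in *.
  replace (q / alpha * (u - rho (x / q) * s) - q / alpha * (u - rho (y / q) * t))
    with (q / alpha * - ((rho (x / q) - rho (y / q)) * s + rho (y / q) * (s - t))) by ring.
  assert (Hqa : 0 < q / alpha) by (apply Rdiv_lt_0_compat; lra).
  rewrite Rabs_mult, Rabs_Ropp, (Rabs_right (q / alpha)) by lra.
  assert (R1 := rho_increment (y / q) (x / q)). assert (R2 := rho_axis_bound y ltac:(lra)).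
  replace (x / q - y / q) with ((x - y) / q) in R1 by (unfold Rdiv; ring).
  assert (R3 := scaled_q_le (x - y)).
  assert (T : Rabs ((rho (x / q) - rho (y / q)) * s + rho (y / q) * (s - t))
     <= 2 * eps * Rabs (x - y) * 1 + 2 * eps * N * Rabs (s - t)).
  { apply Rle_trans with (1 := Rabs_triang _ _). rewrite !Rabs_mult.
    apply Rplus_le_compat; apply Rmult_le_compat; try apply Rabs_pos; try lra. nra. }
  assert (K : q / alpha * (2 * eps * N) <= / 4).
  { apply Rmult_le_reg_r with alpha; [lra|].
    replace (q / alpha * (2 * eps * N) * alpha) with (q * (2 * eps * N)) by (field; lra). lra. }
  assert (K' : q / alpha * (2 * eps) <= / 4).
  { apply Rle_trans with (2 := K). apply Rmult_le_compat_l; [lra | nra]. }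
  pose proof (Rabs_pos (x - y)). pose proof (Rabs_pos (s - t)).
  apply Rle_trans with (q / alpha * (2 * eps * Rabs (x - y) * 1 + 2 * eps * N * Rabs (s - t))).
  - apply Rmult_le_compat_l; lra.
  - replace (q / alpha * (2 * eps * Rabs (x - y) * 1 + 2 * eps * N * Rabs (s - t)))
      with (q / alpha * (2 * eps) * Rabs (x - y) + q / alpha * (2 * eps * N) * Rabs (s - t)) by ring.
    apply Rplus_le_compat; apply Rmult_le_compat_r; assumption.
Qed.

(** The first equation bounds the difference of the [X] by that of the sines. The second,
    differentiated, then gives a Gronwall inequality for the sines alone. *)
Lemma system_solution_unique Y v :
  system_solution alpha a1 u_range k1 rho drho (Y, v) ->
  forall u, Rabs u < u_range -> Y u = axis_of_u u /\ v u = slope u.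
Proof.
  intros [Ha HS].
  assert (HY : forall u, Rabs u < u_range ->
     Rabs (Y u - axis_of_u u) <= Rabs (sine_of_slope (v u) - sine u)).
  { intros u Hu. destruct (HS u Hu) as [E _]. rewrite fst_operator_S in E. cbn [fst snd] in E.
    assert (SY : segment a1 (Y u)) by apply (Ha u Hu).
    assert (SX : segment a1 (axis_of_u u)) by now apply axis_of_u_bound.
    assert (C := axis_map_contraction u (Y u) (axis_of_u u) (sine_of_slope (v u)) (sine u)
      SY SX (Rlt_le _ _ (Rabs_sine_of_slope _))).
    rewrite <- E, <- axis_equation in C.
    pose proof (Rabs_pos (Y u - axis_of_u u)). pose proof (Rabs_pos (sine_of_slope (v u) - sine u)).
    lra. }
  assert (Hs : forall u, Rabs u < u_range -> sine_of_slope (v u) = sine u).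
  { intros u Hu. destruct curvature_rate_lipschitz as [L [HL Lip]].
    assert (Z : sine_of_slope (v u) - sine u = 0).
    { apply (zero_of_gronwall (fun t => sine_of_slope (v t) - sine t)
        (fun t => curvature_rate (Y t) - curvature_rate (axis_of_u t)) L 0 u).
      - apply continuous_on_of_continuous. intros t Ht.
        assert (Bt := between_0_lt _ _ _ Hu Ht).
        apply (continuous_minus (V := R_NormedModule)); [|apply sine_cont].
        apply (continuous_comp v sine_of_slope); [apply (Ha t Bt)|].
        apply (ex_derive_continuous sine_of_slope). eexists. apply is_derive_sine_of_slope.
      - intros t Ht. assert (Bt : Rabs t < u_range)
          by (apply between_0_lt with u; [exact Hu | unfold between; lra]).
        split.
        + apply (is_derive_minus (K := R_AbsRing) (V := R_NormedModule)); [|apply is_derive_sine].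
          assert (Dv : is_derive v t (rate (Y t) (v t))).
          { apply is_derive_ext_loc with (2 := is_derive_snd_operator_S u_range (Y, v) t Ha Bt).
            generalize (locally_Rabs_lt _ t Bt). apply filter_imp. intros z Hz.
            symmetry. apply (HS z Hz). }
          assert (P := sqrt_one_plus_pos (v t)).
          replace (curvature_rate (Y t)) with
            (rate (Y t) (v t) * / ((1 + v t ^ 2) * sqrt (1 + v t ^ 2)))
            by (unfold rate, cube_norm; field; nra).
          exact (is_derive_comp (K := R_AbsRing) (V := R_NormedModule) sine_of_slope v t _ _
                   (is_derive_sine_of_slope (v t)) Dv).
        + apply Rle_trans with (L * Rabs (Y t - axis_of_u t)).
          * apply Lip; [apply (Ha t Bt) | now apply axis_of_u_bound].
          * apply Rmult_le_compat_l; [exact HL | now apply HY].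
      - assert (H0 : Rabs 0 < u_range) by (rewrite Rabs_R0; apply u_range_pos).
        assert (E0 := proj2 (HS 0 H0)). rewrite (snd_operator_S u_range) in E0 by assumption.
        cbn [fst snd] in E0. rewrite E0.
        rewrite (RInt_point (V := R_CompleteNormedModule)).
        unfold sine. rewrite axis_of_0, sine_on_axis_0.
        unfold sine_of_slope, zero; simpl. unfold Rdiv. ring. }
    lra. }
  intros u Hu. split.
  - assert (B := HY u Hu). rewrite (Hs u Hu), Rminus_diag, Rabs_R0 in B.
    pose proof (Rabs_pos (Y u - axis_of_u u)).
    assert (Z : Rabs (Y u - axis_of_u u) = 0) by lra. apply Rabs_eq_0 in Z. lra.
  - rewrite <- (slope_of_sine_of_slope (v u)), (Hs u Hu). reflexivity.
Qed.

Lemma rate_increment : exists C, 0 <= C /\ forall x y m n e,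
  segment a1 x -> segment a1 y -> Rabs m <= 1 -> Rabs n <= 1 ->
  Rabs (x - y) <= e -> Rabs (m - n) <= e -> Rabs (rate x m - rate y n) <= C * e.
Proof.
  destruct curvature_rate_lipschitz as [L [HL Lip]].
  destruct cube_norm_lipschitz as [K [HK Kip]].
  assert (D := delta_bounds).
  exists (4 * L + 4 * delta * K). split; [nra|].
  intros x y m n e Hx Hy Hm Hn He He'.
  replace (rate x m - rate y n) with ((curvature_rate x - curvature_rate y) * cube_norm m
    + curvature_rate y * (cube_norm m - cube_norm n)) by (unfold rate; ring).
  apply Rle_trans with (1 := Rabs_triang _ _). rewrite !Rabs_mult.
  assert (B1 := cube_norm_bound m Hm). assert (B2 := curvature_rate_bound y).
  assert (B3 := Lip x y Hx Hy). assert (B4 := Kip m n Hm Hn).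
  rewrite (Rabs_right (cube_norm m)) by lra.
  replace ((4 * L + 4 * delta * K) * e) with (L * e * 4 + 4 * delta * (K * e)) by ring.
  apply Rplus_le_compat; apply Rmult_le_compat; try apply Rabs_pos; try lra.
  - apply Rle_trans with (1 := B3). now apply Rmult_le_compat_l.
  - apply Rle_trans with (1 := B4). now apply Rmult_le_compat_l.
Qed.

(** Invariance of [[-a1, a1]] under the first component of the operator: the outer margin of
    [u_range] leaves room for the perturbation by [rho]. *)
Lemma axis_map_bound u x m :
  Rabs u < u_range -> segment a1 x -> Rabs (q / alpha * (u - rho (x / q) * sine_of_slope m)) <= a1.
Proof.
  intros Hu Hx. assert (Q := q_ge_1). assert (G := proj1 u_range_gap). unfold segment in Hx.
  assert (R2 := rho_axis_bound x ltac:(lra)). assert (S := Rabs_sine_of_slope m).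
  assert (Hqa : 0 < q / alpha) by (apply Rdiv_lt_0_compat; lra).
  rewrite Rabs_mult, (Rabs_right (q / alpha)) by lra.
  assert (T : Rabs (u - rho (x / q) * sine_of_slope m) <= a1 * alpha / q).
  { unfold Rminus. apply Rle_trans with (1 := Rabs_triang _ _). rewrite Rabs_Ropp, Rabs_mult.
    assert (Rabs (rho (x / q)) * Rabs (sine_of_slope m) <= 2 * eps * N * 1)
      by (apply Rmult_le_compat; try apply Rabs_pos; lra).
    assert (0 <= eps * N) by nra. lra. }
  apply Rle_trans with (q / alpha * (a1 * alpha / q)).
  - apply Rmult_le_compat_l; lra.
  - right. field. lra.
Qed.

(** Admissibility and the bound 1 on the slope are carried through the induction because [rate] is
    known to be Lipschitz only for [|x| <= a1] and [|m| <= 1]. *)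
Lemma iterates_converge : exists M L, 0 < M /\ 0 < L /\ forall n,
  admissible a1 u_range (iterate_S alpha k1 rho drho n) /\
  forall u, Rabs u < u_range ->
    Rabs (snd (iterate_S alpha k1 rho drho n) u) <= 1 /\
    Rabs (fst (iterate_S alpha k1 rho drho n) u - axis_of_u u) <= M * (/ 2) ^ n * exp (L * Rabs u) /\
    Rabs (snd (iterate_S alpha k1 rho drho n) u - slope u) <= M * (/ 2) ^ n * exp (L * Rabs u).
Proof.
  destruct rate_increment as [C [HC Inc]]. assert (Q := q_ge_1). assert (D := delta_bounds).
  assert (ON := u_range_le).
  (* The start is off by at most [2 * a1] in [X] and 1 in [w]. With [L = 2 * C + 1] one integration
     multiplies the weighted error by [C / L <= / 2]. *)
  exists (2 * a1 + 1), (2 * C + 1). split; [lra | split; [lra|]].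
  induction n as [|n [Ha IH]].
  - change (iterate_S alpha k1 rho drho 0)
      with (fun u : R => q / alpha * u, fun _ : R => 0). split.
    + intros u Hu. cbn [fst snd]. split; [|split; [apply continuous_const|]].
      * apply (ex_derive_continuous (fun u => q / alpha * u)). auto_derive. auto.
      * assert (B := axis_map_bound u 0 0 Hu). unfold Rdiv at 2 in B.
        rewrite Rmult_0_l, rho_0, Rmult_0_l, Rminus_0_r in B. apply B.
        unfold segment. rewrite Rabs_R0. lra.
    + intros u Hu. cbn [fst snd]. rewrite Rabs_R0. split; [lra|].
      assert (E : 1 <= exp ((2 * C + 1) * Rabs u)).
      { apply Rle_trans with (exp 0); [rewrite exp_0; lra|]. apply exp_monotone. apply Rmult_le_pos; [lra | apply Rabs_pos]. }
      assert (E' : 2 * a1 + 1 <= (2 * a1 + 1) * (/ 2) ^ 0 * exp ((2 * C + 1) * Rabs u)).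
      { rewrite pow_O, Rmult_1_r. rewrite <- (Rmult_1_r (2 * a1 + 1)) at 1.
        apply Rmult_le_compat_l; lra. }
      split.
      * assert (B := axis_map_bound u 0 0 Hu). unfold Rdiv at 2 in B.
        rewrite Rmult_0_l, rho_0, Rmult_0_l, Rminus_0_r in B.
        assert (B1 : Rabs (q / alpha * u) <= a1) by (apply B; unfold segment; rewrite Rabs_R0; lra).
        assert (B2 := axis_of_u_bound u Hu).
        unfold Rminus. apply Rle_trans with (1 := Rabs_triang _ _). rewrite Rabs_Ropp. lra.
      * unfold Rminus. rewrite Rplus_0_l, Rabs_Ropp. assert (B := slope_bound u). lra.
  - change (iterate_S alpha k1 rho drho (S n))
      with (operator_S alpha k1 rho drho (iterate_S alpha k1 rho drho n)).
    set (Z := iterate_S alpha k1 rho drho n) in *.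
    assert (W1 : forall u, Rabs u < u_range ->
      Rabs (snd (operator_S alpha k1 rho drho Z) u) <= 1).
    { intros u Hu. rewrite (snd_operator_S u_range) by assumption.
      (* The 16 is 4 * 4, from the bounds on [curvature_rate] and [cube_norm]; since [|u| <= N], the
         integral is at most [16 * eps < 1]. *)
      apply Rle_trans with (16 * delta * Rabs (u - 0)).
      - apply Rabs_RInt_le_const.
        + intros t Ht. apply (continuous_rate u_range); [exact Ha|]. now apply between_0_lt with u.
        + intros t Ht. assert (Bt := between_0_lt _ _ _ Hu Ht). unfold rate. rewrite Rabs_mult.
          assert (B1 := cube_norm_bound _ (proj1 (IH t Bt))).
          assert (B2 := curvature_rate_bound (fst Z t)).
          rewrite (Rabs_right (cube_norm _)) by lra.
          replace (16 * delta) with (4 * delta * 4) by ring.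
          apply Rmult_le_compat; try apply Rabs_pos; lra.
      - rewrite Rminus_0_r. assert (16 * delta * Rabs u <= 16 * delta * N)
          by (apply Rmult_le_compat_l; lra).
        replace (16 * delta * N) with (16 * (delta * N)) in * by ring. rewrite eps_def in *. lra. }
    split.
    + intros u Hu. destruct (Ha u Hu) as [Cx [Cw Bx]]. split; [|split].
      * apply continuous_ext with (fun u => q / alpha * (u - rho (fst Z u / q) * sine_of_slope (snd Z u))).
        { intros t. symmetry. apply fst_operator_S. }
        apply (continuous_mult (K := R_AbsRing)); [apply continuous_const|].
        apply (continuous_minus (V := R_NormedModule)); [apply continuous_id|].
        apply (continuous_mult (K := R_AbsRing)).
        -- apply (continuous_comp (fst Z) (fun x => rho (x / q))); [exact Cx|].
           apply scaled_cont, rho_cont.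
        -- apply (continuous_comp (snd Z) sine_of_slope); [exact Cw|].
           apply (ex_derive_continuous sine_of_slope). eexists. apply is_derive_sine_of_slope.
      * apply (ex_derive_continuous (snd (operator_S alpha k1 rho drho Z))). eexists.
        now apply is_derive_snd_operator_S with u_range.
      * rewrite fst_operator_S. now apply axis_map_bound.
    + intros u Hu. split; [now apply W1|].
      destruct (IH u Hu) as [_ [IX IW]]. split.
      * rewrite fst_operator_S, axis_equation.
        apply Rle_trans with (1 := axis_map_contraction u (fst Z u) (axis_of_u u) _ (sine u)
          (proj2 (proj2 (Ha u Hu))) (axis_of_u_bound u Hu) (Rlt_le _ _ (Rabs_sine_of_slope _))).
        assert (T := Rabs_sine_of_slope_increment (snd Z u) (slope u)).
        change (sine_of_slope (slope u)) with (slope u / sqrt (1 + slope u ^ 2)) in T.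
        rewrite sine_of_slope_slope in T. cbn [pow].
        replace ((2 * a1 + 1) * (/ 2 * (/ 2) ^ n) * exp ((2 * C + 1) * Rabs u))
          with (/ 2 * ((2 * a1 + 1) * (/ 2) ^ n * exp ((2 * C + 1) * Rabs u))) by ring. lra.
      * assert (E1 := is_RInt_rate u_range Z u Ha Hu).
        assert (E2 := is_RInt_rate u_range (axis_of_u, slope) u admissible_solution Hu).
        destruct system_solution_slope as [_ HS]. destruct (HS u Hu) as [_ ES]. cbn [snd] in ES.
        rewrite <- ES in E2. cbn [fst snd] in E2.
        assert (E3 := is_RInt_minus (V := R_NormedModule) _ _ _ _ _ _ E1 E2).
        apply (is_RInt_unique (V := R_CompleteNormedModule)) in E3.
        apply Rle_trans with (Rabs (RInt (fun t => minus (rate (fst Z t) (snd Z t))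
                                                     (rate (axis_of_u t) (slope t))) 0 u));
          [right; f_equal; symmetry; exact E3|].
        apply Rle_trans with (C * ((2 * a1 + 1) * (/ 2) ^ n) / (2 * C + 1) * exp ((2 * C + 1) * Rabs u)).
        -- assert (Hp : 0 < (/ 2) ^ n) by (apply pow_lt; lra).
           apply Rabs_RInt_le_exp;
             [lra | apply Rmult_le_pos; [lra | apply Rmult_le_pos; lra] | |].
           ++ intros t Ht. assert (Bt := between_0_lt _ _ _ Hu Ht).
              apply (continuous_minus (V := R_NormedModule)).
              ** now apply (continuous_rate u_range).
              ** now apply (continuous_rate u_range (axis_of_u, slope) t admissible_solution).
           ++ intros t Ht. assert (Bt := between_0_lt _ _ _ Hu Ht).
              destruct (IH t Bt) as [B1 [B2 B3]].
              rewrite Rmult_assoc. apply Inc; auto.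
              ** apply (Ha t Bt).
              ** now apply axis_of_u_bound.
              ** apply slope_bound.
        -- cbn [pow]. apply Rmult_le_compat_r; [left; apply exp_pos|].
           assert (Hp : 0 < (/ 2) ^ n) by (apply pow_lt; lra).
           apply Rmult_le_reg_r with (2 * C + 1); [lra|].
           unfold Rdiv. rewrite Rmult_assoc, Rinv_l by lra.
           assert (0 <= (2 * a1 + 1) * (/ 2) ^ n) by (apply Rmult_le_pos; lra). nra.
Qed.

Lemma iterates_admissible n : admissible a1 u_range (iterate_S alpha k1 rho drho n).
Proof. destruct iterates_converge as [M [L [_ [_ H]]]]. apply H. Qed.

Lemma iterates_uniform_limit :
  uniform_limit u_range (iterate_S alpha k1 rho drho) (axis_of_u, slope).
Proof.
  destruct iterates_converge as [M [L [HM [HL H]]]]. intros e He.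
  set (K := M * exp (L * u_range)).
  assert (HK : 0 < K) by (apply Rmult_lt_0_compat; [exact HM | apply exp_pos]).
  destruct (pow_lt_1_zero (/ 2) ltac:(rewrite Rabs_right; lra) (e / K)
              (Rdiv_lt_0_compat _ _ He HK)) as [n0 Hn0].
  exists n0. intros n Hn u Hu. destruct (proj2 (H n) u Hu) as [_ [B1 B2]].
  assert (Hp : 0 < (/ 2) ^ n) by (apply pow_lt; lra).
  specialize (Hn0 n Hn). rewrite Rabs_right in Hn0 by lra.
  assert (B : M * (/ 2) ^ n * exp (L * Rabs u) < e).
  { apply Rle_lt_trans with (K * (/ 2) ^ n).
    - unfold K. replace (M * exp (L * u_range) * (/ 2) ^ n)
        with (M * (/ 2) ^ n * exp (L * u_range)) by ring.
      apply Rmult_le_compat_l; [nra|]. apply exp_monotone. nra.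
    - apply Rmult_lt_compat_l with (r := K) in Hn0; [|exact HK].
      replace (K * (e / K)) with e in Hn0 by (field; lra). exact Hn0. }
  cbn [fst snd]. split; lra.
Qed.

(** * Representation over the rectangle *)

Lemma param_xy_eq u h :
  param_xy alpha slope rho u h = ((h + alpha * offset u h) / q, (offset u h - alpha * h) / q).
Proof. unfold param_xy. now rewrite U_eq. Qed.

Lemma rot_of_coordinates h s :
  rot_h alpha ((h + alpha * s) / q, (s - alpha * h) / q) = h /\
  rot_s alpha ((h + alpha * s) / q, (s - alpha * h) / q) = s.
Proof.
  assert (Q := q_ge_1). assert (S := q_sqr). unfold rot_h, rot_s. cbn [fst snd].
  set (r := q) in *. split.
  - transitivity (h * (alpha ^ 2 + 1) / (r * r)); [field; lra | rewrite S; field; nra].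
  - transitivity (s * (alpha ^ 2 + 1) / (r * r)); [field; lra | rewrite S; field; nra].
Qed.

Lemma coordinates_of_rot p :
  p = ((rot_h alpha p + alpha * rot_s alpha p) / q, (rot_s alpha p - alpha * rot_h alpha p) / q).
Proof.
  assert (Q := q_ge_1). assert (S := q_sqr). destruct p as [x y]. unfold rot_h, rot_s.
  cbn [fst snd]. set (r := q) in *. f_equal.
  - transitivity (x * (alpha ^ 2 + 1) / (r * r)); [rewrite S; field; nra | field; lra].
  - transitivity (y * (alpha ^ 2 + 1) / (r * r)); [rewrite S; field; nra | field; lra].
Qed.

Lemma scaled_lt_N c h : c <= a1 -> Rabs h <= c / q -> Rabs h < N.
Proof.
  intros Hc Hh. assert (Q := q_ge_1). apply Rle_lt_trans with (1 := Hh).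
  apply Rmult_lt_reg_r with q; [lra|]. unfold Rdiv. rewrite Rmult_assoc, Rinv_l by lra. nra.
Qed.

Lemma graph_on_param u h : Rabs h <= N ->
  rot_graph alpha graph (param_xy alpha slope rho u h) = V slope rho u h.
Proof.
  intros Hh. rewrite param_xy_eq. unfold rot_graph.
  destruct (rot_of_coordinates h (offset u h)) as [E1 E2]. rewrite E1, E2.
  unfold graph. rewrite foot_offset by exact Hh. symmetry. apply V_eq.
Qed.

Lemma param_of_point p : Pi_rect alpha a p ->
  exists u h, Rabs u < u_range /\ Rabs h <= a / q /\ p = param_xy alpha slope rho u h.
Proof.
  intros Hp. apply Pi_rect_rotated in Hp. destruct Hp as [Hh Hs].
  set (h := rot_h alpha p) in *. set (s := rot_s alpha p) in *.
  assert (HN := scaled_lt_N a h ltac:(lra) Hh).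
  exists (foot h s), h. split; [|split; [exact Hh|]].
  - assert (G := proj2 u_range_gap). assert (O := offset_foot h s ltac:(lra)).
    replace (foot h s) with (s + sine (foot h s) * rho h) by (rewrite <- O at 1; unfold offset; ring).
    apply Rle_lt_trans with (1 := Rabs_triang _ _). rewrite Rabs_mult.
    assert (B1 := sine_half (foot h s)). assert (B2 := rho_bound h).
    assert (Rabs (sine (foot h s)) * Rabs (rho h) <= / 2 * (2 * eps * N)).
    { apply Rmult_le_compat; try apply Rabs_pos; [exact B1|].
      apply Rle_trans with (1 := B2). apply Rmult_le_compat_l; lra. }
    assert (0 < eps * N) by nra. lra.
  - rewrite param_xy_eq, offset_foot by lra. apply coordinates_of_rot.
Qed.

Lemma represented_graph : represented alpha a1 a u_range slope rho (rot_graph alpha graph).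
Proof.
  assert (Q := q_ge_1). intros p z Hp. split.
  - intros Hz. destruct (param_of_point p Hp) as [u [h [Hu [Hh E]]]].
    exists u, h. repeat split; auto.
    + unfold segment. apply Rle_trans with (1 := Hh). apply Rmult_le_compat_r; [|lra].
      left. apply Rinv_0_lt_compat. lra.
    + rewrite Hz, E. apply graph_on_param. left. apply scaled_lt_N with a; lra.
  - intros [u [h [Hu [Hh [E Hz]]]]]. rewrite E, graph_on_param; [exact Hz|].
    left. apply scaled_lt_N with a1; [lra | exact Hh].
Qed.

(** * A given surface and its comparison with the constructed one *)

Definition point (h s : R) : R * R := ((h + alpha * s) / q, (s - alpha * h) / q).

Lemma rot_h_point h s : rot_h alpha (point h s) = h.
Proof. apply rot_of_coordinates. Qed.

Lemma rot_s_point h s : rot_s alpha (point h s) = s.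
Proof. apply rot_of_coordinates. Qed.

Lemma point_on_axis x : point (x / q) (alpha * x / q) = (x, 0).
Proof.
  assert (Q := q_ge_1). assert (S := q_sqr). unfold point. set (r := q) in *. f_equal.
  - transitivity (x * (alpha ^ 2 + 1) / (r * r)); [field; lra | rewrite S; field; nra].
  - field. lra.
Qed.

(** Inserting the equations for the [k1]-direction into those for [v2] gives
    [(K1 - K2) I(v1, v2) = 0]. Either the point is umbilic and [II = K1 I], or [v2] is orthogonal to
    the [s]-direction; the third equation holds in both cases. *)
Lemma curvature_equations J p K1 K2 v1 v2 :
  principal_direction J p v1 K1 -> dot (1, - alpha, 0) (lift J p v1) = 0 ->
  principal_direction J p v2 K2 -> fst v1 * snd v2 - snd v1 * fst v2 <> 0 ->
  let jh := jet_h alpha J p in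
  let js := jet_s alpha J p in
  let W := sqrt (1 + jh ^ 2 + js ^ 2) in
  jet_hs alpha J p = K1 * W * (jh * js) /\
  jet_ss alpha J p = K1 * W * (1 + js ^ 2) /\
  (1 + js ^ 2) * jet_hh alpha J p - jh * js * jet_hs alpha J p = K2 * W * (W * W).
Proof.
  intros [_ E1] Hdot [_ E2] Hdet jh js W.
  destruct v1 as [x1 y1]. destruct v2 as [x2 y2]. unfold dot, lift in Hdot. cbn [fst snd] in *.
  assert (Hx1 : x1 = alpha * y1) by lra. subst x1.
  assert (Hy1 : y1 <> 0) by (intros Z; apply Hdet; rewrite Z; ring).
  set (k := (x2 - alpha * y2) / (alpha ^ 2 + 1)). set (l := (alpha * x2 + y2) / (alpha ^ 2 + 1)).
  assert (Ex : x2 = k + alpha * l) by (unfold k, l; field; nra).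
  assert (Ey : y2 = l - alpha * k) by (unfold k, l; field; nra).
  assert (Hk : k <> 0) by (intros Z; apply Hdet; rewrite Ex, Ey, Z; ring).
  rewrite Ex, Ey in E2. apply principal_direction_rotated in E2.
  replace (alpha * y1, y1) with (0 + alpha * y1, y1 - alpha * 0) in E1 by (f_equal; ring).
  replace (K1 * (alpha * y1), K1 * y1)
    with (K1 * (0 + alpha * y1), K1 * (y1 - alpha * 0)) in E1 by (f_equal; ring).
  apply principal_direction_rotated in E1.
  unfold rotated_principal in E1, E2. fold jh js W in E1, E2.
  destruct E1 as [E1h E1s]. destruct E2 as [E2h E2s].
  set (A := jet_hh alpha J p) in *. set (B := jet_hs alpha J p) in *. set (C := jet_ss alpha J p) in *.
  assert (EB : B = K1 * W * (jh * js)) by (apply Rmult_eq_reg_r with y1; [lra | exact Hy1]).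
  assert (EC : C = K1 * W * (1 + js ^ 2)) by (apply Rmult_eq_reg_r with y1; [lra | exact Hy1]).
  assert (HW : 0 < W) by (apply sqrt_lt_R0; nra).
  assert (HWW : W * W = 1 + jh ^ 2 + js ^ 2) by (apply sqrt_sqrt; nra).
  split; [exact EB | split; [exact EC|]].
  rewrite EB, EC in E2s. rewrite EB in E2h. rewrite EB.
  apply Rmult_eq_reg_r with k; [|exact Hk].
  assert (Z : (K1 - K2) * (jh * js * k + (1 + js ^ 2) * l) = 0).
  { apply Rmult_eq_reg_l with W; [|lra]. lra. }
  apply Rmult_integral in Z. destruct Z as [Z|Z].
  - assert (EK : K2 = K1) by lra. rewrite EK in *.
    assert (EA : A * k = K1 * W * (1 + jh ^ 2) * k) by lra.
    transitivity ((1 + js ^ 2) * (A * k) - jh * js * (K1 * W * (jh * js)) * k); [ring|].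
    rewrite EA, HWW. ring.
  - transitivity ((1 + js ^ 2) * (A * k + K1 * W * (jh * js) * l)
       - K1 * W * (jh * js) * (jh * js * k + (1 + js ^ 2) * l)); [ring|].
    rewrite E2h, Z, HWW.
    transitivity (K2 * W * ((1 + js ^ 2) * (1 + jh ^ 2) * k
       + jh * js * (jh * js * k + (1 + js ^ 2) * l) - jh * js * (jh * js) * k)); [ring|].
    rewrite Z. ring.
Qed.

Section Uniqueness.

Variables (c : R) (g : R * R -> R) (J : derivatives) (K1 K2 : R * R -> R).
Hypothesis c_range : 0 < c <= a1.
Hypothesis g_C2 : is_C2 (Pi_rect alpha c) g J.
Hypothesis d_x_0 : d_x J (0, 0) = 0.
Hypothesis d_y_0 : d_y J (0, 0) = 0.
Hypothesis g_principal : forall p, Pi_rect alpha c p -> exists v1 v2 : R * R,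
       principal_direction J p v1 (K1 p) /\
       dot (1, - alpha, 0) (lift J p v1) = 0 /\
       principal_direction J p v2 (K2 p) /\
       fst v1 * snd v2 - snd v1 * fst v2 <> 0.
Hypothesis g_data : forall x, Rabs x <= c -> K1 (x, 0) = k1 x /\ K2 (x, 0) = k2 x.

Local Notation jh p := (jet_h alpha J p).
Local Notation js p := (jet_s alpha J p).

(** Derivatives of the given surface are only relative to the closed rectangle; following curves
    inside it reduces every argument to one variable, with ordinary derivatives at interior
    parameters. *)
Definition curve (x1 x2 l1 l2 : R -> R) (t0 t1 : R) : Prop :=
  forall t, between t0 t1 t ->
    Pi_rect alpha c (point (x1 t) (x2 t)) /\ is_derive x1 t (l1 t) /\ is_derive x2 t (l2 t).

Lemma smooth_on_curve x1 x2 l1 l2 t0 t1 (f : R * R -> R) (fx fy : R * R -> R) :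
  curve x1 x2 l1 l2 t0 t1 ->
  (forall p, Pi_rect alpha c p -> gradient_within (Pi_rect alpha c) f p (fx p) (fy p)) ->
  smooth_between t0 t1 (fun t => f (point (x1 t) (x2 t)))
    (fun t => (l1 t + alpha * l2 t) / q * fx (point (x1 t) (x2 t))
              + (l2 t - alpha * l1 t) / q * fy (point (x1 t) (x2 t))).
Proof.
  intros Hc Hf. apply smooth_of_deriv_within. intros t Ht. assert (Q := q_ge_1).
  assert (lin : forall m n, is_derive (fun t => (m * x1 t + n * x2 t) / q) t ((m * l1 t + n * l2 t) / q)).
  { intros m n. destruct (Hc t Ht) as [_ [H1 H2]]. generalize q. intros r. auto_derive.
    - repeat split; eexists; eassumption.
    - rewrite_derive H1. rewrite_derive H2. unfold Rdiv. ring. }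
  apply (deriv_along_curve (Pi_rect alpha c) (between t0 t1) f
    (fun t => (x1 t + alpha * x2 t) / q) (fun t => (x2 t - alpha * x1 t) / q) t).
  - exact Ht.
  - intros s Hs. apply (Hc s Hs).
  - apply Hf. apply (Hc t Ht).
  - generalize (lin 1 alpha). rewrite Rmult_1_l. apply is_derive_ext.
    intros s. now rewrite Rmult_1_l.
  - replace (l2 t - alpha * l1 t) with (- alpha * l1 t + 1 * l2 t) by ring.
    generalize (lin (- alpha) 1). apply is_derive_ext. intros s. f_equal. ring.
Qed.

Lemma smooth_lincomb t0 t1 f df f' df' m n :
  smooth_between t0 t1 f df -> smooth_between t0 t1 f' df' ->
  smooth_between t0 t1 (fun t => (m * f t + n * f' t) / q) (fun t => (m * df t + n * df' t) / q).
Proof.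
  intros [C1 D1] [C2 D2]. split.
  - apply (continuous_on_comp _ (fun t => m * f t + n * f' t) (fun y => y / q)).
    + apply continuous_on_plus; [apply (continuous_on_comp _ f (fun y => m * y)) |
        apply (continuous_on_comp _ f' (fun y => n * y))]; try assumption;
      intros y; apply (continuous_mult (K := R_AbsRing)); (apply continuous_const || apply continuous_id).
    + intros y. apply (continuous_mult (K := R_AbsRing)); [apply continuous_id | apply continuous_const].
  - intros t Ht. assert (H1 := D1 t Ht). assert (H2 := D2 t Ht). generalize q. intros r.
    auto_derive.
    + repeat split; eexists; eassumption.
    + rewrite_derive H1. rewrite_derive H2. unfold Rdiv. ring.
Qed.

Lemma smooth_g x1 x2 l1 l2 t0 t1 :
  curve x1 x2 l1 l2 t0 t1 ->
  smooth_between t0 t1 (fun t => g (point (x1 t) (x2 t)))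
    (fun t => l1 t * jh (point (x1 t) (x2 t)) + l2 t * js (point (x1 t) (x2 t))).
Proof.
  intros Hc. destruct g_C2 as [HG _]. assert (Q := q_ge_1).
  apply smooth_ext with (3 := smooth_on_curve _ _ _ _ _ _ g (d_x J) (d_y J) Hc
                                (fun p Hp => proj1 (HG p Hp))); [reflexivity|].
  intros t _. unfold jet_h, jet_s. field. lra.
Qed.

Lemma smooth_jet_h x1 x2 l1 l2 t0 t1 :
  curve x1 x2 l1 l2 t0 t1 ->
  smooth_between t0 t1 (fun t => jh (point (x1 t) (x2 t)))
    (fun t => l1 t * jet_hh alpha J (point (x1 t) (x2 t)) + l2 t * jet_hs alpha J (point (x1 t) (x2 t))).
Proof.
  intros Hc. destruct g_C2 as [HG _]. assert (Q := q_ge_1). assert (S := q_sqr).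
  assert (H1 := smooth_on_curve _ _ _ _ _ _ (d_x J) (d_xx J) (d_xy J) Hc
                  (fun p Hp => proj1 (proj2 (HG p Hp)))).
  assert (H2 := smooth_on_curve _ _ _ _ _ _ (d_y J) (d_xy J) (d_yy J) Hc
                  (fun p Hp => proj2 (proj2 (HG p Hp)))).
  apply smooth_ext with (3 := smooth_lincomb _ _ _ _ _ _ 1 (- alpha) H1 H2).
  - intros t. unfold jet_h. f_equal. ring.
  - intros t _. unfold jet_hh, jet_hs. set (r := q) in *. rewrite <- S. field. lra.
Qed.

Lemma smooth_jet_s x1 x2 l1 l2 t0 t1 :
  curve x1 x2 l1 l2 t0 t1 ->
  smooth_between t0 t1 (fun t => js (point (x1 t) (x2 t)))
    (fun t => l1 t * jet_hs alpha J (point (x1 t) (x2 t)) + l2 t * jet_ss alpha J (point (x1 t) (x2 t))).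
Proof.
  intros Hc. destruct g_C2 as [HG _]. assert (Q := q_ge_1). assert (S := q_sqr).
  assert (H1 := smooth_on_curve _ _ _ _ _ _ (d_x J) (d_xx J) (d_xy J) Hc
                  (fun p Hp => proj1 (proj2 (HG p Hp)))).
  assert (H2 := smooth_on_curve _ _ _ _ _ _ (d_y J) (d_xy J) (d_yy J) Hc
                  (fun p Hp => proj2 (proj2 (HG p Hp)))).
  apply smooth_ext with (3 := smooth_lincomb _ _ _ _ _ _ alpha 1 H1 H2).
  - intros t. unfold jet_s. f_equal. ring.
  - intros t _. unfold jet_ss, jet_hs. set (r := q) in *. rewrite <- S. field. lra.
Qed.

Lemma jet_equations p : Pi_rect alpha c p ->
  let W := sqrt (1 + jh p ^ 2 + js p ^ 2) in
  jet_hs alpha J p = K1 p * W * (jh p * js p) /\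
  jet_ss alpha J p = K1 p * W * (1 + js p ^ 2) /\
  (1 + js p ^ 2) * jet_hh alpha J p - jh p * js p * jet_hs alpha J p = K2 p * W * (W * W).
Proof.
  intros Hp. destruct (g_principal p Hp) as [v1 [v2 [H1 [H2 [H3 H4]]]]].
  exact (curvature_equations J p (K1 p) (K2 p) v1 v2 H1 H2 H3 H4).
Qed.

Definition cross_sine (p : R * R) : R := sine_of_slope (cross_slope (jh p) (js p)).
Definition line_sine (p : R * R) : R := sine_of_slope (js p).

(** The absence of [l2] is constancy in the [s]-direction; the coefficient [K2] of [l1] is the
    equation satisfied by [tilt] once the data are inserted. *)
Lemma smooth_cross_sine x1 x2 l1 l2 t0 t1 :
  curve x1 x2 l1 l2 t0 t1 ->
  smooth_between t0 t1 (fun t => cross_sine (point (x1 t) (x2 t)))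
    (fun t => l1 t * K2 (point (x1 t) (x2 t))).
Proof.
  intros Hc. assert (Sh := smooth_jet_h _ _ _ _ _ _ Hc). assert (Ss := smooth_jet_s _ _ _ _ _ _ Hc).
  destruct Sh as [Ch Dh]. destruct Ss as [Cs Ds]. split.
  - apply (continuous_on_comp _ _ sine_of_slope).
    + apply (continuous_on_mult _ _ (fun t => / sqrt (1 + js (point (x1 t) (x2 t)) ^ 2))); [exact Ch|].
      apply (continuous_on_comp _ _ (fun y => / sqrt (1 + y ^ 2)) Cs).
      intros y. assert (P := sqrt_one_plus_pos y).
      apply (ex_derive_continuous (fun y => / sqrt (1 + y ^ 2))). auto_derive.
      replace (1 + y * (y * 1)) with (1 + y ^ 2) by ring. repeat split; nra.
    + intros y. apply (ex_derive_continuous sine_of_slope). eexists. apply is_derive_sine_of_slope.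
  - intros t Ht. set (p := point (x1 t) (x2 t)).
    assert (Hp : Pi_rect alpha c p) by (apply Hc; unfold between; lra).
    destruct (jet_equations p Hp) as [E1 [E2 E3]].
    assert (D := is_derive_cross_slope _ _ t _ _ (Dh t Ht) (Ds t Ht)). cbv beta in D. fold p in D.
    assert (D2 := is_derive_comp (K := R_AbsRing) (V := R_NormedModule) sine_of_slope _ t _ _
      (is_derive_sine_of_slope _) D). cbv beta in D2. fold p in D2.
    assert (P := sqrt_one_plus_pos (js p)). assert (Q := sqr_sqrt_one_plus (js p)).
    assert (P' := sqrt_one_plus_pos (cross_slope (jh p) (js p))).
    assert (Q' := sqr_sqrt_one_plus (cross_slope (jh p) (js p))).
    rewrite normal_cross_slope in E1, E2, E3.
    set (r := sqrt (1 + js p ^ 2)) in *. set (z := sqrt (1 + cross_slope (jh p) (js p) ^ 2)) in *.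
    replace (l1 t * K2 p) with
     (((l1 t * jet_hh alpha J p + l2 t * jet_hs alpha J p) / r -
       jh p * js p * (l1 t * jet_hs alpha J p + l2 t * jet_ss alpha J p) / ((1 + js p ^ 2) * r))
      * / ((1 + cross_slope (jh p) (js p) ^ 2) * z)).
    + exact D2.
    + rewrite <- Q', <- Q.
      transitivity ((l1 t * (r * r * jet_hh alpha J p - jh p * js p * jet_hs alpha J p)
         + l2 t * (r * r * jet_hs alpha J p - jh p * js p * jet_ss alpha J p)) / (r * r * r * (z * z * z)));
        [field; lra|].
      rewrite <- Q in E2, E3. rewrite E3, E2, E1. field. lra.
Qed.

(** The last factor vanishes exactly along curves of velocity [- rho' z] in [s]. On the axis, where
    [l1 = / q] and [l2 = alpha / q], it gives the linear equation of [sine_on_axis]. *)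
Lemma smooth_line_sine x1 x2 l1 l2 t0 t1 :
  curve x1 x2 l1 l2 t0 t1 ->
  smooth_between t0 t1 (fun t => line_sine (point (x1 t) (x2 t)))
    (fun t => let p := point (x1 t) (x2 t) in
       K1 p * sqrt (1 + cross_slope (jh p) (js p) ^ 2)
       * (l1 t * cross_slope (jh p) (js p) * line_sine p + l2 t)).
Proof.
  intros Hc. assert (Ss := smooth_jet_s _ _ _ _ _ _ Hc).
  destruct Ss as [Cs Ds]. split.
  - apply (continuous_on_comp _ _ sine_of_slope Cs).
    intros y. apply (ex_derive_continuous sine_of_slope). eexists. apply is_derive_sine_of_slope.
  - intros t Ht. cbv zeta. set (p := point (x1 t) (x2 t)).
    assert (Hp : Pi_rect alpha c p) by (apply Hc; unfold between; lra).
    destruct (jet_equations p Hp) as [E1 [E2 _]].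
    assert (D2 := is_derive_comp (K := R_AbsRing) (V := R_NormedModule) sine_of_slope _ t _ _
      (is_derive_sine_of_slope _) (Ds t Ht)). cbv beta in D2. fold p in D2.
    assert (P := sqrt_one_plus_pos (js p)). assert (Q := sqr_sqrt_one_plus (js p)).
    rewrite normal_cross_slope in E1, E2.
    unfold line_sine, sine_of_slope. set (z := sqrt (1 + cross_slope (jh p) (js p) ^ 2)) in *.
    unfold cross_slope.
    set (r := sqrt (1 + js p ^ 2)) in *.
    replace (K1 p * z * (l1 t * (jh p / r) * (js p / r) + l2 t)) with
      ((l1 t * jet_hs alpha J p + l2 t * jet_ss alpha J p) * / ((1 + js p ^ 2) * r)).
    + exact D2.
    + rewrite E1, E2, <- Q. field. lra.
Qed.

Lemma axis_in_rect x : Rabs x <= c -> Pi_rect alpha c (x, 0).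
Proof.
  intros Hx. unfold Pi_rect. cbn [fst snd].
  rewrite Rplus_0_r, Rabs_mult, (Rabs_right alpha), Rmult_0_r, Rminus_0_r by lra. split; nra.
Qed.

Lemma axis_curve x : Rabs x <= c ->
  curve (fun t => t / q) (fun t => alpha * t / q) (fun _ => / q) (fun _ => alpha / q) 0 x.
Proof.
  intros Hx t Ht. assert (Q := q_ge_1). split; [|split].
  - rewrite point_on_axis. apply axis_in_rect.
    exact (between_0_segment c x t Hx Ht).
  - generalize q. intros r. auto_derive; [exact I | unfold Rdiv; ring].
  - generalize q. intros r. auto_derive; [exact I | unfold Rdiv; ring].
Qed.

Lemma jets_at_0 : jh (0, 0) = 0 /\ js (0, 0) = 0.
Proof. unfold jet_h, jet_s. rewrite d_x_0, d_y_0. unfold Rdiv. split; ring. Qed.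

Lemma point_axis_0 : point (0 / q) (alpha * 0 / q) = (0, 0).
Proof. apply point_on_axis. Qed.

Lemma axis_segment t x : Rabs x <= c -> Rmin 0 x < t < Rmax 0 x -> Rabs t <= c.
Proof.
  intros Hx Ht. apply (between_0_segment c x t Hx). unfold between; lra.
Qed.

Lemma cross_sine_on_axis x : Rabs x <= c -> cross_sine (x, 0) = tilt (x / q).
Proof.
  intros Hx. assert (Q := q_ge_1).
  assert (S1 := smooth_cross_sine _ _ _ _ _ _ (axis_curve x Hx)).
  assert (S2 := smooth_of_is_derive 0 x (fun t => tilt (t / q)) _
                  (fun t => is_derive_scaled tilt _ t (is_derive_tilt (t / q)))).
  assert (Z := zero_of_smooth _ _ _ _ 0 (smooth_minus _ _ _ _ _ _ S1 S2)).
  cbv beta in Z. rewrite point_axis_0, (point_on_axis x) in Z.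
  assert (cross_sine (x, 0) - tilt (x / q) = 0); [apply Z | lra].
  - intros t Ht. rewrite point_on_axis. assert (Ht' := axis_segment t x Hx Ht).
    rewrite (proj2 (g_data t Ht')), <- k2_eq by (unfold segment; lra).
    replace (t / q * q) with t by (field; lra).
    replace (/ q * c2 t - c2 t / q) with 0 by (unfold Rdiv; ring). rewrite Rabs_R0. lra.
  - unfold cross_sine. destruct jets_at_0 as [-> ->]. unfold Rdiv at 1.
    rewrite Rmult_0_l, tilt_0. unfold cross_slope, sine_of_slope, Rdiv. ring.
Qed.

(** The segment [h = const] from [p] to the axis stays in the rectangle because the axis is its
    diagonal, so the value on the axis is carried to every point. *)
Lemma cross_sine_eq p : Pi_rect alpha c p -> cross_sine p = tilt (rot_h alpha p).
Proof.
  intros Hp. assert (Q := q_ge_1). set (h := rot_h alpha p). set (s := rot_s alpha p).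
  assert (Ep : p = point h s) by apply coordinates_of_rot.
  assert (HR := proj1 (Pi_rect_rotated c p) Hp). fold h s in HR. destruct HR as [Hh Hs].
  assert (Hx : Rabs (h * q) <= c).
  { rewrite Rabs_mult, (Rabs_right q) by lra.
    apply Rmult_le_compat_r with (r := q) in Hh; [|lra].
    replace (c / q * q) with c in Hh by (field; lra). exact Hh. }
  assert (E0 : point h (alpha * h) = (h * q, 0)).
  { rewrite <- (point_on_axis (h * q)). f_equal; field; lra. }
  assert (Hc : curve (fun _ => h) (fun t => t) (fun _ => 0) (fun _ => 1) (alpha * h) s).
  { intros t Ht. split; [|split].
    - apply Pi_rect_rotated. rewrite rot_h_point, rot_s_point. split; [exact Hh|].
      assert (Ha : Rabs (alpha * h) <= c * alpha / q).
      { rewrite Rabs_mult, (Rabs_right alpha) by lra.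
        replace (c * alpha / q) with (alpha * (c / q)) by (field; lra).
        apply Rmult_le_compat_l; lra. }
      apply Rabs_le_between in Ha. apply Rabs_le_between in Hs. apply Rabs_le.
      revert Ht. unfold between, Rmin, Rmax. destruct Rle_dec; lra.
    - apply (is_derive_const (K := R_AbsRing) (V := R_NormedModule)).
    - apply (is_derive_id (K := R_AbsRing)). }
  assert (S1 := smooth_cross_sine _ _ _ _ _ _ Hc).
  assert (S2 := smooth_of_is_derive (alpha * h) s (fun _ => tilt h) (fun _ => 0)
                  (fun t => is_derive_const (K := R_AbsRing) (V := R_NormedModule) _ t)).
  assert (Z := zero_of_smooth _ _ _ _ 0 (smooth_minus _ _ _ _ _ _ S1 S2)).
  cbv beta in Z. rewrite E0, <- Ep in Z.
  assert (cross_sine p - tilt h = 0); [apply Z | lra].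
  - intros t _. rewrite Rmult_0_l, Rminus_0_r, Rabs_R0. lra.
  - rewrite cross_sine_on_axis by exact Hx. replace (h * q / q) with h by (field; lra). ring.
Qed.

Lemma cross_slope_eq p : Pi_rect alpha c p -> cross_slope (jh p) (js p) = drho (rot_h alpha p).
Proof.
  intros Hp. unfold drho. rewrite <- cross_sine_eq by exact Hp. unfold cross_sine.
  symmetry. apply slope_of_sine_of_slope.
Qed.

Lemma jet_h_eq p : Pi_rect alpha c p -> jh p = drho (rot_h alpha p) * sqrt (1 + js p ^ 2).
Proof.
  intros Hp. rewrite <- cross_slope_eq by exact Hp. unfold cross_slope.
  assert (P := sqrt_one_plus_pos (js p)). field. lra.
Qed.

Lemma line_sine_on_axis x : Rabs x <= c -> line_sine (x, 0) = sine_on_axis x.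
Proof.
  intros Hx. assert (Q := q_ge_1).
  assert (S1 := smooth_line_sine _ _ _ _ _ _ (axis_curve x Hx)).
  assert (S2 := smooth_of_is_derive 0 x sine_on_axis _ is_derive_sine_on_axis).
  destruct (continuous_on_bounded sine_rate 0 x) as [M [HM BM]].
  { apply continuous_on_of_continuous. intros; apply sine_rate_cont. }
  assert (Z := zero_of_smooth _ _ _ _ M (smooth_minus _ _ _ _ _ _ S1 S2)).
  cbv beta zeta in Z. rewrite point_axis_0, (point_on_axis x) in Z.
  assert (line_sine (x, 0) - sine_on_axis x = 0); [apply Z | lra].
  - intros t Ht. rewrite point_on_axis. assert (Ht' := axis_segment t x Hx Ht).
    assert (Hp := axis_in_rect t Ht').
    rewrite cross_slope_eq by exact Hp.
    replace (rot_h alpha (t, 0)) with (t / q)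
      by (unfold rot_h; cbn [fst snd]; unfold Rdiv; ring).
    unfold drho at 1. rewrite sqrt_one_plus_slope_of_sine by apply tilt_lt_1.
    rewrite (proj1 (g_data t Ht')), <- k1_eq by (unfold segment; lra).
    assert (P := Ph_bounds t).
    (* The source terms cancel, and the difference solves the homogeneous equation with coefficient
       [sine_rate]. *)
    match goal with |- Rabs ?e <= _ =>
      replace e with (sine_rate t * (line_sine (t, 0) - sine_on_axis t))
        by (unfold sine_rate; field; lra) end.
    rewrite Rabs_mult. apply Rmult_le_compat_r; [apply Rabs_pos|].
    apply BM. unfold between; lra.
  - unfold line_sine. rewrite (proj2 jets_at_0), sine_on_axis_0. unfold sine_of_slope, Rdiv. ring.
Qed.

Lemma linked_sub u h t :
  linked_to_data alpha c axis_of_u slope rho u h -> between (axis_of_u u / q) h t ->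
  linked_to_data alpha c axis_of_u slope rho u t.
Proof.
  intros H Ht z Hz. apply H. unfold between in *. revert Ht Hz.
  unfold Rmin, Rmax. repeat destruct Rle_dec; lra.
Qed.

Lemma offset_on_axis u : offset u (axis_of_u u / q) = alpha * axis_of_u u / q.
Proof.
  assert (Q := q_ge_1). unfold offset. rewrite <- (axis_to_u_of_u u) at 1.
  unfold axis_to_u, sine. ring.
Qed.

Lemma line_curve u h :
  linked_to_data alpha c axis_of_u slope rho u h ->
  curve (fun t => t) (offset u) (fun _ => 1) (fun t => - (sine u * drho t)) (axis_of_u u / q) h.
Proof.
  intros H t Ht. split; [|split].
  - specialize (H t Ht). rewrite param_xy_eq in H. exact H.
  - apply (is_derive_id (K := R_AbsRing)).
  - assert (D := is_derive_rho t). unfold offset. auto_derive.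
    + eexists; exact D.
    + rewrite_derive D. ring.
Qed.

Lemma linked_axis u h :
  linked_to_data alpha c axis_of_u slope rho u h -> Rabs (axis_of_u u) <= c.
Proof.
  intros H. assert (Q := q_ge_1). set (h0 := axis_of_u u / q).
  assert (B0 : between h0 h h0) by (unfold between; split; [apply Rmin_l | apply Rmax_l]).
  destruct (line_curve u h H h0 B0) as [R _]. apply Pi_rect_rotated in R.
  rewrite rot_h_point in R. destruct R as [R _].
  now apply <- (Rabs_div_pos_le_iff (axis_of_u u) c q ltac:(lra)).
Qed.

Lemma line_start u : point (axis_of_u u / q) (offset u (axis_of_u u / q)) = (axis_of_u u, 0).
Proof. rewrite offset_on_axis. apply point_on_axis. Qed.

(** On a [k1]-line [line_sine] stays equal to its value on the axis, since
    [z = line_sine] of a solution satisfies [z_h = rho' z z_s] and the line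
    moves with velocity [- rho' z] in the [s]-direction. *)
Lemma line_sine_on_line u h :
  linked_to_data alpha c axis_of_u slope rho u h ->
  line_sine (point h (offset u h)) = sine u.
Proof.
  intros Hl. assert (Hc := line_curve u h Hl). assert (HX := linked_axis u h Hl).
  set (h0 := axis_of_u u / q) in *.
  assert (S1 := smooth_line_sine _ _ _ _ _ _ Hc).
  assert (S2 := smooth_of_is_derive h0 h (fun _ => sine u) (fun _ => 0)
                  (fun t => is_derive_const (K := R_AbsRing) (V := R_NormedModule) _ t)).
  (* Gronwall's inequality needs a bound on [K1], which is not assumed continuous. It is dominated
     by [jet_ss = K1 W (1 + js ^ 2)], which is continuous along the line. *)
  assert (Css : continuous_on (between h0 h) (fun t => jet_ss alpha J (point t (offset u t)))).
  { destruct g_C2 as [_ [Cxx [Cxy Cyy]]].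
    assert (Hcurve : forall f : R * R -> R, continuous_on (Pi_rect alpha c) f ->
      continuous_on (between h0 h) (fun t => f (point t (offset u t)))).
    { intros f Hf. apply (continuous_on_curve (Pi_rect alpha c) _ f
        (fun t => (t + alpha * offset u t) / q) (fun t => (offset u t - alpha * t) / q)); auto.
      - intros t Ht. apply (Hc t Ht).
      - intros t Ht. destruct (Hc t Ht) as [_ [_ D]].
        assert (Co : continuous (offset u) t) by (apply (ex_derive_continuous (offset u)); eexists; exact D).
        split; apply (continuous_mult (K := R_AbsRing)); try apply continuous_const.
        + apply (continuous_plus (V := R_NormedModule)); [apply continuous_id|].
          apply (continuous_mult (K := R_AbsRing)); [apply continuous_const | exact Co].
        + apply (continuous_minus (V := R_NormedModule)); [exact Co|].
          apply (continuous_mult (K := R_AbsRing)); [apply continuous_const | apply continuous_id]. }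
    assert (scale : forall (m : R) (f : R -> R), continuous_on (between h0 h) f ->
      continuous_on (between h0 h) (fun t => m * f t)).
    { intros m f Hf. apply (continuous_on_comp _ f (fun y => m * y) Hf).
      intros y. apply (continuous_mult (K := R_AbsRing)); [apply continuous_const | apply continuous_id]. }
    unfold jet_ss. apply (continuous_on_mult _ _ (fun _ => / (alpha ^ 2 + 1))).
    - apply continuous_on_plus; [apply continuous_on_plus|]; try apply scale; now apply Hcurve.
    - apply continuous_on_of_continuous. intros; apply continuous_const. }
  destruct (continuous_on_bounded _ _ _ Css) as [M [HM BM]].
  assert (Z := zero_of_smooth _ _ _ _ (M * 2) (smooth_minus _ _ _ _ _ _ S1 S2)).
  cbv beta zeta in Z.
  assert (line_sine (point h (offset u h)) - sine u = 0); [apply Z | lra].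
  - intros t Ht. assert (Bt : between h0 h t) by (unfold between; lra).
    set (p := point t (offset u t)).
    assert (Hp : Pi_rect alpha c p) by apply (Hc t Bt).
    specialize (BM t Bt). cbv beta in BM. fold p in BM.
    destruct (jet_equations p Hp) as [_ [E2 _]].
    rewrite cross_slope_eq by exact Hp.
    assert (Er : rot_h alpha p = t) by apply rot_h_point. rewrite Er.
    unfold drho at 1. rewrite sqrt_one_plus_slope_of_sine by apply tilt_lt_1.
    assert (P := sqrt_one_minus_ge_half _ (tilt_half t)).
    (* The line moves with the constructed sine rather than with that of the given surface. The
       mismatch is their difference, so the equation is again homogeneous. *)
    match goal with |- Rabs ?e <= _ =>
      replace e with (K1 p * (/ sqrt (1 - tilt t ^ 2) * drho t) * (line_sine p - sine u)) by ring end.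
    rewrite Rabs_mult. apply Rmult_le_compat_r; [apply Rabs_pos|].
    rewrite Rabs_mult. apply Rmult_le_compat; try apply Rabs_pos.
    + apply Rle_trans with (2 := BM). rewrite E2, Rmult_assoc, Rabs_mult.
      set (W := sqrt (1 + jh p ^ 2 + js p ^ 2)).
      assert (HW : 1 <= W) by (apply Rle_trans with (sqrt 1); [rewrite sqrt_1; lra | apply sqrt_le_1_alt; nra]).
      rewrite (Rabs_right (W * _)) by nra. pose proof (Rabs_pos (K1 p)).
      assert (1 <= W * (1 + js p ^ 2)) by nra. nra.
    + rewrite Rabs_mult. assert (B1 := drho_bound t).
      assert (B2 := Rabs_inv_le _ (/ 2) ltac:(lra) (proj1 P)). rewrite Rinv_inv in B2.
      pose proof (Rabs_pos (drho t)). pose proof (Rabs_pos (/ sqrt (1 - tilt t ^ 2))). nra.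
  - fold h0 in HX |- *. unfold h0. rewrite line_start, line_sine_on_axis by exact HX.
    unfold sine. ring.
Qed.

(** The derivative is written in the constructed functions alone: along the axis, and likewise along
    the lines treated next, any two such surfaces differ by a constant. *)
Lemma smooth_g_axis x : Rabs x <= c ->
  smooth_between 0 x (fun t => g (t, 0))
    (fun t => (drho (t / q) * sqrt (1 + slope_of_sine (sine_on_axis t) ^ 2)
               + alpha * slope_of_sine (sine_on_axis t)) / q).
Proof.
  intros Hx. assert (Q := q_ge_1).
  apply smooth_ext with (3 := smooth_g _ _ _ _ _ _ (axis_curve x Hx)).
  - intros t. now rewrite point_on_axis.
  - intros t Ht. rewrite point_on_axis.
    assert (Ht' : Rabs t <= c) by exact (between_0_segment c x t Hx Ht).
    rewrite jet_h_eq by now apply axis_in_rect.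
    replace (rot_h alpha (t, 0)) with (t / q)
      by (unfold rot_h; cbn [fst snd]; unfold Rdiv; ring).
    rewrite <- (slope_of_sine_of_slope (js (t, 0))). fold (line_sine (t, 0)).
    rewrite line_sine_on_axis by exact Ht'. field. lra.
Qed.

Lemma smooth_g_line u h :
  linked_to_data alpha c axis_of_u slope rho u h ->
  smooth_between (axis_of_u u / q) h (fun t => g (point t (offset u t)))
    (fun t => drho t * sqrt (1 + slope u ^ 2) - sine u * drho t * slope u).
Proof.
  intros Hl. apply smooth_ext with (3 := smooth_g _ _ _ _ _ _ (line_curve u h Hl)); [reflexivity|].
  intros t Ht. rewrite jet_h_eq by apply (line_curve u h Hl t Ht). rewrite rot_h_point.
  rewrite <- (slope_of_sine_of_slope (js _)).
  fold (line_sine (point t (offset u t))).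
  rewrite line_sine_on_line by exact (linked_sub u h t Hl Ht). fold (slope u). ring.
Qed.

End Uniqueness.

(** The point is reached from the origin along the axis up to [axis_of_u u] and then along the line
    with parameter [u]; on both pieces the difference has derivative 0. The size [c] is kept general
    for use with [a] and with [a1]. *)
Lemma prescribed_agree c f g u h :
  0 < c <= a1 -> prescribed_PC_graph alpha c k1 k2 f -> prescribed_PC_graph alpha c k1 k2 g ->
  linked_to_data alpha c axis_of_u slope rho u h ->
  g (point h (offset u h)) = f (point h (offset u h)).
Proof.
  intros Hc [Jf [K1f [K2f [Cf [F0 [Fx [Fy [_ [Pf Df]]]]]]]]]
    [Jg [K1g [K2g [Cg [G0 [Gx [Gy [_ [Pg Dg]]]]]]]]] Hl.
  assert (HX := linked_axis c u h Hl).
  set (h0 := axis_of_u u / q) in *.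
  assert (E0 : g (axis_of_u u, 0) - f (axis_of_u u, 0) = 0).
  { apply (zero_of_smooth 0 (axis_of_u u) (fun t => g (t, 0) - f (t, 0)) _ 0
      (smooth_minus _ _ _ _ _ _
        (smooth_g_axis c g Jg K1g K2g Hc Cg Gx Gy Pg Dg _ HX)
        (smooth_g_axis c f Jf K1f K2f Hc Cf Fx Fy Pf Df _ HX))).
    - intros t _. rewrite Rminus_diag, Rabs_R0. lra.
    - rewrite F0, G0. ring. }
  assert (E1 : g (point h (offset u h)) - f (point h (offset u h)) = 0).
  { apply (zero_of_smooth h0 h (fun t => g (point t (offset u t)) - f (point t (offset u t))) _ 0
      (smooth_minus _ _ _ _ _ _
        (smooth_g_line c g Jg K1g K2g Hc Cg Gx Gy Pg Dg u h Hl)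
        (smooth_g_line c f Jf K1f K2f Hc Cf Fx Fy Pf Df u h Hl))).
    - intros t _. rewrite Rminus_diag, Rabs_R0. lra.
    - unfold h0. rewrite line_start. exact E0. }
  lra.
Qed.

Lemma prescribed_graph_data c :
  0 < c <= a1 -> prescribed_PC_graph alpha c k1 k2 (rot_graph alpha graph).
Proof.
  intros Hc. destruct (prescribed_graph c ltac:(lra)) as [J [K1 [K2 [H1 [H2 [H3 [H4 [H5 [H6 H7]]]]]]]]].
  exists J, K1, K2. do 6 (split; [assumption|]). intros x Hx.
  rewrite <- k1_eq, <- k2_eq by (unfold segment; lra). now apply H7.
Qed.

Lemma prescribed_unique_linked g u h :
  prescribed_PC_graph alpha a k1 k2 g -> linked_to_data alpha a axis_of_u slope rho u h ->
  g (param_xy alpha slope rho u h) = rot_graph alpha graph (param_xy alpha slope rho u h).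
Proof.
  intros Hg Hl. rewrite param_xy_eq. apply (prescribed_agree a); auto; [lra|].
  apply prescribed_graph_data. lra.
Qed.

(** Such a line may leave the small rectangle on its way to the axis, but the drift is below the
    outer margin of [u_range], which keeps it over the large one. *)
Lemma linked_larger u h : Rabs u < u_range -> Rabs h <= a / q ->
  linked_to_data alpha a1 axis_of_u slope rho u h.
Proof.
  intros Hu Hh t Ht. assert (Q := q_ge_1). assert (G := proj1 u_range_gap).
  assert (HX := axis_of_u_bound u Hu).
  assert (I : 0 < / q) by (apply Rinv_0_lt_compat; lra).
  assert (Ht1 : Rabs t <= a1 / q).
  { assert (B0 : Rabs (axis_of_u u / q) <= a1 / q).
    { now apply (Rabs_div_pos_le_iff (axis_of_u u) a1 q ltac:(lra)). }
    assert (B1 : Rabs h <= a1 / q).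
    { apply Rle_trans with (1 := Hh). apply Rmult_le_compat_r; lra. }
    apply Rabs_le_between in B0. apply Rabs_le_between in B1. apply Rabs_le.
    revert Ht. unfold Rmin, Rmax. destruct Rle_dec; lra. }
  rewrite param_xy_eq. fold (point t (offset u t)). apply Pi_rect_rotated.
  rewrite rot_h_point, rot_s_point. split; [exact Ht1|]. unfold offset, Rminus.
  apply Rle_trans with (1 := Rabs_triang _ _). rewrite Rabs_Ropp, Rabs_mult.
  assert (HN := scaled_lt_N a1 t ltac:(lra) Ht1).
  assert (B1 := sine_half u). assert (B2 := rho_bound t).
  assert (Rabs (sine u) * Rabs (rho t) <= / 2 * (2 * eps * N)).
  { apply Rmult_le_compat; try apply Rabs_pos; [exact B1|].
    apply Rle_trans with (1 := B2). apply Rmult_le_compat_l; lra. }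
  assert (0 < eps * N) by nra. lra.
Qed.

Lemma prescribed_unique_larger g p :
  prescribed_PC_graph alpha a1 k1 k2 g -> Pi_rect alpha a p -> g p = rot_graph alpha graph p.
Proof.
  intros Hg Hp. destruct (param_of_point p Hp) as [u [h [Hu [Hh E]]]].
  rewrite E, param_xy_eq. apply (prescribed_agree a1); auto; [lra | |].
  - apply prescribed_graph_data. lra.
  - now apply linked_larger.
Qed.

Lemma PC_graph_representation :
  exists (f : R * R -> R) (rho drho : R -> R) (b : R) (X w : R -> R),
    prescribed_PC_graph alpha a k1 k2 f /\
    cauchy_problem alpha a1 k2 rho drho /\
    (forall r dr : R -> R, cauchy_problem alpha a1 k2 r dr ->
       forall h, segment (a1 / sqrt (alpha ^ 2 + 1)) h -> r h = rho h) /\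
    (forall x, segment a1 x -> denominator alpha k1 rho drho x <> 0) /\
    0 < b /\
    system_solution alpha a1 b k1 rho drho (X, w) /\
    (forall Y v : R -> R, system_solution alpha a1 b k1 rho drho (Y, v) ->
       forall u, Rabs u < b -> Y u = X u /\ v u = w u) /\
    represented alpha a1 a b w rho f /\
    (forall g : R * R -> R, prescribed_PC_graph alpha a k1 k2 g ->
       forall u h, Rabs u < b -> linked_to_data alpha a X w rho u h ->
         g (param_xy alpha w rho u h) = f (param_xy alpha w rho u h)) /\
    (forall g : R * R -> R, prescribed_PC_graph alpha a1 k1 k2 g ->
       forall p, Pi_rect alpha a p -> g p = f p) /\
    (forall n : nat, admissible a1 b (iterate_S alpha k1 rho drho n)) /\
    uniform_limit b (iterate_S alpha k1 rho drho) (X, w).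
Proof.
  exists (rot_graph alpha graph), rho, drho, u_range, axis_of_u, slope.
  split; [apply prescribed_graph_data; lra|].
  split; [exact cauchy_problem_rho|].
  split; [exact cauchy_problem_unique|].
  split.
  { intros x Hx. unfold denominator. rewrite <- k1_eq by exact Hx.
    fold (denominator alpha c1 rho drho x). rewrite denominator_eq.
    assert (D := den_ge x). lra. }
  split; [exact u_range_pos|].
  split; [exact system_solution_slope|].
  split; [exact system_solution_unique|].
  split; [exact represented_graph|].
  split; [intros g Hg u h _; now apply prescribed_unique_linked|].
  split; [intros g Hg p; now apply prescribed_unique_larger|].
  split; [exact iterates_admissible | exact iterates_uniform_limit].
Qed.

End Profile.

Theorem proposition4 (a1 alpha a : R) (ha1 : 0 < a1) (halpha : 0 < alpha)
    (ha : 0 < a < a1) :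
  exists delta : R, 0 < delta /\
  forall k1 k2 : R -> R,
    C1_on (segment a1) k1 ->
    continuous_on (segment a1) k2 ->
    Rbar_lt (sup_norm (segment a1) k1) delta ->
    Rbar_lt (sup_norm (segment a1) k2) delta ->
  exists (f : R * R -> R) (rho drho : R -> R) (b : R) (X w : R -> R),
    prescribed_PC_graph alpha a k1 k2 f /\
    cauchy_problem alpha a1 k2 rho drho /\
    (forall r dr : R -> R, cauchy_problem alpha a1 k2 r dr ->
       forall h, segment (a1 / sqrt (alpha ^ 2 + 1)) h -> r h = rho h) /\
    (forall x, segment a1 x -> denominator alpha k1 rho drho x <> 0) /\
    0 < b /\
    system_solution alpha a1 b k1 rho drho (X, w) /\
    (forall Y v : R -> R, system_solution alpha a1 b k1 rho drho (Y, v) ->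
       forall u, Rabs u < b -> Y u = X u /\ v u = w u) /\
    represented alpha a1 a b w rho f /\
    (forall g : R * R -> R, prescribed_PC_graph alpha a k1 k2 g ->
       forall u h, Rabs u < b -> linked_to_data alpha a X w rho u h ->
         g (param_xy alpha w rho u h) = f (param_xy alpha w rho u h)) /\
    (forall g : R * R -> R, prescribed_PC_graph alpha a1 k1 k2 g ->
       forall p, Pi_rect alpha a p -> g p = f p) /\
    (forall n : nat, admissible a1 b (iterate_S alpha k1 rho drho n)) /\
    uniform_limit b (iterate_S alpha k1 rho drho) (X, w).
Proof.
  set (q := sqrt (alpha ^ 2 + 1)). set (N := a1 + 1).
  assert (Hq : 1 <= q)
    by (apply Rle_trans with (sqrt 1); [rewrite sqrt_1; lra | apply sqrt_le_1_alt; nra]).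
  assert (HqN : 0 < 8 * q * N) by (unfold N; nra).
  (* The three bounds keep the sines below 1/2 with room to spare, make the first component of the
     operator contract and make the axis map increasing, and keep the drift of the lines below the
     gap between [a] and [a1]. *)
  set (eps := Rmin (/ 100) (Rmin (alpha / (8 * q * N)) (alpha * (a1 - a) / (8 * q * N)))).
  assert (He : 0 < eps).
  { repeat apply Rmin_glb_lt; [lra | |]; apply Rdiv_lt_0_compat; nra. }
  assert (He1 : eps <= / 100) by apply Rmin_l.
  assert (le_mul : forall z, eps <= z / (8 * q * N) -> 8 * q * N * eps <= z).
  { intros z Hz. apply Rmult_le_compat_l with (r := 8 * q * N) in Hz; [|lra].
    replace (8 * q * N * (z / (8 * q * N))) with z in Hz by (field; unfold N; lra). exact Hz. }
  assert (He2 : 8 * q * N * eps <= alpha).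
  { apply le_mul. apply Rle_trans with (1 := Rmin_r _ _), Rmin_l. }
  assert (He3 : 8 * q * N * eps <= alpha * (a1 - a)).
  { apply le_mul. apply Rle_trans with (1 := Rmin_r _ _), Rmin_r. }
  assert (HdN : eps / N * N = eps) by (field; unfold N; lra).
  (* The extended curvatures vanish for [|x| >= N], so a sup bound [eps / N] bounds their integrals
     from 0 by [eps]. *)
  exists (eps / N). split; [apply Rdiv_lt_0_compat; unfold N; lra|].
  intros k1 k2 Hk1 Hk2 B1 B2.
  assert (HN : 1 <= N) by (unfold N; lra).
  assert (L1 := lipschitz_of_C1_on a1 k1 ltac:(lra) Hk1).
  assert (C1 : continuous_on (segment a1) k1).
  { destruct Hk1 as [dk [Hd _]]. intros x Hx. exact (deriv_within_continuous _ k1 x _ (Hd x Hx)). }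
  destruct (compactly_supported_extension k1 a1 (eps / N) ltac:(lra) C1
    (fun x => Rabs_lt_of_sup_norm _ _ _ x B1)) as [c1 [c1_cont [c1_eq [c1_bound c1_supp]]]].
  destruct (compactly_supported_extension k2 a1 (eps / N) ltac:(lra) Hk2
    (fun x => Rabs_lt_of_sup_norm _ _ _ x B2)) as [c2 [c2_cont [c2_eq [c2_bound c2_supp]]]].
  assert (L2 : lipschitz_on a1 c1).
  { destruct L1 as [L [HL Lip]]. exists L. split; [exact HL|]. intros x y Hx Hy.
    rewrite !c1_eq by assumption. now apply Lip. }
  now apply (PC_graph_representation alpha N eps (eps / N) c1 c2).
Qed.
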